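(* Let $\pi:S^3\to S^2$ be the Hopf map from the unit sphere $S^3\subset\mathbb{C}^2$ to the sphere $S^2\subset\mathbb{C}\times\mathbb{R}$ of radius $1/2$, $\pi(z,w)=\big(z\bar w,\tfrac12(|z|^2-|w|^2)\big)$, and let $\omega$ be the area form of $S^2$. Let $g$ be the round metric of $S^3$, and write $g=g_{\mathcal V}+g_{\mathcal H}$, where $\mathcal V=\ker d\pi$ is the distribution tangent to the fibres of $\pi$, $\mathcal H=\mathcal V^\perp$ is its $g$-orthogonal complement, and $g_{\mathcal V},g_{\mathcal H}$ are the corresponding components of $g$. For $0<t\le 1$ let $g_t=t^2g_{\mathcal V}+g_{\mathcal H}$ (the Berger's sphere metric). Then for every $0<t\le1$ the map $\pi:(S^3,g_t)\to S^2$ minimizes $F$ in its homotopy class: $F(\pi)\le F(\varphi)$ for every smooth map $\varphi:S^3\to S^2$ homotopic to $\pi$, where $F(\varphi)=\frac12\int_{S^3}\|\varphi^*\omega\|^2$ is computed with respect to the metric $g_t$ on $S^3$.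
   Context: All maps are smooth. For a smooth map $\varphi:(M,g)\to(N,\omega)$ from a compact Riemannian manifold to a symplectic manifold, $F(\varphi)=\frac12\int_M\|\varphi^*\omega\|^2\,d\mathrm{vol}_g$, where $\|\cdot\|$ is the pointwise norm on $2$-forms induced by $g$ (for an orthonormal coframe $e^1,\dots,e^m$, the forms $e^i\wedge e^j$, $i<j$, are orthonormal). *)

(* Defs.v *)
From HB Require Import structures.
From mathcomp Require Import all_boot all_order all_algebra.
From mathcomp Require Import all_classical all_reals all_analysis.
Import Order.TTheory GRing.Theory Num.Theory.
Import numFieldNormedType.Exports.

Set Implicit Arguments.
Unset Strict Implicit.
Unset Printing Implicit Defensive.

Local Open Scope classical_set_scope.
Local Open Scope ring_scope.

Section Smoothness.
Variables (R : realType) (m n : nat).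
Implicit Types (U A : set 'rV[R]_m.+1) (f : 'rV[R]_m.+1 -> 'rV[R]_n.+1).

(* For U open this is the class C^k(U): f is C^(k+1) iff f is differentiable
   and all its directional derivatives are C^k. *)
Fixpoint class_C (k : nat) U f : Prop :=
  match k with
  | 0%N => forall x, U x -> {for x, continuous f}
  | k'.+1 => (forall x, U x -> differentiable f x) /\
             (forall v : 'rV[R]_m.+1, class_C k' U (fun x => 'D_v f x))
  end.

(* Smoothness of a map defined on a subset A of Euclidean space: near every
   point of A, f is the restriction of a smooth map on an open set. The values
   of f outside A are irrelevant. *)
Definition smooth_on A f : Prop :=
  forall x, A x -> exists U F,
    [/\ open U, U x, (forall k, class_C k U F) &
        forall y, U y -> A y -> F y = f y].

End Smoothness.

Section Berger.
Variable R : realType.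

(* The norm of 'rV[R]_n in the library is the sup norm, hence this explicit
   Euclidean inner product. *)
Definition dot n (u v : 'rV[R]_n) : R := \sum_i u 0 i * v 0 i.

Definition sphere n (r : R) : set 'rV[R]_n := [set x | dot x x = r ^+ 2].

Definition S3 : set 'rV[R]_4 := @sphere 4 1.
Definition S2 : set 'rV[R]_3 := @sphere 3 2^-1.

Definition tangentS3 (x : 'rV[R]_4) : set 'rV[R]_4 := [set v | dot x v = 0].

(* Maps S^3 -> S^2 are represented by functions 'rV_4 -> 'rV_3 of which only
   the values on S3 matter. *)
Definition smooth_S3_S2 (f : 'rV[R]_4 -> 'rV[R]_3) : Prop :=
  (forall x, S3 x -> S2 (f x)) /\ smooth_on S3 f.

Definition homotopic_S3_S2 (f0 f1 : 'rV[R]_4 -> 'rV[R]_3) : Prop :=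
  exists H : R * 'rV[R]_4 -> 'rV[R]_3,
    [/\ {within `[0, 1]%classic `*` S3, continuous H},
        (forall (s : R) x, s \in `[0, 1] -> S3 x -> S2 (H (s, x))),
        (forall x, S3 x -> H (0, x) = f0 x) &
        (forall x, S3 x -> H (1, x) = f1 x)].

Definition normalize (x : 'rV[R]_4) : 'rV[R]_4 := (Num.sqrt (dot x x))^-1 *: x.

(* The differential at x \in S3 of a map f on S3: for v tangent to S3 at x,
   s |-> normalize (x + s *: v) is a curve in S3 with initial velocity v. *)
Definition dS3 (f : 'rV[R]_4 -> 'rV[R]_3) (x v : 'rV[R]_4) : 'rV[R]_3 :=
  'D_v (f \o normalize) x.

(* z = x_0 + i x_1, w = x_2 + i x_3, and C * R is identified with R^3:
   z (conj w) = (x_0 x_2 + x_1 x_3) + i (x_1 x_2 - x_0 x_3). *)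
Definition hopf (x : 'rV[R]_4) : 'rV[R]_3 :=
  let c (k : nat) : R := x 0 (inord k) in
  \row_(j < 3) [:: c 0%N * c 2%N + c 1%N * c 3%N;
                   c 1%N * c 2%N - c 0%N * c 3%N;
                   2^-1 * ((c 0%N ^+ 2 + c 1%N ^+ 2) - (c 2%N ^+ 2 + c 3%N ^+ 2))]`_j.

(* 2 *: y is the outward unit normal of S2 at y. *)
Definition area_form (y u v : 'rV[R]_3) : R :=
  \det (col_mx (2 *: y) (col_mx u v) : 'M[R]_3).

Definition pullback_area (f : 'rV[R]_4 -> 'rV[R]_3) (x u v : 'rV[R]_4) : R :=
  area_form (f x) (dS3 f x u) (dS3 f x v).

(* A Riemannian metric g on S3 is given as g x u v, where x \in S3 and u, v are
   tangent to S3 at x. *)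
Definition metric := 'rV[R]_4 -> 'rV[R]_4 -> 'rV[R]_4 -> R.

(* Gram matrix of the three vectors which are the rows of e. *)
Definition gram (g : metric) (x : 'rV[R]_4) (e : 'M[R]_(3, 4)) : 'M[R]_3 :=
  \matrix_(i, j) g x (row i e) (row j e).

Definition orthonormal_frame (g : metric) (x : 'rV[R]_4) : set 'M[R]_(3, 4) :=
  [set e | (forall i, tangentS3 x (row i e)) /\ gram g x e = 1%:M].

(* The squared norm of a 2-form a at x. If (e_i) is a g-orthonormal frame with
   dual coframe (e^i), then a = \sum_(i < j) a e_i e_j e^i /\ e^j; the value
   does not depend on the frame, which is picked by choice. *)
Definition sqnorm_form2 (g : metric) (x : 'rV[R]_4)
    (a : 'rV[R]_4 -> 'rV[R]_4 -> R) : R :=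
  let e := xget 0 (orthonormal_frame g x) in
  \sum_(i < 3) \sum_(j < 3 | (i < j)%N) a (row i e) (row j e) ^+ 2.

Definition vertical (x : 'rV[R]_4) : set 'rV[R]_4 :=
  [set v | tangentS3 x v /\ dS3 hopf x v = 0].

Definition horizontal (x : 'rV[R]_4) : set 'rV[R]_4 :=
  [set v | tangentS3 x v /\ forall w, vertical x w -> dot v w = 0].

(* Components of a tangent vector in T_x S^3 = V_x (+) H_x. *)
Definition vpart (x v : 'rV[R]_4) : 'rV[R]_4 :=
  xget 0 [set u | vertical x u /\ horizontal x (v - u)].
Definition hpart (x v : 'rV[R]_4) : 'rV[R]_4 := v - vpart x v.

Definition berger (t : R) : metric := fun x u v =>
  t ^+ 2 * dot (vpart x u) (vpart x v) + dot (hpart x u) (hpart x v).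

(* For (a, b, c) in the open box ]0, pi/2[ * ]0, 2 pi[ * ]0, 2 pi[ this is the
   parametrization z = cos a e^(ib), w = sin a e^(ic): a diffeomorphism onto an
   open subset of S^3 whose complement (z or w is in [0, +oo[) is null. *)
Definition param (a b c : R) : 'rV[R]_4 :=
  \row_(j < 4) [:: cos a * cos b; cos a * sin b; sin a * cos c; sin a * sin c]`_j.

Definition param_dom : set (R * R * R) :=
  (`]0, pi / 2[%classic `*` `]0, 2 * pi[%classic) `*` `]0, 2 * pi[%classic.

Definition param_frame (a b c : R) : 'M[R]_(3, 4) :=
  col_mx (derive1 (fun s => param s b c) a)
    (col_mx (derive1 (fun s => param a s c) b)
            (derive1 (fun s => param a b s) c)).

(* Integral of h over S^3 for the Riemannian volume of g, i.e. in the above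
   coordinates for the density sqrt (det (g_ij)). *)
Definition integral_S3 (g : metric) (h : 'rV[R]_4 -> R) : \bar R :=
  (\int[(lebesgue_measure \x lebesgue_measure) \x lebesgue_measure]_(p in param_dom)
    (h (param p.1.1 p.1.2 p.2) *
     Num.sqrt (\det (gram g (param p.1.1 p.1.2 p.2)
                           (param_frame p.1.1 p.1.2 p.2))))%:E)%E.

Definition energy (g : metric) (f : 'rV[R]_4 -> 'rV[R]_3) : \bar R :=
  ((2^-1)%:E *
    integral_S3 g (fun x => sqnorm_form2 g x (pullback_area f x)))%E.

End Berger.

(* Main.v *)
Require Import Defs.
From HB Require Import structures.
From mathcomp Require Import all_boot all_order all_algebra.
From mathcomp Require Import all_classical all_reals all_analysis.
From mathcomp Require Import measurable_realfun ring lra.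
Import Order.TTheory GRing.Theory Num.Theory.
Import numFieldNormedType.Exports.

Set Implicit Arguments.
Unset Strict Implicit.
Unset Printing Implicit Defensive.

Local Open Scope classical_set_scope.
Local Open Scope ring_scope.

(* A map phi homotopic to pi is pi o psi for a smooth psi : S^3 -> S^3 of degree one: along the homotopy, a lift of one map is carried to a nearby map by projecting it onto the complex lines which that map prescribes, and the degree, written as the integral of the Jacobian, does not change. Let X1 = I, X2 = J, X3 = K be the quaternionic frame of S^3, with X1 tangent to the fibres of pi, let a_i = <i psi, X_i psi> be the components of the pulled back contact form, and b = curl a. Up to sign the components of phi^* omega in this frame are b_i / 2, and the integral of a . b is twice that of the Jacobian, i.e. 2 vol(S^3). The first eigenvalue of the curl being 2, the integral of |b|^2 is at least 4 vol(S^3), with equality for pi, where b = (2, 0, 0) up to sign. For t <= 1 the metric g_t multiplies the squares of the components b_2 and b_3 by t^-2 >= 1, and the volume by t. The eigenvalue estimate follows from a Bochner identity applied to a minus a polynomial gradient that makes its divergence small in L^2, the integral of a . b being unchanged. *)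

(** * Functions of class C^k *)

(** The homotopy is only continuous, so it cannot be lifted smoothly as a whole. Time is cut into
    small steps, each intermediate map is replaced by a polynomial approximation p, and only
    approximate lifts are kept. Projecting a lift of error 1/20 already gives lifts of any accuracy
    for the next map, so errors do not accumulate; at the last step phi is smooth, p = phi is
    allowed and the lift is exact. The gauge step would classically solve a Poisson equation.
    Instead, the fields X_i do not raise the degree of polynomials, so the Galerkin projection of a
    onto gradients of polynomials of degree d leaves a divergence orthogonal to all polynomials of
    degree d, and a Weierstrass approximation of div a makes it small. The constant stays sharp
    because 4 a . b <= |b|^2 + 4 |a|^2 is an equality when b = 2 a. All integrations by parts reduce
    to the vanishing of the integral of X_i h. In Hopf coordinates X_i has poles on the two
    degenerate circles; the volume density removes them. *)

Section Germs.
Variables (R : realType) (V W : normedModType R).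
Implicit Types (f g : V -> W).

Lemma open_near_eq (U : set V) f g x : open U -> (forall y, U y -> f y = g y) -> U x ->
  \forall y \near x, f y = g y.
Proof.
by move=> oU fg Ux; have := open_nbhs_nbhs (conj oU Ux); exact: filterS.
Qed.

Lemma differentiable_of f x (df : {linear V -> W}) :
  continuous df -> f \o shift x = cst (f x) + df +o_ 0 id -> differentiable f x.
Proof.
by move=> dfc dxf; apply/diff_locallyP; rewrite (diff_unique dfc dxf); split.
Qed.

Lemma near_eq_differentiable f g x :
  (\near x, f x = g x) -> differentiable f x -> differentiable g x.
Proof.
move=> fg df.
have fx : f x = g x by apply: nbhs_singleton fg.
apply: (@differentiable_of _ _ ('d f x)); first exact: diff_continuous.
have /diff_locallyP[_ /eqaddoP h] := df.
apply/eqaddoP => _/posnumP[e]; have := h e%:num [gt0 of e%:num].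
have : \forall y \near (0:V), f (y + x) = g (y + x).
  move: fg; rewrite (near_shift 0) /=; apply: filterS => y /=.
  by rewrite subr0.
apply: filterS2 => y /= fgy; rewrite /cst /= !fctE.
by rewrite /= fgy fx.
Qed.

End Germs.

Section Ck.
Variables (R : realType) (m : nat).
Local Notation V := 'rV[R]_m.+1.
Implicit Types (U : set V) (f g : V -> R).

(** The scalar counterpart of [class_C], where products and inverses make sense; maps into row
    vectors are treated one coordinate at a time. *)
Fixpoint Ck (k : nat) U f : Prop :=
  match k with
  | 0%N => forall x, U x -> {for x, continuous f}
  | k'.+1 => (forall x, U x -> differentiable f x) /\
             (forall v : V, Ck k' U (fun x => 'D_v f x))
  end.

Lemma Ck_ext k U f g : open U -> (forall y, U y -> f y = g y) -> Ck k U f -> Ck k U g.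
Proof.
move=> oU; elim: k f g => [|k IH] f g fg /=.
  move=> fc x Ux; have fgx := open_near_eq oU fg Ux.
  rewrite /prop_for /continuous_at -(fg x Ux).
  by move=> P /(fc x Ux) /=; apply: filterS2 fgx => y /= ->.
move=> [df dk]; split=> [x Ux|v].
  by apply: near_eq_differentiable (df x Ux); apply: (open_near_eq oU fg Ux).
apply: IH (dk v) => y Uy; apply: near_eq_derive; apply: (open_near_eq oU fg Uy).
Qed.

Lemma Ck_diff k U f x : Ck k.+1 U f -> U x -> differentiable f x.
Proof. by case=> + _; apply. Qed.

Lemma CkS k U f : Ck k.+1 U f -> Ck k U f.
Proof.
elim: k f => [|k IH] f [df dk].
  by move=> x Ux; apply: differentiable_continuous; exact: df.
by split=> // v; apply: IH; exact: dk.
Qed.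

Lemma Ck_sub k U U' f : U' `<=` U -> Ck k U f -> Ck k U' f.
Proof.
move=> s; elim: k f => [|k IH] f /= H; first by move=> x /s; exact: H.
by case: H => df dk; split=> [x /s|v]; [exact: df|exact/IH/dk].
Qed.

Lemma derivable_Ck k U f x v : Ck k.+1 U f -> U x -> derivable f x v.
Proof. by move=> c Ux; apply: diff_derivable; exact: Ck_diff c Ux. Qed.

Lemma Ck_cst k U (c : R) : Ck k U (fun _ => c).
Proof.
elim: k c => [|k IH] c /=; first by move=> x _; exact: cst_continuous.
split=> [x _|v]; first exact: differentiable_cst.
have -> : (fun x : V => 'D_v (fun=> c) x) = (fun=> 0) by apply/funext => x; rewrite derive_cst.
exact: IH.
Qed.

Lemma CkD k U f g : open U -> Ck k U f -> Ck k U g -> Ck k U (fun x => f x + g x).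
Proof.
move=> oU; elim: k f g => [|k IH] f g cf cg /=.
  by move=> x Ux; exact: (cvgD (cf x Ux) (cg x Ux)).
split=> [x Ux|v].
  by apply: differentiableD; [exact: Ck_diff cf Ux|exact: Ck_diff cg Ux].
apply: (@Ck_ext _ _ (fun x => 'D_v f x + 'D_v g x)) => //.
  by move=> x Ux; rewrite -deriveD//; [exact: derivable_Ck cf Ux|exact: derivable_Ck cg Ux].
by apply: IH; [exact: cf.2|exact: cg.2].
Qed.

Lemma CkM k U f g : open U -> Ck k U f -> Ck k U g -> Ck k U (fun x => f x * g x).
Proof.
move=> oU; elim: k f g => [|k IH] f g cf cg /=.
  by move=> x Ux; exact: (cvgM (cf x Ux) (cg x Ux)).
split=> [x Ux|v].
  by apply: differentiableM; [exact: Ck_diff cf Ux|exact: Ck_diff cg Ux].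
apply: (@Ck_ext _ _ (fun x => f x * 'D_v g x + g x * 'D_v f x)) => //.
  by move=> x Ux; rewrite -deriveM//; [exact: derivable_Ck cf Ux|exact: derivable_Ck cg Ux].
by apply: CkD => //; apply: IH; [exact: CkS|exact: cg.2|exact: CkS|exact: cf.2].
Qed.

Lemma CkV k U f : open U -> (forall x, U x -> f x != 0) -> Ck k U f -> Ck k U (fun x => (f x)^-1).
Proof.
move=> oU f0; elim: k => [|k IH] cf /=.
  by move=> x Ux; exact: (cvgV (f0 x Ux) (cf x Ux)).
split=> [x Ux|v].
  by apply: differentiableV; [exact: Ck_diff cf Ux|exact: f0].
apply: (@Ck_ext _ _ (fun x => (-1) * ((f x)^-1 * (f x)^-1) * 'D_v f x)) => //.
  move=> x Ux; rewrite deriveV//; last exact: derivable_Ck cf Ux.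
    by rewrite mulN1r -invfM expr2.
  exact: f0.
apply: CkM => //; last exact: cf.2.
by apply: CkM => //; [exact: Ck_cst|apply: CkM => //; exact/IH/CkS].
Qed.

Lemma Ck_coord k U j : Ck k U (fun x => x 0 j).
Proof.
case: k => [|k] /=; first by move=> x _; exact: coord_continuous.
split=> [x _|v]; first exact: differentiable_coord.
have -> : (fun x : V => 'D_v (fun x : V => x 0 j) x) = (fun=> v 0 j).
  apply/funext => x.
  have := @derive_mx R V 1 m.+1 id x v (@derivable_id _ _ _ _).
  by rewrite derive_id => /matrixP/(_ 0 j); rewrite mxE.
exact: Ck_cst.
Qed.

Lemma differentiable_coords n (f : V -> 'rV[R]_n.+1) x :
  (forall j, differentiable (fun y => f y 0 j) x) -> differentiable f x.
Proof.
move=> df.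
have -> : f = \sum_(j < n.+1) (fun y => f y 0 j *: delta_mx 0 j).
  apply/funext => y; rewrite fct_sumE [LHS]row_sum_delta //.
by apply: differentiable_sum => j; apply: differentiableZl.
Qed.

Lemma coord_derive n (f : V -> 'rV[R]_n.+1) x v j : derivable f x v ->
  ('D_v f x) 0 j = 'D_v (fun y => f y 0 j) x.
Proof. by move=> df; rewrite derive_mx // mxE. Qed.

Lemma differentiable_coord_comp n (f : V -> 'rV[R]_n.+1) x j : differentiable f x ->
  differentiable (fun y => f y 0 j) x.
Proof.
move=> df; apply: (@differentiable_comp _ _ _ _ f (fun M : 'rV[R]_n.+1 => M 0 j)) => //.
exact: differentiable_coord.
Qed.

Lemma derive_linear (W : normedModType R) (f : V -> W) x : differentiable f x ->
  forall a u v, 'D_(a *: u + v) f x = a *: 'D_u f x + 'D_v f x.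
Proof. by move=> df a u v; rewrite !deriveE // linearP. Qed.

Lemma derive_coord_sum (W : normedModType R) (f : V -> W) x v : differentiable f x ->
  'D_v f x = \sum_j v 0 j *: 'D_(delta_mx 0 j) f x.
Proof.
move=> df; rewrite deriveE // {1}(row_sum_delta v) linear_sum.
by apply: eq_bigr => j _; rewrite linearZ deriveE.
Qed.

Lemma derive_comp n (f : V -> 'rV[R]_n.+1) (g : 'rV[R]_n.+1 -> R) x v :
  differentiable f x -> differentiable g (f x) ->
  'D_v (fun y => g (f y)) x = 'D_('D_v f x) g (f x).
Proof.
move=> df dg.
rewrite -[LHS]/('D_v (g \o f) x).
rewrite (deriveE v (differentiable_comp df dg)) (deriveE v df) (deriveE _ dg).
by rewrite (diff_comp df dg).
Qed.

End Ck.

Lemma class_C_Ck (R : realType) m n k U (F : 'rV[R]_m.+1 -> 'rV[R]_n.+1) j : open U ->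
  class_C k U F -> Ck k U (fun x => F x 0 j).
Proof.
move=> oU; elim: k F => [|k IH] F /=.
  move=> cF x Ux; apply: (@continuous_comp _ _ _ F (fun M : 'rV[R]_n.+1 => M 0 j)); first exact: cF.
  exact: coord_continuous.
move=> [df dk]; split=> [x Ux|v].
  by apply: differentiable_coord_comp; exact: df.
apply: (@Ck_ext _ _ _ _ (fun x => ('D_v F x) 0 j)) => //; last by apply: IH.
by move=> x Ux; rewrite coord_derive //; apply: diff_derivable; exact: df.
Qed.

Lemma coords_cvg (R : realType) (T : Type) (F : set_system T) {FF : Filter F} n
   (f : T -> 'rV[R]_n.+1) (l : 'rV[R]_n.+1) : (forall j, (fun x => f x 0 j) @ F --> l 0 j) -> f @ F --> l.
Proof.
move=> fl; apply/cvgrPdist_le => e e0; near=> x.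
rewrite /Num.Def.normr/= mx_normrE (bigmax_le _ (ltW e0))//= => -[i j] _.
rewrite !mxE/= ord1; move: j; near: x; apply: filter_forall => /= j.
by move: (fl j) => /cvgrPdist_le; exact.
Unshelve. all: by end_near. Qed.

Lemma Ck_sum (R : realType) m k U n (F : 'I_n -> 'rV[R]_m.+1 -> R) : open U ->
  (forall i, Ck k U (F i)) -> Ck k U (fun x => \sum_i F i x).
Proof.
move=> oU; elim: n F => [|n IH] F cF.
  apply: (@Ck_ext _ _ _ _ (fun=> 0)) => //; first by move=> y _; rewrite big_ord0.
  exact: Ck_cst.
apply: (@Ck_ext _ _ _ _ (fun x => F ord0 x + \sum_i F (lift ord0 i) x)) => //.
  by move=> x _; rewrite big_ord_recl.
by apply: CkD => //; exact: (IH (fun i => F (lift ord0 i))).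
Qed.

Lemma Ck_comp (R : realType) m n k (U : set 'rV[R]_m.+1) (U' : set 'rV[R]_n.+1)
   (f : 'rV[R]_m.+1 -> 'rV[R]_n.+1) g : open U -> open U' ->
  (forall x, U x -> U' (f x)) ->
  (forall j, Ck k U (fun x => f x 0 j)) -> Ck k U' g -> Ck k U (fun x => g (f x)).
Proof.
move=> oU oU' fU; elim: k g => [|k IH] g cf cg /=.
  move=> x Ux; apply: (@continuous_comp _ _ _ f g); last by apply: cg; exact: fU.
  by apply: (@coords_cvg _ _ (nbhs x) _ _ f (f x)) => j; exact: cf.
have df x : U x -> differentiable f x.
  by move=> Ux; apply: differentiable_coords => j; exact: Ck_diff (cf j) Ux.
split=> [x Ux|v].
  apply: (@differentiable_comp _ _ _ _ f g); first exact: df.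
  by apply: Ck_diff cg _; exact: fU.
apply: (@Ck_ext _ _ _ _ (fun x => \sum_j 'D_v (fun y => f y 0 j) x * 'D_(delta_mx 0 j) g (f x))) => //.
  move=> x Ux; have dg : differentiable g (f x) by apply: Ck_diff cg _; exact: fU.
  rewrite derive_comp //; last exact: df.
  rewrite [RHS]derive_coord_sum //; apply: eq_bigr => j _.
  by rewrite coord_derive //; apply: diff_derivable; exact: df.
apply: Ck_sum => // j; apply: CkM => //; first by have [_] := cf j; apply.
by apply: (IH ('D_(delta_mx 0 j) g)); [move=> i; exact/CkS/cf|exact: cg.2].
Qed.

(** * Derivatives along curves and symmetry of second derivatives *)

Section Curves.
Variables (R : realType) (V W : normedModType R).

Lemma is_derive_curve (f : V -> W) (c : R -> V) (s : R) (w : V) :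
  is_derive s 1 c w -> differentiable f (c s) ->
  is_derive s 1 (f \o c) ('D_w f (c s)).
Proof.
move=> dc df; have Dc : differentiable c s by apply/derivable1_diffP; exact: ex_derive.
have Dfc := differentiable_comp Dc df.
apply: DeriveDef; first exact: diff_derivable.
by rewrite deriveE // (diff_comp Dc df) /= -(deriveE _ Dc) derive_val deriveE.
Qed.

Lemma is_derive_line (f : V -> W) (y u : V) (s : R) :
  differentiable f (y + s *: u) ->
  is_derive s 1 (fun s => f (y + s *: u)) ('D_u f (y + s *: u)).
Proof.
move=> df; apply: (@is_derive_curve f (fun s => y + s *: u)) => //.
have -> : (fun s : R => y + s *: u) = (cst y + ( *:%R ^~ u)) :> (R -> V) by [].
apply: DeriveDef; first by apply: diff_derivable.
rewrite deriveE // diffD // diff_cst /= add0r.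
by rewrite diff_val scale1r.
Qed.

End Curves.

Lemma near_continuous2 (R : realType) (T : topologicalType) (x : T) (U : set T) (P Q : T -> R) (e : R) :
  nbhs x U -> {for x, continuous P} -> {for x, continuous Q} -> 0 < e ->
  \forall y \near x, [/\ U y, `|P x - P y| < e & `|Q x - Q y| < e].
Proof.
move=> H1 /cvgrPdist_lt H2 /cvgrPdist_lt H3 e0.
by apply: filterS3 H1 (H2 _ e0) (H3 _ e0) => y *; split.
Qed.

Lemma dist_near (R : realType) (X Y Z e : R) : `|Y - Z| < e / 2 -> `|X - Z| < e / 2 -> `|X - Y| <= e.
Proof. by rewrite !ltr_norml ler_norml; lra. Qed.

Lemma MVT_from0 (R : realType) (f df : R -> R) (h : R) : 0 < h ->
  (forall a, 0 <= a <= h -> is_derive a 1 f (df a)) ->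
  exists2 a : R, 0 <= a <= h & f h - f 0 = df a * h.
Proof.
move=> h0 dp.
have itv (a : R) : a \in `]0, h[%R -> 0 <= a <= h.
  by rewrite in_itv /= => /andP[a0 ah]; rewrite !ltW.
have [|a ah fE] := @MVT R f df 0 h h0 (fun a ah => dp a (itv a ah)).
  by apply: derivable_within_continuous => a; rewrite in_itv /= => ah; have [] := dp a ah.
by exists a; [exact: itv|rewrite fE subr0].
Qed.

Section Clairaut.
Variables (R : realType) (m : nat).
Local Notation V := 'rV[R]_m.+1.

(** The mean value theorem is used twice: along u for the increment of f in the direction v, then
    along v for the derivative in the direction u. *)
Lemma second_difference (f : V -> R) (x u v : V) (h : R) : 0 < h ->
  (forall a b : R, 0 <= a <= h -> 0 <= b <= h -> differentiable f (x + a *: u + b *: v)) ->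
  (forall a b : R, 0 <= a <= h -> 0 <= b <= h -> differentiable ('D_u f) (x + a *: u + b *: v)) ->
  exists a b : R, [/\ 0 <= a <= h, 0 <= b <= h &
    f (x + h *: u + h *: v) - f (x + h *: u) - f (x + h *: v) + f x =
    h ^+ 2 * 'D_v ('D_u f) (x + a *: u + b *: v)].
Proof.
move=> h0 df ddf.
have hh : 0 <= h <= h by rewrite lexx ltW.
have h00 : 0 <= (0:R) <= h by rewrite lexx ltW.
have sw (a b : R) : x + b *: v + a *: u = x + a *: u + b *: v by rewrite addrAC.
have df0 (a : R) : 0 <= a <= h -> differentiable f (x + a *: u).
  by move=> ah; have := df a 0 ah h00; rewrite scale0r addr0.
pose p (a : R) : R := f (x + h *: v + a *: u) - f (x + a *: u).
have dp (a : R) : 0 <= a <= h -> is_derive a 1 p ('D_u f (x + h *: v + a *: u) - 'D_u f (x + a *: u)).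
  move=> ah; apply: is_deriveB.
    by apply: is_derive_line; rewrite sw; exact: df.
  by apply: is_derive_line; exact: df0.
have [a ah pE] := MVT_from0 h0 dp.
pose q (b : R) : R := 'D_u f (x + a *: u + b *: v).
have dq (b : R) : 0 <= b <= h -> is_derive b 1 q ('D_v ('D_u f) (x + a *: u + b *: v)).
  by move=> bh; apply: is_derive_line; exact: ddf.
have [b bh qE] := MVT_from0 h0 dq.
exists a, b; split => //.

move: pE qE; rewrite /p /q !scale0r !addr0 !sw => pE qE.
rewrite qE in pE.
by rewrite mulrC expr2 mulrA -pE opprB (addrC (f x)) addrA.
Qed.

(** The second difference of f is symmetric in u and v, so each mixed derivative takes a common
    value at points arbitrarily close to x; both are continuous at x. *)
Lemma Clairaut (f : V -> R) (U : set V) (x u v : V) : open U -> U x -> Ck 2 U f ->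
  'D_u ('D_v f) x = 'D_v ('D_u f) x.
Proof.
move=> oU Ux [df dk].
have cc w w' : {for x, continuous ('D_w ('D_w' f))}.
  by have [_] := dk w'; apply.
apply/eqP; rewrite -subr_eq0 -normr_le0; apply/ler_addgt0Pl => e e0; rewrite addr0.
have e20 : 0 < e / 2 by rewrite divr_gt0.
have N := near_continuous2 (open_nbhs_nbhs (conj oU Ux)) (cc u v) (cc v u) e20.
move/nbhs_ballP : N => [d /= d0 N].
(* With this h the parallelogram with sides h u and h v stays within distance d/2 of x, hence inside
   the ball of radius d. *)
pose h := d / 2 / (1 + `|u| + `|v|).
have p0 : 0 < 1 + `|u| + `|v| by rewrite -addrA ltr_pwDl.
have h0 : 0 < h by rewrite !divr_gt0.
have inb a b : 0 <= a <= h -> 0 <= b <= h -> ball x d (x + a *: u + b *: v).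
  move=> /andP[a0 ah] /andP[b0 bh]; rewrite -ball_normE /= opprD addrA opprD addrA subrr add0r.
  rewrite -opprD normrN (le_lt_trans (ler_normD _ _)) // !normrZ !ger0_norm //.
  have : a * `|u| + b * `|v| <= h * (1 + `|u| + `|v|).
    by rewrite !mulrDr mulr1 -addrA ler_wpDl ?(ltW h0) // lerD // ler_wpM2r.
  move=> /le_lt_trans; apply; rewrite /h divfK ?gt_eqF //; lra.
have Ub a b : 0 <= a <= h -> 0 <= b <= h -> U (x + a *: u + b *: v).
  by move=> ah bh; have [] := N _ (inb a b ah bh).
have [a [b [ah bh E1]]] : exists a b : R, [/\ 0 <= a <= h, 0 <= b <= h &
    f (x + h *: u + h *: v) - f (x + h *: u) - f (x + h *: v) + f x =
    h ^+ 2 * 'D_v ('D_u f) (x + a *: u + b *: v)].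
  apply: second_difference => // a b ah bh; first by apply: df; exact: Ub.
  by have [+ _] := dk u; apply; exact: Ub.
have [a' [b' [ah' bh' E2]]] : exists a b : R, [/\ 0 <= a <= h, 0 <= b <= h &
    f (x + h *: v + h *: u) - f (x + h *: v) - f (x + h *: u) + f x =
    h ^+ 2 * 'D_u ('D_v f) (x + a *: v + b *: u)].
  apply: second_difference => // a' b' ah' bh'; first by rewrite addrAC; apply: df; exact: Ub.
  by rewrite addrAC; have [+ _] := dk v; apply; exact: Ub.
have E : 'D_v ('D_u f) (x + a *: u + b *: v) = 'D_u ('D_v f) (x + b' *: u + a' *: v).
  apply: (mulfI (lt0r_neq0 (exprn_gt0 2 h0))).
  apply: (etrans (esym E1)); apply: (etrans _ (etrans E2 _)).
    by rewrite (addrAC x (h *: v) (h *: u)); congr (_ + _); exact: addrAC.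
  by congr (_ * 'D_u ('D_v f) _); exact: addrAC.
have [_ _ B1] := N _ (inb a b ah bh).
have [_ B2 _] := N _ (inb b' a' bh' ah').
move: B1 B2; rewrite E.
by move=> B1 B2; exact: (dist_near B1 B2).
Qed.

End Clairaut.

(** * Polynomials *)

Section BinomialMean.
Variable R : realType.
Implicit Types (y : R) (g h : nat -> R).

(* The mean of g over a binomial law with parameters n and y, i.e. the value at y of the n-th Bernstein polynomial of k/n |-> g k; the recursion conditions on one trial. *)
Fixpoint bmean (n : nat) y g : R :=
  if n is n'.+1 then y * bmean n' y (fun k => g k.+1) + (1 - y) * bmean n' y g
  else g 0%N.

Lemma eq_bmean n y g h : g =1 h -> bmean n y g = bmean n y h.
Proof. by move=> /funext ->. Qed.

Lemma bmean_cst n y c : bmean n y (fun=> c) = c.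
Proof. by elim: n => //= n ->; ring. Qed.

Lemma bmeanD n y g h : bmean n y (fun k => g k + h k) = bmean n y g + bmean n y h.
Proof. by elim: n g h => //= n IH g h; rewrite !IH; ring. Qed.

Lemma bmeanZ n y c g : bmean n y (fun k => c * g k) = c * bmean n y g.
Proof. by elim: n g => //= n IH g; rewrite !IH; ring. Qed.

Lemma le_bmean n y g h : 0 <= y <= 1 -> (forall k, g k <= h k) ->
  bmean n y g <= bmean n y h.
Proof.
move=> /andP[y0 y1]; elim: n g h => //= n IH g h gh.
by rewrite lerD // ler_wpM2l ?subr_ge0 // IH.
Qed.

(** Variance plus squared bias. The centre c is arbitrary because conditioning on one trial shifts
    it to c - 1 in the induction. *)
Lemma bmean_sqr n y c :
  bmean n y (fun k => (k%:R - c) ^+ 2) = n%:R * y * (1 - y) + (n%:R * y - c) ^+ 2.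
Proof.
elim: n c => [|n IH] c /=; first by ring.
rewrite IH (@eq_bmean n y _ (fun k => (k%:R - (c - 1)) ^+ 2)) => [|k]; last by rewrite -natr1; ring.
by rewrite IH -natr1; ring.
Qed.

End BinomialMean.

Section Span.
Variables (R : realType) (T : Type).
Implicit Types (s : seq (T -> R)) (p q : T -> R).

Definition span s p := exists c : nat -> R,
  forall x, p x = \sum_(i < size s) c i * nth (fun=> 0) s i x.

Lemma span_nil p : (forall x, p x = 0) -> span [::] p.
Proof. by move=> p0; exists (fun=> 0) => x; rewrite big_ord0. Qed.

Lemma span_cons s q p : span (q :: s) p <->
  exists a p', span s p' /\ forall x, p x = a * q x + p' x.
Proof.
split=> [[c pE]|[a [p' [[c p'E] pE]]]].
  exists (c 0%N), (fun x => \sum_(i < size s) c i.+1 * nth (fun=> 0) s i x).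
  split; first by exists (fun i => c i.+1).
  by move=> x; rewrite pE /= big_ord_recl.
exists (fun i => if i is j.+1 then c j else a) => x.
by rewrite /= big_ord_recl pE p'E.
Qed.

Lemma span_eq s p q : (forall x, p x = q x) -> span s p -> span s q.
Proof. by move=> /funext ->. Qed.

Lemma spanD s p q : span s p -> span s q -> span s (fun x => p x + q x).
Proof.
move=> [c pE] [d qE]; exists (fun i => c i + d i) => x.
by rewrite pE qE -big_split; apply: eq_bigr => i _; rewrite mulrDl.
Qed.

Lemma spanZ s a p : span s p -> span s (fun x => a * p x).
Proof.
move=> [c pE]; exists (fun i => a * c i) => x.
by rewrite pE mulr_sumr; apply: eq_bigr => i _; rewrite mulrA.
Qed.

Lemma span0 s : span s (fun=> 0).
Proof. by exists (fun=> 0) => x; rewrite big1 // => i _; rewrite mul0r. Qed.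

Fixpoint each (P : (T -> R) -> Prop) s : Prop :=
  if s is q :: s' then P q /\ each P s' else True.

Lemma each_cat P s s' : each P s -> each P s' -> each P (s ++ s').
Proof. by move=> + Ps'; elim: s => //= q s IH [Pq /IH]. Qed.

Lemma each_map P (L : (T -> R) -> T -> R) s :
  each (fun q => P (L q)) s -> each P (map L s).
Proof. by elim: s => //= q s IH [Pq /IH]. Qed.

Lemma map_each P (L : (T -> R) -> T -> R) s :
  each P (map L s) -> each (fun q => P (L q)) s.
Proof. by elim: s => //= q s IH [Pq /IH]. Qed.

Lemma each_imp (P Q : (T -> R) -> Prop) s : (forall q, P q -> Q q) -> each P s -> each Q s.
Proof. by move=> PQ; elim: s => //= q s IH [/PQ Pq /IH]. Qed.

Lemma each_flatten_map P (I : Type) (F : I -> seq (T -> R)) (js : seq I) :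
  (forall j, each P (F j)) -> each P (flatten (map F js)).
Proof. by move=> H; elim: js => //= j js IH; exact: each_cat. Qed.

Lemma span_ind (P Q : (T -> R) -> Prop) s p : P (fun=> 0) ->
  (forall a q p', Q q -> P p' -> P (fun x => a * q x + p' x)) ->
  each Q s -> span s p -> P p.
Proof.
move=> P0 PD; elim: s p => [|q s IH] p /=.
  by move=> _ [c /funext ->]; move: P0; congr P; apply/funext => x; rewrite big_ord0.
move=> [Qq Qs] /span_cons[a [p' [sp' /funext ->]]].
by apply: PD => //; exact: IH.
Qed.

Lemma span_self s : each (span s) s.
Proof.
elim: s => //= q s IH; split.
  by apply/span_cons; exists 1, (fun=> 0); split; [exact: span0|move=> x; rewrite mul1r addr0].
apply: each_imp IH => p sp; apply/span_cons; exists 0, p; split => // x.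
by rewrite mul0r add0r.
Qed.

Lemma span_catr s s' p : span s' p -> span (s ++ s') p.
Proof.
move=> sp; elim: s => //= q s IH; apply/span_cons; exists 0, p; split => // x.
by rewrite mul0r add0r.
Qed.

Lemma span_catl s s' p : span s p -> span (s ++ s') p.
Proof.
elim: s p => [|q s IH] p.
  by move=> [c pE]; apply: span_eq (span0 _) => x; rewrite pE big_ord0.
move=> /span_cons[a [p' [sp' pE]]].
by apply/span_cons; exists a, p'; split => //; exact: IH.
Qed.

Lemma each_nth P s i : P (fun=> 0) -> each P s -> P (nth (fun=> 0) s i).
Proof. by move=> P0; elim: s i => [|q s IH] [|i] //= [Pq /IH]. Qed.

Lemma span_flatten_map (I : eqType) (F : I -> seq (T -> R)) (js : seq I) j p : j \in js ->
  span (F j) p -> span (flatten (map F js)) p.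
Proof.
move=> jl sp; elim: js jl => //= i l IH; rewrite inE => /orP[/eqP <-|/IH].
  exact: span_catl.
exact: span_catr.
Qed.

End Span.

Section Polynomials.
Variable R : realType.
Local Notation V := 'rV[R]_4.
Implicit Types (p q : V -> R).

Definition mulcoord (j : 'I_4) p : V -> R := fun x => x 0 j * p x.

(** The family generates the polynomials of degree at most n but has repetitions from n = 2 on, and
    constants have zero gradient, so the Gram matrix of gradients built on it may be singular. *)
Fixpoint polybasis (n : nat) : seq (V -> R) :=
  if n is n'.+1 then
    polybasis n' ++ flatten [seq map (mulcoord j) (polybasis n') | j <- enum 'I_4]
  else [:: fun=> 1].

Definition polydeg n p := span (polybasis n) p.

Lemma polydeg_eq n p q : (forall x, p x = q x) -> polydeg n p -> polydeg n q.
Proof. exact: span_eq. Qed.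

Lemma polydegS n p : polydeg n p -> polydeg n.+1 p.
Proof. exact: span_catl. Qed.

Lemma polydeg_le n m p : (n <= m)%N -> polydeg n p -> polydeg m p.
Proof.
by move=> /subnK <-; elim: (m - n)%N => // k IH /IH; exact: polydegS.
Qed.

Lemma polydeg_cst n a : polydeg n (fun=> a).
Proof.
apply: (@polydeg_le 0) => //.
by apply/span_cons; exists a, (fun=> 0); split; [exact: span_nil|move=> x; rewrite mulr1 addr0].
Qed.

Lemma polydegD n p q : polydeg n p -> polydeg n q -> polydeg n (fun x => p x + q x).
Proof. exact: spanD. Qed.

Lemma polydegZ n a p : polydeg n p -> polydeg n (fun x => a * p x).
Proof. exact: spanZ. Qed.

Lemma polydeg_coord n j p : polydeg n p -> polydeg n.+1 (fun x => x 0 j * p x).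
Proof.
move=> np; apply: span_catr.
have mp : span (map (mulcoord j) (polybasis n)) (mulcoord j p).
  apply: (@span_ind _ _ (fun p => span (map (mulcoord j) (polybasis n)) (mulcoord j p))
     (fun q => span (map (mulcoord j) (polybasis n)) (mulcoord j q))) np.
  - by apply: span_eq (span0 _) => x; rewrite /mulcoord mulr0.
  - move=> a q p' sq sp'.
    apply: (@span_eq _ _ _ (fun x => a * mulcoord j q x + mulcoord j p' x)).
      by move=> x; rewrite /mulcoord; ring.
    by apply: spanD => //; exact: spanZ.
  have := span_self (map (mulcoord j) (polybasis n)).
  exact: map_each.
by apply: (@span_flatten_map _ _ _ _ (enum 'I_4) j) mp; rewrite mem_enum.
Qed.

Lemma polydegM n m p q : polydeg n p -> polydeg m q -> polydeg (n + m) (fun x => p x * q x).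
Proof.
move=> + mq; apply: (@span_ind _ _ (fun p => polydeg (n + m) (fun x => p x * q x))
    (fun p => polydeg (n + m) (fun x => p x * q x))).
- by apply: span_eq (span0 _) => x; rewrite mul0r.
- move=> a p1 p2 h1 h2; apply: (@span_eq _ _ _ (fun x => a * (p1 x * q x) + p2 x * q x)).
    by move=> x; ring.
  by apply: spanD => //; exact: spanZ.
elim: n => [|n IH] /=.
  by split => //; apply: span_eq mq => x; rewrite mul1r.
apply: each_cat; first by apply: each_imp IH => r; exact: polydegS.
apply: each_flatten_map => j; apply: each_map; apply: each_imp IH => r rq.
apply: (@polydeg_eq _ (fun x => x 0 j * (r x * q x))); first by move=> x; rewrite mulrA.
exact: polydeg_coord.
Qed.

(** A linear vector field, acting as a derivation; it is tangent to the spheres when A is skew. *)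
Definition X (A : 'M[R]_4) p : V -> R := fun x => 'D_(x *m A) p x.

Lemma derive_coord (j : 'I_4) (x v : V) : 'D_v (fun x : V => x 0 j) x = v 0 j.
Proof.
have := @derive_mx R V 1 4 id x v (@derivable_id _ _ _ _).
by rewrite derive_id => /matrixP/(_ 0 j); rewrite mxE.
Qed.

Lemma derive_lincomb a q p' (x v : V) : differentiable q x -> differentiable p' x ->
  'D_v (fun x => a * q x + p' x) x = a * 'D_v q x + 'D_v p' x.
Proof.
move=> dq dp'.
have dq' : derivable q x v by exact: diff_derivable.
have dp'' : derivable p' x v by exact: diff_derivable.
have daq : derivable (a *: q) x v by exact: derivableZ.
by rewrite -[LHS]/('D_v ((a *: q) + p') x) (deriveD daq dp'') (deriveZ _ dq').
Qed.

(** Linear fields send coordinates to linear forms, so they do not raise the degree. This keeps the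
    Laplacian of a polynomial of degree n among the test functions of degree n. *)
Lemma polydegX n p A : polydeg n p -> polydeg n (X A p).
Proof.
move=> np; have [] : (forall x, differentiable p x) /\ polydeg n (X A p) => //.
apply: (@span_ind _ _ (fun q => (forall x, differentiable q x) /\ polydeg n (X A q))
  (fun q => (forall x, differentiable q x) /\ polydeg n (X A q)) (polybasis n) p _ _ _ np).
- split; first by move=> x; exact: differentiable_cst.
  by apply: polydeg_eq (span0 _) => x; rewrite /X derive_cst.
- move=> a q p' [dq wq] [dp' wp']; split.
    move=> x; apply: differentiableD => //.
    by apply: differentiableM => //; exact: differentiable_cst.
  apply: (@polydeg_eq _ (fun x => a * X A q x + X A p' x)).
    by move=> x; rewrite /X derive_lincomb.
  by apply: spanD => //; exact: spanZ.
(* The Leibniz rule on x_j q also produces q times a linear form, so the degree of q itself is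
   carried through the induction. *)
apply: (@each_imp _ _ (fun q => [/\ forall x, differentiable q x, polydeg n q & polydeg n (X A q)])).
  by move=> q [dq _ wq].
elim: n {p np} => [|n IH].
  split => //; split; first by move=> x; exact: differentiable_cst.
    exact: polydeg_cst.
  by apply: polydeg_eq (span0 _) => x; rewrite /X derive_cst.
apply: each_cat.
  by apply: each_imp IH => q [dq sq wq]; split => //; exact: polydegS.
apply: each_flatten_map => j; apply: each_map; apply: each_imp IH => q [dq sq wq]; split.
- by move=> x; apply: differentiableM => //; exact: differentiable_coord.
- exact: polydeg_coord.
- apply: (@polydeg_eq _ (fun x => (\sum_i x 0 i * A i j) * q x + x 0 j * X A q x)).
    move=> x; rewrite /X -[RHS]/('D_(x *m A) ((fun x : V => x 0 j) * q) x) deriveM.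
    + by rewrite derive_coord mxE addrC /GRing.scale /= (mulrC (q x)).
    + by apply: diff_derivable; exact: differentiable_coord.
    + exact: diff_derivable.
  apply: polydegD; last exact: polydeg_coord.
  apply: (@polydeg_eq _ (fun x => \sum_i (A i j * (x 0 i * q x)))).
    by move=> x; rewrite mulr_suml; apply: eq_bigr => i _; ring.
  have E (F : 'I_4 -> V -> R) : (forall i, polydeg n.+1 (F i)) -> forall r : seq 'I_4, polydeg n.+1 (fun x => \sum_(i <- r) F i x).
    move=> FF; elim=> [|i r IHr].
      by apply: polydeg_eq (span0 _) => x; rewrite big_nil.
    apply: (@polydeg_eq _ (fun x => F i x + \sum_(i <- r) F i x)).
      by move=> x; rewrite big_cons.
    exact: polydegD.
  by apply: (E (fun i x => A i j * (x 0 i * q x))) => i; apply: polydegZ; exact: polydeg_coord.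
Qed.

End Polynomials.

(** * The sphere and polynomial approximation *)

Section Sphere.
Variable R : realType.
Local Notation V := 'rV[R]_4.
Implicit Types (x y : V).

Lemma dot_ge0 n (x : 'rV[R]_n) : 0 <= dot x x.
Proof. by apply: sumr_ge0 => i _; rewrite -expr2 sqr_ge0. Qed.

Lemma norm_le_dot n (x : 'rV[R]_n) : `|x| ^+ 2 <= dot x x.
Proof.
rewrite -(sqr_sqrtr (dot_ge0 x)) ler_pXn2r ?nnegrE ?sqrtr_ge0 //.
rewrite [leLHS]/Num.Def.normr /= mx_normrE bigmax_le ?sqrtr_ge0 // => -[i j] _ /=.
rewrite ord1 -sqrtr_sqr ler_wsqrtr // /dot (bigD1 j) //= expr2 lerDl.
by apply: sumr_ge0 => k _; rewrite -expr2 sqr_ge0.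
Qed.

Lemma dot_eq0 n (x : 'rV[R]_n) : (dot x x == 0) = (x == 0).
Proof.
apply/eqP/eqP => [x0|->]; last by rewrite /dot big1 // => i _; rewrite mxE mul0r.
by apply/normr0_eq0/eqP; rewrite -sqrf_eq0 eq_le sqr_ge0 andbT -x0 norm_le_dot.
Qed.

Lemma dot_coordE x : dot x x = \sum_i x 0 i ^+ 2.
Proof. by apply: eq_bigr => i _; rewrite expr2. Qed.

Lemma S3E x : S3 x -> dot x x = 1.
Proof. by rewrite /S3 /sphere /= expr1n. Qed.

Lemma S3_neq0 x : S3 x -> x != 0.
Proof. by move=> /S3E x1; rewrite -dot_eq0 x1 oner_eq0. Qed.

Lemma S3_norm_le1 x : S3 x -> `|x| <= 1.
Proof.
move=> /S3E x1; rewrite -(@ler_pXn2r _ 2) ?nnegrE //.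
by rewrite expr1n -x1 norm_le_dot.
Qed.

Lemma S3_coord_le1 x i : S3 x -> `|x 0 i| <= 1.
Proof.
move=> /S3E x1; rewrite -(@ler_pXn2r _ 2) ?nnegrE // expr1n -x1 dot_coordE.
rewrite (bigD1 i) //= real_normK ?num_real // lerDl.
by apply: sumr_ge0 => k _; rewrite sqr_ge0.
Qed.

Lemma dotZ n (a b : R) (x y : 'rV[R]_n) : dot (a *: x) (b *: y) = a * b * dot x y.
Proof. by rewrite /dot mulr_sumr; apply: eq_bigr => i _; rewrite !mxE; ring. Qed.

Lemma normalize_S3 x : x != 0 -> S3 (normalize x).
Proof.
rewrite -dot_eq0 => x0; have xp : 0 < dot x x by rewrite lt_def x0 dot_ge0.
by rewrite /S3 /sphere /= /normalize dotZ -expr2 exprVn sqr_sqrtr ?ltW// mulVf // expr1n.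
Qed.

Lemma normalize_id x : S3 x -> normalize x = x.
Proof. by move=> /S3E x1; rewrite /normalize x1 sqrtr1 invr1 scale1r. Qed.

Lemma Ck_dot k U : open U -> Ck k U (fun x : V => dot x x).
Proof.
move=> oU; apply: Ck_sum => // i.
by apply: CkM => //; exact: Ck_coord.
Qed.

Lemma dot_continuous : continuous (fun x : V => dot x x).
Proof. by move=> x; apply: (@Ck_dot 0 setT) => //; exact: openT. Qed.

Lemma S3_compact : compact (@S3 R).
Proof.
apply: bounded_closed_compact.
  exists 1; split => // M M1 x Sx /=.
  exact: le_trans (S3_norm_le1 Sx) (ltW M1).
have -> : @S3 R = (fun x : V => dot x x) @^-1` [set 1].
  by apply/seteqP; split => x /=; rewrite /S3 /sphere /= expr1n.
apply: closed_comp; last exact: closed_eq.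
by move=> x _; exact: dot_continuous.
Qed.

Lemma normalize_continuous x : x != 0 -> {for x, continuous (@normalize R)}.
Proof.
rewrite -dot_eq0 => x0; apply: (@coords_cvg R _ (nbhs x) _ 3 (@normalize R) (normalize x)) => j.
have -> : (fun y : V => normalize y 0 j) = (fun y => (Num.sqrt (dot y y))^-1 * y 0 j).
  by apply/funext => y; rewrite mxE.
rewrite mxE; apply: cvgM; last exact: coord_continuous.
apply: cvgV; first by rewrite sqrtr_eq0 -ltNge lt_def x0 dot_ge0.
apply: (@continuous_comp _ _ _ (fun y : V => dot y y) (@Num.sqrt R)).
  exact: dot_continuous.
exact: sqrt_continuous.
Qed.

(** A function continuous along the sphere is extended radially; [normalize] is continuous near the
    sphere and fixes its points, so the extension is continuous in the ambient space. *)
Lemma continuous_comp_normalize (T : topologicalType) (f : V -> T) x : S3 x ->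
  (f @ within (@S3 R) (nbhs x) --> f x) -> {for x, continuous (f \o @normalize R)}.
Proof.
move=> Sx fx; rewrite /prop_for /continuous_at /= (normalize_id Sx) => A /fx /= fA.
have nx : @normalize R @ x --> x.
  by have := normalize_continuous (S3_neq0 Sx); rewrite /prop_for /continuous_at (normalize_id Sx).
have H : \forall y \near x, S3 (normalize y) -> A (f (normalize y)) by exact: (nx _ fA).
have ne : \forall y \near x, y != 0.
  have /cvgrPdist_lt/(_ _ ltr01) := @dot_continuous x.
  apply: filterS => y; rewrite (S3E Sx) -dot_eq0 => /ltr_normlP[_ h].
  by apply: lt0r_neq0; lra.
by apply: filterS2 ne H => y y0; apply; exact: normalize_S3.
Qed.

(* The estimate that makes a positive operator close to the identity as soon as it is so on quadratic polynomials. *)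
Lemma quadratic_modulus (g : V -> R) (M e : R) : 0 < e -> (forall x, `|g x| <= M) ->
  (forall x, S3 x -> {for x, continuous g}) ->
  exists2 K, 0 <= K & forall x y, S3 x -> `|g y - g x| <= e + K * dot (y - x) (y - x).
Proof.
move=> e0 gM gc.
have M0 : 0 <= M by apply: le_trans (normr_ge0 _) (gM 0).
suff [K0 [_ HK]] : \forall K \near +oo, @S3 R `<=` (fun x => 0 <= K /\ forall y, `|g y - g x| <= e + K * dot (y - x) (y - x)).
  have := HK (K0 + 1); rewrite ltrDl => /(_ ltr01) H.
  pose K := Num.max 0 (K0 + 1); exists K; first by rewrite le_max lexx.
  move=> x y Sx; have [_ /(_ y) h] := H x Sx; apply: le_trans h _.
  by rewrite lerD2l ler_wpM2r ?dot_ge0 // le_max lexx orbT.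
have nc := (compact_near_coveringP _).1 S3_compact.
apply: (nc _ (+oo : set_system R) (fun K x => 0 <= K /\ forall y, `|g y - g x| <= e + K * dot (y - x) (y - x))).
move=> x Sx.
have e20 : 0 < e / 2 by rewrite divr_gt0.
have /cvgrPdist_lt/(_ _ e20)/nbhs_ballP[d /= d0 Hd] := gc x Sx.
have d20 : 0 < d / 2 by rewrite divr_gt0.
near=> z K => /=.
have zx : `|x - z| < d / 2.
  by near: z; exact: (@cvgr_dist_lt _ _ _ _ _ id).
have K0 : 0 <= K by near: K; exact: nbhs_pinfty_ge.
have KM : 2 * M <= K * (d / 2) ^+ 2.
  rewrite -ler_pdivrMr ?exprn_gt0 //.
split => // y; have q0 := dot_ge0 (y - z).
have [yz|yz] := ltrP `|z - y| (d / 2).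
  have h1 : `|g x - g y| < e / 2.
    apply: Hd; rewrite -ball_normE /= -(subrKA z) (le_lt_trans (ler_normD _ _)) //.
    by rewrite (splitr d) ltrD.
  have h2 : `|g x - g z| < e / 2.
    by apply: Hd; rewrite -ball_normE /= (lt_trans zx) // ltr_pdivrMr // ltr_pMr // ltr1n.
  have := mulr_ge0 K0 q0; move: h1 h2; rewrite !ltr_norml ler_norml; lra.
have : `|g y - g z| <= 2 * M.
  by rewrite (le_trans (ler_normB _ _)) // mulr_natl mulr2n lerD.
move=> /le_trans; apply; apply: (le_trans KM); rewrite -[leLHS]add0r lerD ?(ltW e0) //.
rewrite ler_wpM2l // (le_trans _ (norm_le_dot _)) // ler_pXn2r ?nnegrE ?(ltW d20) //.
by rewrite distrC.
Unshelve. all: by end_near. Qed.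

End Sphere.

Section Bernstein.
Variable R : realType.
Local Notation V := 'rV[R]_4.
Implicit Types (x y : V) (f g : V -> R).

Lemma polydeg_bmean n d (Y : V -> R) (g : nat -> V -> R) : polydeg 1 Y ->
  (forall k, polydeg d (g k)) -> polydeg (n + d) (fun x => bmean n (Y x) (fun k => g k x)).
Proof.
move=> Y1; elim: n g => [|n IH] g gd /=; first by rewrite add0n; exact: gd.
rewrite addSn -add1n; apply: polydegD.
  apply: (@polydegM _ _ _ Y (fun x => bmean n (Y x) (fun k => g k.+1 x))) => //.
  exact: (IH (fun k => g k.+1)).
apply: (@polydegM _ _ _ (fun x => 1 - Y x) (fun x => bmean n (Y x) (fun k => g k x))); last exact: IH.
apply: (@polydeg_eq _ _ (fun x => 1 + (-1) * Y x)); first by move=> x; rewrite mulN1r.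
by apply: polydegD; [exact: polydeg_cst|exact: polydegZ].
Qed.

Lemma bmean_quad n (y a c : R) (g : nat -> R) : (forall k, g k = a + c * (k%:R - n%:R * y) ^+ 2) ->
  bmean n y g = a + c * (n%:R * y * (1 - y)).
Proof.
move=> gE; rewrite (eq_bmean _ _ gE) bmeanD bmean_cst bmeanZ bmean_sqr.
by rewrite subrr expr0n addr0.
Qed.

Definition node (n : nat) (k : nat -> nat) : V := \row_(j < 4) (2 * ((k j)%:R / n%:R) - 1).

Definition seq4 (k0 k1 k2 k3 : nat) : nat -> nat := nth 0%N [:: k0; k1; k2; k3].

(** The Bernstein operator of the cube [-1, 1]^4, which contains the sphere, applied one variable at
    a time; (x + 1)/2 maps [-1, 1] onto [0, 1]. *)
Definition bern4 n f x :=
  let y (j : nat) := (x 0 (inord j) + 1) / 2 in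
  bmean n (y 0%N) (fun k0 => bmean n (y 1%N) (fun k1 =>
  bmean n (y 2%N) (fun k2 => bmean n (y 3%N) (fun k3 => f (node n (seq4 k0 k1 k2 k3)))))).

Lemma polydeg_bern4 n f : polydeg (n + (n + (n + (n + 0)))) (bern4 n f).
Proof.
have Y j : polydeg 1 (fun x : V => (x 0 (inord j) + 1) / 2).
  apply: (@polydeg_eq _ _ (fun x => 2^-1 * (x 0 (inord j) * 1) + 2^-1)).
    by move=> x; field.
  apply: polydegD; last exact: polydeg_cst.
  by apply: polydegZ; apply: (@polydeg_coord _ 0 _ (fun=> 1)); exact: polydeg_cst.
rewrite /bern4.
apply: (@polydeg_bmean _ _ _ (fun k0 x => _)) => // k0.
apply: (@polydeg_bmean _ _ _ (fun k0 x => _)) => // k1.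
apply: (@polydeg_bmean _ _ _ (fun k0 x => _)) => // k2.
apply: (@polydeg_bmean _ _ _ (fun k0 x => _)) => // k3.
exact: polydeg_cst.
Qed.

(** The operator is positive and fixes constants, so it suffices to average the quadratic bound. A
    node deviates from x by 2 (k/n - y_j) in coordinate j, with mean square 4 y_j (1 - y_j) / n;
    each y_j (1 - y_j) is at most 1/4 and there are four of them. *)
Lemma bern4_dist n f (e K : R) x : (0 < n)%N -> (forall j, `|x 0 j| <= 1) -> 0 <= K ->
  (forall y, `|f y - f x| <= e + K * dot (y - x) (y - x)) ->
  `|bern4 n f x - f x| <= e + 4 * K / n%:R.
Proof.
move=> n0 x1 K0 H; rewrite /bern4.
have n0' : (0 : R) < n%:R by rewrite ltr0n.
set y := fun j : nat => (x 0 (inord j) + 1) / 2.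
have y01 j : 0 <= y j <= 1.
  by rewrite /y; have := x1 (inord j); rewrite ler_norml => /andP[h1 h2]; lra.
pose q (j k : nat) : R := (k%:R - n%:R * y j) ^+ 2.
pose B k0 k1 k2 k3 := e + (4 * K / n%:R ^+ 2) * (q 0%N k0 + (q 1%N k1 + (q 2%N k2 + q 3%N k3))).
have nodeE k0 k1 k2 k3 : e + K * dot (node n (seq4 k0 k1 k2 k3) - x) (node n (seq4 k0 k1 k2 k3) - x)
   = B k0 k1 k2 k3.
  rewrite /B /dot !big_ord_recl big_ord0 !mxE /= /seq4 /q /y /=.
  have -> : inord 0 = ord0 :> 'I_4 by apply/val_inj; rewrite /= inordK.
  have -> : inord 1 = lift ord0 ord0 :> 'I_4 by apply/val_inj; rewrite /= inordK.
  have -> : inord 2 = lift ord0 (lift ord0 ord0) :> 'I_4 by apply/val_inj; rewrite /= inordK.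
  have -> : inord 3 = lift ord0 (lift ord0 (lift ord0 ord0)) :> 'I_4 by apply/val_inj; rewrite /= inordK.
  by field; rewrite gt_eqF.
have Bb k0 k1 k2 k3 : - B k0 k1 k2 k3 + f x <= f (node n (seq4 k0 k1 k2 k3)) <= B k0 k1 k2 k3 + f x.
  by have := H (node n (seq4 k0 k1 k2 k3)); rewrite nodeE ler_norml => /andP[h1 h2]; lra.
pose E4 F := bmean n (y 0%N) (fun k0 => bmean n (y 1%N) (fun k1 => bmean n (y 2%N) (fun k2 => bmean n (y 3%N) (F k0 k1 k2)))).
(* Each mean turns a squared deviation [q] into a variance [w], from the innermost variable
   outwards; s = 1 and s = -1 give the upper and the lower bound. *)
have EB s : E4 (fun k0 k1 k2 k3 => s * B k0 k1 k2 k3 + f x) =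
   s * (e + (4 * K / n%:R) * (y 0%N * (1 - y 0%N) + y 1%N * (1 - y 1%N) + y 2%N * (1 - y 2%N) + y 3%N * (1 - y 3%N))) + f x.
  pose c := s * (4 * K / n%:R ^+ 2); pose w j := n%:R * y j * (1 - y j).
  rewrite /E4 /B (@bmean_quad _ _ (s * e + f x + c * (w 1%N + w 2%N + w 3%N)) c).
    by rewrite /c /w; field; rewrite gt_eqF.
  move=> k0; rewrite (@bmean_quad _ _ (s * e + f x + c * (q 0%N k0 + w 2%N + w 3%N)) c).
    by rewrite /c /w /q; ring.
  move=> k1; rewrite (@bmean_quad _ _ (s * e + f x + c * (q 0%N k0 + q 1%N k1 + w 3%N)) c).
    by rewrite /c /w /q; ring.
  move=> k2; rewrite (@bmean_quad _ _ (s * e + f x + c * (q 0%N k0 + q 1%N k1 + q 2%N k2)) c).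
    by rewrite /c /w /q; ring.
  by move=> k3; rewrite /c /w /q; ring.
have E4le F G : (forall k0 k1 k2 k3, F k0 k1 k2 k3 <= G k0 k1 k2 k3) -> E4 F <= E4 G.
  by move=> FG; rewrite /E4; do 4 (apply: le_bmean => // ?); exact: FG.
have W : y 0%N * (1 - y 0%N) + y 1%N * (1 - y 1%N) + y 2%N * (1 - y 2%N) + y 3%N * (1 - y 3%N) <= 1.
  have h j : y j * (1 - y j) <= 4^-1.
    by have := sqr_ge0 (y j - 2^-1); rewrite expr2; lra.
  by have := h 0%N; have := h 1%N; have := h 2%N; have := h 3%N; lra.
have C0 : 0 <= 4 * K / n%:R by rewrite !mulr_ge0 // invr_ge0 ltW.
have UB : E4 (fun k0 k1 k2 k3 => 1 * B k0 k1 k2 k3 + f x) <= e + 4 * K / n%:R + f x.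
  by rewrite EB mul1r lerD2r lerD2l ler_piMr.
have LB : - (e + 4 * K / n%:R) + f x <= E4 (fun k0 k1 k2 k3 => (-1) * B k0 k1 k2 k3 + f x).
  by rewrite EB mulN1r lerD2r lerN2 lerD2l ler_piMr.
have H1 := E4le (fun k0 k1 k2 k3 => f (node n (seq4 k0 k1 k2 k3))) (fun k0 k1 k2 k3 => 1 * B k0 k1 k2 k3 + f x).
have H2 := E4le (fun k0 k1 k2 k3 => (-1) * B k0 k1 k2 k3 + f x) (fun k0 k1 k2 k3 => f (node n (seq4 k0 k1 k2 k3))).
have {}H1 : E4 (fun k0 k1 k2 k3 => f (node n (seq4 k0 k1 k2 k3))) <= e + 4 * K / n%:R + f x.
  by apply: le_trans UB; apply: H1 => k0 k1 k2 k3; rewrite mul1r; case/andP: (Bb k0 k1 k2 k3).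
have {}H2 : - (e + 4 * K / n%:R) + f x <= E4 (fun k0 k1 k2 k3 => f (node n (seq4 k0 k1 k2 k3))).
  by apply: (le_trans LB); apply: H2 => k0 k1 k2 k3; rewrite mulN1r; case/andP: (Bb k0 k1 k2 k3).
rewrite -/(E4 (fun k0 k1 k2 k3 => f (node n (seq4 k0 k1 k2 k3)))).
move: (E4 _) (4 * K / n%:R) H1 H2 => a b; rewrite ler_norml; lra.
Qed.

Theorem S3_Weierstrass f (e : R) : 0 < e ->
  (forall x, S3 x -> f @ within (@S3 R) (nbhs x) --> f x) ->
  exists d p, polydeg d p /\ forall x, S3 x -> `|p x - f x| <= e.
Proof.
move=> e0 fc; pose g := f \o @normalize R.
have gc x : S3 x -> {for x, continuous g} by move=> Sx; apply: continuous_comp_normalize => //; exact: fc.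
have [M gM] : exists M, forall x, `|g x| <= M.
  have : compact (g @` @S3 R).
    apply: continuous_compact; last exact: S3_compact.
    by apply: continuous_in_subspaceT => x; rewrite inE; exact: gc.
  move=> /compact_bounded[M [_ HM]].
  (* [normalize 0] is 0, off the sphere, so the value of g there is bounded separately. *)
  exists (Num.max (M + 1) `|g 0|) => x; rewrite le_max; have [->|x0] := eqVneq x 0; first by rewrite lexx orbT.
  rewrite (HM (M + 1)) ?ltrDl //=; exists (normalize x); first exact: normalize_S3.
  by rewrite /g /= normalize_id //; exact: normalize_S3.
have e20 : 0 < e / 2 by rewrite divr_gt0.
have [K K0 HK] := quadratic_modulus e20 gM gc.
pose n := (Num.truncn (8 * K / e)).+1.
exists (n + (n + (n + (n + 0))))%N, (bern4 n g); split; first exact: polydeg_bern4.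
move=> x Sx; have -> : f x = g x by rewrite /g /= normalize_id.
apply: le_trans (bern4_dist (e := e / 2) (K := K) _ _ _ _) _ => //.
- by move=> j; exact: S3_coord_le1.
- by move=> y; exact: HK.
- have : 8 * K / e < n%:R by rewrite truncnS_gt // divr_ge0 ?mulr_ge0 // ltW.
  rewrite ltr_pdivrMr // => h.
  have n0 : (0:R) < n%:R by rewrite ltr0n.
  have : 4 * K / n%:R <= e / 2 by rewrite ler_pdivrMr //; lra.
  lra.
Qed.

End Bernstein.

(** * Smooth functions near the sphere *)

Section SmoothNearS3.
Variable R : realType.
Local Notation V := 'rV[R]_4.
Implicit Types (f g : V -> R) (x v : V) (A B : 'M[R]_4).

(** Smoothness is asked on a neighbourhood of the sphere, common to all orders, so that ambient
    directional derivatives exist; derivatives along tangent fields depend only on the restriction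
    to the sphere, by [X_ext]. *)
Definition sm f := exists U : set V, [/\ open U, @S3 R `<=` U & forall k, Ck k U f].

Lemma sm_cst (c : R) : sm (fun=> c).
Proof. by exists setT; split => // [|k]; [exact: openT|exact: Ck_cst]. Qed.

Lemma sm_coord j : sm (fun x => x 0 j).
Proof. by exists setT; split => // [|k]; [exact: openT|exact: Ck_coord]. Qed.

Lemma sm_op2 (op : (V -> R) -> (V -> R) -> V -> R) f g :
  (forall k (U : set V) f g, open U -> Ck k U f -> Ck k U g -> Ck k U (op f g)) ->
  sm f -> sm g -> sm (op f g).
Proof.
move=> H [U [oU SU cU]] [U' [oU' SU' cU']]; exists (U `&` U'); split.
- exact: openI.
- by move=> x Sx; split; [exact: SU|exact: SU'].
- move=> k; apply: H; first exact: openI.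
    by apply: Ck_sub (cU k) => x [].
  by apply: Ck_sub (cU' k) => x [].
Qed.

Lemma smD f g : sm f -> sm g -> sm (fun x => f x + g x).
Proof. by apply: (@sm_op2 (fun f g x => f x + g x)) => *; exact: CkD. Qed.

Lemma smM f g : sm f -> sm g -> sm (fun x => f x * g x).
Proof. by apply: (@sm_op2 (fun f g x => f x * g x)) => *; exact: CkM. Qed.

Lemma smN f : sm f -> sm (fun x => - f x).
Proof.
move=> sf; have -> : (fun x => - f x) = (fun x => (-1) * f x) by apply/funext => x; rewrite mulN1r.
by apply: smM => //; exact: sm_cst.
Qed.

Lemma smB f g : sm f -> sm g -> sm (fun x => f x - g x).
Proof. by move=> sf sg; apply: smD => //; exact: smN. Qed.

Lemma sm_expr n f : sm f -> sm (fun x => f x ^+ n).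
Proof.
move=> sf; elim: n => [|n IH]; first exact: sm_cst.
have -> : (fun x => f x ^+ n.+1) = (fun x => f x * f x ^+ n) by apply/funext => x; rewrite exprS.
exact: smM.
Qed.

Lemma sm_sum n (F : 'I_n -> V -> R) : (forall i, sm (F i)) -> sm (fun x => \sum_i F i x).
Proof.
elim: n F => [|n IH] F sF.
  have -> : (fun x => \sum_i F i x) = (fun=> 0) by apply/funext => x; rewrite big_ord0.
  exact: sm_cst.
have -> : (fun x => \sum_i F i x) = (fun x => F ord0 x + \sum_i F (lift ord0 i) x).
  by apply/funext => x; rewrite big_ord_recl.
by apply: smD => //; exact: (IH (fun i => F (lift ord0 i))).
Qed.

Lemma sm_dir v f : sm f -> sm ('D_v f).
Proof. by move=> [U [oU SU cU]]; exists U; split => // k; have [_] := cU k.+1; apply. Qed.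

Lemma sm_diff f x : sm f -> S3 x -> differentiable f x.
Proof. by move=> [U [oU SU cU]] /SU Ux; exact: Ck_diff (cU 1%N) Ux. Qed.

Lemma sm_cont f x : sm f -> S3 x -> {for x, continuous f}.
Proof. by move=> [U [oU SU cU]] /SU Ux; exact: (cU 0%N). Qed.

Lemma open_pos (U : set V) f : open U -> (forall x, U x -> {for x, continuous f}) ->
  open (U `&` [set x | 0 < f x]).
Proof.
rewrite !openE => oU cf x [Ux fx].
have /cvgrPdist_lt/(_ _ fx) h := cf x Ux.
apply: filterS2 (oU x Ux) h => y Uy /ltr_normlP[h1 h2]; split => //=; lra.
Qed.

Lemma sm_pos_nbhd f : sm f -> (forall x, S3 x -> 0 < f x) ->
  exists U : set V, [/\ open U, @S3 R `<=` U, forall k, Ck k U f & forall x, U x -> 0 < f x].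
Proof.
move=> [U [oU SU cU]] fp; exists (U `&` [set x | 0 < f x]); split.
- by apply: open_pos => //; exact: (cU 0%N).
- by move=> x Sx; split; [exact: SU|exact: fp].
- by move=> k; apply: Ck_sub (cU k) => x [].
- by move=> x [].
Qed.

Lemma smV f : sm f -> (forall x, S3 x -> 0 < f x) -> sm (fun x => (f x)^-1).
Proof.
move=> sf fp; have [U [oU SU cU Up]] := sm_pos_nbhd sf fp.
by exists U; split => // k; apply: CkV => // x /Up; exact: lt0r_neq0.
Qed.

Lemma Ck_sqrt k (U : set V) f : open U -> (forall x, U x -> 0 < f x) -> Ck k U f ->
  Ck k U (fun x => Num.sqrt (f x)).
Proof.
move=> oU fp; elim: k => [|k IH] cf /=.
  move=> x Ux; apply: (@continuous_comp _ _ _ f (@Num.sqrt R)); first exact: cf.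
  exact: sqrt_continuous.
have ds x : U x -> differentiable (@Num.sqrt R) (f x).
  move=> Ux; apply/derivable1_diffP.
  by have [] := is_derive1_sqrt (fp x Ux).
split=> [x Ux|v].
  apply: (@differentiable_comp _ _ _ _ f (@Num.sqrt R)); first exact: Ck_diff cf Ux.
  exact: ds.
apply: (@Ck_ext _ _ _ _ (fun x => (2 * Num.sqrt (f x))^-1 * 'D_v f x)) => //.
  move=> x Ux; have df := Ck_diff cf Ux.
  have dc := differentiable_comp df (ds x Ux).
  rewrite -[RHS]/('D_v (@Num.sqrt R \o f) x) (deriveE _ dc).
  rewrite (diff_comp df (ds x Ux)) /= -(deriveE _ df).
  have -> : 'd (@Num.sqrt R) (f x) ('D_v f x) = 'D_v f x * 'd (@Num.sqrt R) (f x) 1.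
    by rewrite -[X in 'd _ _ X]mulr1 [LHS]linearZ.
  rewrite -(deriveE _ (ds x Ux)) mulrC.
  by have [_ ->] := is_derive1_sqrt (fp x Ux).
apply: CkM => //; last exact: cf.2.
apply: CkV => // [x Ux|]; first by rewrite mulf_neq0 // sqrtr_eq0 -ltNge fp.
by apply: CkM => //; [exact: Ck_cst|exact/IH/CkS].
Qed.

Lemma sm_sqrt f : sm f -> (forall x, S3 x -> 0 < f x) -> sm (fun x => Num.sqrt (f x)).
Proof.
move=> sf fp; have [U [oU SU cU Up]] := sm_pos_nbhd sf fp.
by exists U; split => // k; exact: Ck_sqrt.
Qed.

Lemma sm_polydeg n p : polydeg n p -> sm p.
Proof.
apply: (@span_ind _ _ sm sm); first exact: sm_cst.
- by move=> a q p' sq sp'; apply: smD => //; apply: smM => //; exact: sm_cst.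
- elim: n => [|n IH] /=; first by split => //; exact: sm_cst.
  apply: each_cat => //; apply: each_flatten_map => j; apply: each_map; apply: each_imp IH => q sq.
  by apply: smM => //; exact: sm_coord.
Qed.

Lemma open_neq0 : open [set x : V | x != 0].
Proof.
have -> : [set x : V | x != 0] = setT `&` [set x | 0 < dot x x].
  by rewrite setTI; apply/seteqP; split => x /=; rewrite -dot_eq0 lt_def dot_ge0 andbT.
by apply: open_pos; [exact: openT|move=> x _; exact: dot_continuous].
Qed.

Lemma Ck_normalize k j : Ck k [set x : V | x != 0] (fun x => normalize x 0 j).
Proof.
have oU := open_neq0.
have dp (x : V) : x != 0 -> 0 < dot x x by rewrite -dot_eq0 lt_def dot_ge0 andbT.
apply: (@Ck_ext _ _ _ _ (fun x : V => (Num.sqrt (dot x x))^-1 * x 0 j)) => //.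
  by move=> x _; rewrite /normalize mxE.
apply: CkM => //; last exact: Ck_coord.
apply: CkV => // [x /dp x0|]; first by rewrite sqrtr_eq0 -ltNge.
by apply: Ck_sqrt => //; exact: Ck_dot.
Qed.

Lemma normalize_diff x : x != 0 -> differentiable (@normalize R) x.
Proof.
move=> x0; apply: differentiable_coords => j.
exact: (@Ck_diff _ _ 0 _ _ _ (Ck_normalize 1 j)).
Qed.

Lemma derive_dot x v : 'D_v (fun x : V => dot x x) x = 2 * dot x v.
Proof.
have -> : (fun x : V => dot x x) = \sum_(i < 4) (fun x : V => x 0 i * x 0 i).
  by apply/funext => y; rewrite fct_sumE.
have dc i : derivable (fun x : V => x 0 i) x v.
  by apply: diff_derivable; exact: differentiable_coord.
rewrite derive_sum; last by move=> i; apply: derivableM.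
rewrite /dot mulr_sumr; apply: eq_bigr => i _.
rewrite -[LHS]/('D_v ((fun x : V => x 0 i) * (fun x : V => x 0 i)) x) deriveM //.
by rewrite derive_coord /GRing.scale /=; ring.
Qed.

Lemma derive_normalize x v : S3 x -> dot x v = 0 -> 'D_v (@normalize R) x = v.
Proof.
move=> Sx xv; have x0 := S3_neq0 Sx; have dn := normalize_diff x0.
apply/rowP => j; rewrite coord_derive; last exact: diff_derivable.
have -> : (fun y : V => normalize y 0 j) = (fun y => (Num.sqrt (dot y y))^-1) * (fun y => y 0 j).
  by apply/funext => y; rewrite mxE.
have sd : sm (fun y : V => dot y y).
  by exists setT; split => // [|k]; [exact: openT|apply: Ck_dot; exact: openT].
have sp (y : V) : S3 y -> 0 < dot y y by move=> /S3E ->.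
have dd : derivable (fun y : V => dot y y) x v by apply: diff_derivable; exact: sm_diff.
have ds : derivable (fun y : V => Num.sqrt (dot y y)) x v.
  by apply: diff_derivable; apply: sm_diff => //; exact: (sm_sqrt sd sp).
have Ds : 'D_v (fun y : V => Num.sqrt (dot y y)) x = 0.
  have E : 'D_v ((fun y : V => Num.sqrt (dot y y)) * (fun y : V => Num.sqrt (dot y y))) x = 0.
    have -> : (fun y : V => Num.sqrt (dot y y)) * (fun y : V => Num.sqrt (dot y y)) = (fun y : V => dot y y).
      by apply/funext => y; rewrite /GRing.mul /= -expr2 sqr_sqrtr // dot_ge0.
    by rewrite derive_dot xv mulr0.
  move: E; rewrite deriveM // (S3E Sx) sqrtr1 !scale1r; lra.
rewrite deriveM; last 2 first.
- by apply: derivableV => //; rewrite (S3E Sx) sqrtr1 oner_neq0.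
- by apply: diff_derivable; exact: differentiable_coord.
rewrite deriveV //; last by rewrite (S3E Sx) sqrtr1 oner_neq0.
by rewrite Ds scaler0 scaler0 addr0 derive_coord (S3E Sx) sqrtr1 invr1 scale1r.
Qed.

Lemma derive_comp_normalize (W : normedModType R) (f : V -> W) x v :
  S3 x -> dot x v = 0 -> differentiable f x ->
  differentiable (f \o @normalize R) x /\ 'D_v (f \o @normalize R) x = 'D_v f x.
Proof.
move=> Sx xv df0.
have df : differentiable f (normalize x) by rewrite normalize_id.
have dn := normalize_diff (S3_neq0 Sx).
have dfn := differentiable_comp dn df; split => //.
rewrite (deriveE _ dfn) (diff_comp dn df) /= -(deriveE _ dn) derive_normalize //.
by rewrite -(deriveE _ df) normalize_id.
Qed.

(** Composition with [normalize] does not alter tangential derivatives and turns equality on the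
    sphere into equality near x. *)
Lemma derive_eq_on_S3 f g x v : S3 x -> dot x v = 0 -> differentiable f x -> differentiable g x ->
  (forall y, S3 y -> f y = g y) -> 'D_v f x = 'D_v g x.
Proof.
move=> Sx xv df dg fg.
rewrite -(derive_comp_normalize Sx xv df).2 -(derive_comp_normalize Sx xv dg).2.
apply: near_eq_derive.
apply: (@open_near_eq _ _ _ [set y : V | y != 0]); [exact: open_neq0| |exact: S3_neq0].
by move=> y y0 /=; apply: fg; exact: normalize_S3.
Qed.

End SmoothNearS3.

(** * The quaternionic frame and its commutators *)

Section Fields.
Variable R : realType.
Local Notation V := 'rV[R]_4.
Implicit Types (f g : V -> R) (x v : V) (A B : 'M[R]_4).

Definition co x (k : nat) : R := x 0 (inord k).

Lemma sum4 (W : nmodType) (F : 'I_4 -> W) :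
  \sum_i F i = F (inord 0) + F (inord 1) + F (inord 2) + F (inord 3).
Proof.
rewrite !big_ord_recl big_ord0 addr0 !addrA.
by congr (_ + _ + _ + _); congr F; apply/val_inj; rewrite /= inordK.
Qed.

Lemma co_eq x y : co x 0 = co y 0 -> co x 1 = co y 1 -> co x 2 = co y 2 -> co x 3 = co y 3 -> x = y.
Proof.
move=> e0 e1 e2 e3; apply/rowP => -[[|[|[|[|//]]]] lt];
  [move: e0|move: e1|move: e2|move: e3]; rewrite /co;
  by congr (x _ _ = y _ _); apply/val_inj; rewrite /= inordK.
Qed.

Lemma dotE x y : dot x y = co x 0 * co y 0 + co x 1 * co y 1 + co x 2 * co y 2 + co x 3 * co y 3.
Proof. by rewrite /dot sum4. Qed.

Lemma coD x y k : co (x + y) k = co x k + co y k. Proof. by rewrite /co mxE. Qed.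
Lemma coN x k : co (- x) k = - co x k. Proof. by rewrite /co mxE. Qed.
Lemma coZ a x k : co (a *: x) k = a * co x k. Proof. by rewrite /co mxE. Qed.

Definition mat4 (s : seq (seq R)) : 'M[R]_4 := \matrix_(i < 4, j < 4) (nth [::] s i)`_j.

(* Multiplication of C^2 = H by the quaternion units, acting on row vectors: x *m qI = (iz, iw), x *m qJ = (- conj w, conj z) and x *m qK = (- i conj w, i conj z). *)
Definition qI := mat4 [:: [:: 0; 1; 0; 0]; [:: -1; 0; 0; 0]; [:: 0; 0; 0; 1]; [:: 0; 0; -1; 0]].
Definition qJ := mat4 [:: [:: 0; 0; 1; 0]; [:: 0; 0; 0; -1]; [:: -1; 0; 0; 0]; [:: 0; 1; 0; 0]].
Definition qK := mat4 [:: [:: 0; 0; 0; 1]; [:: 0; 0; 1; 0]; [:: 0; -1; 0; 0]; [:: -1; 0; 0; 0]].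

Lemma co_qI x : (co (x *m qI) 0 = - co x 1) * (co (x *m qI) 1 = co x 0) *
  (co (x *m qI) 2 = - co x 3) * (co (x *m qI) 3 = co x 2).
Proof. by do !split; rewrite /co mxE sum4 !mxE !inordK //=; ring. Qed.

Lemma co_qJ x : (co (x *m qJ) 0 = - co x 2) * (co (x *m qJ) 1 = co x 3) *
  (co (x *m qJ) 2 = co x 0) * (co (x *m qJ) 3 = - co x 1).
Proof. by do !split; rewrite /co mxE sum4 !mxE !inordK //=; ring. Qed.

Lemma co_qK x : (co (x *m qK) 0 = - co x 3) * (co (x *m qK) 1 = - co x 2) *
  (co (x *m qK) 2 = co x 1) * (co (x *m qK) 3 = co x 0).
Proof. by do !split; rewrite /co mxE sum4 !mxE !inordK //=; ring. Qed.

Definition tangent_field A := forall x, dot x (x *m A) = 0.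

Lemma tangent_qI : tangent_field qI.
Proof. by move=> x; rewrite dotE !co_qI; ring. Qed.
Lemma tangent_qJ : tangent_field qJ.
Proof. by move=> x; rewrite dotE !co_qJ; ring. Qed.
Lemma tangent_qK : tangent_field qK.
Proof. by move=> x; rewrite dotE !co_qK; ring. Qed.

Lemma sm_X A f : sm f -> sm (X A f).
Proof.
move=> [U [oU SU cU]]; exists U; split => // k.
apply: (@Ck_ext _ _ _ _ (fun x => \sum_j (\sum_i x 0 i * A i j) * 'D_(delta_mx 0 j) f x)) => //.
  move=> x Ux; rewrite /X derive_coord_sum; last exact: Ck_diff (cU 1%N) Ux.
  by apply: eq_bigr => j _; rewrite mxE.
apply: Ck_sum => // j; apply: CkM => //; last by have [_] := cU k.+1; apply.
apply: Ck_sum => // i; apply: CkM => //; [exact: Ck_coord|exact: Ck_cst].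
Qed.

Lemma sm_co k : sm (fun x => co x k). Proof. exact: sm_coord. Qed.

Lemma X_ext A f g x : tangent_field A -> S3 x -> sm f -> sm g ->
  (forall y, S3 y -> f y = g y) -> X A f x = X A g x.
Proof.
move=> tA Sx sf sg fg; apply: derive_eq_on_S3 => //; by apply: sm_diff.
Qed.

Lemma sm_derivable f x v : sm f -> S3 x -> derivable f x v.
Proof. by move=> sf Sx; apply: diff_derivable; exact: sm_diff. Qed.

Lemma X_cst A a x : X A (fun=> a) x = 0.
Proof. by rewrite /X derive_cst. Qed.

Lemma X_co A k x : X A (fun y => co y k) x = co (x *m A) k.
Proof. by rewrite /X derive_coord. Qed.

Lemma XD A f g x : S3 x -> sm f -> sm g -> X A (fun y => f y + g y) x = X A f x + X A g x.
Proof.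
move=> Sx sf sg; rewrite /X -[LHS]/('D_(x *m A) (f + g) x).
by rewrite (deriveD (sm_derivable sf Sx) (sm_derivable sg Sx)).
Qed.

Lemma XM A f g x : S3 x -> sm f -> sm g ->
  X A (fun y => f y * g y) x = X A f x * g x + f x * X A g x.
Proof.
move=> Sx sf sg; rewrite /X -[LHS]/('D_(x *m A) (f * g) x).
rewrite (deriveM (sm_derivable sf Sx) (sm_derivable sg Sx)) /GRing.scale /= addrC.
by rewrite (mulrC (g x)).
Qed.

Lemma XZ A a f x : S3 x -> sm f -> X A (fun y => a * f y) x = a * X A f x.
Proof.
move=> Sx sf; rewrite (@XM A (fun=> a)) //; last exact: sm_cst.
by rewrite X_cst mul0r add0r.
Qed.

Lemma XN A f x : S3 x -> sm f -> X A (fun y => - f y) x = - X A f x.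
Proof.
move=> Sx sf; rewrite /X -[LHS]/('D_(x *m A) (- f) x).
by rewrite (deriveN (sm_derivable sf Sx)).
Qed.

Lemma XB A f g x : S3 x -> sm f -> sm g -> X A (fun y => f y - g y) x = X A f x - X A g x.
Proof. by move=> Sx sf sg; rewrite XD ?XN //; exact: smN. Qed.

Lemma XX A B f x : S3 x -> sm f ->
  X A (X B f) x = 'D_(x *m A *m B) f x + 'D_(x *m A) ('D_(x *m B) f) x.
Proof.
move=> Sx sf; have [U [oU SU cU]] := sf; have Ux := SU _ Sx.
have dfj j : derivable ('D_(delta_mx 0 j) f) x (x *m A).
  by apply: sm_derivable => //; exact: sm_dir.
have dB j : derivable (fun y : V => (y *m B) 0 j) x (x *m A).
  have -> : (fun y : V => (y *m B) 0 j) = (fun y : V => \sum_i y 0 i * B i j).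
    by apply/funext => y; rewrite mxE.
  apply: sm_derivable => //; apply: sm_sum => i.
  by apply: smM; [exact: sm_coord|exact: sm_cst].
have DB j : 'D_(x *m A) (fun y : V => (y *m B) 0 j) x = (x *m A *m B) 0 j.
  have -> : (fun y : V => (y *m B) 0 j) = \sum_(i < 4) (B i j *: (fun y : V => y 0 i)).
    by apply/funext => y; rewrite fct_sumE mxE; apply: eq_bigr => i _; rewrite /GRing.scale /= /GRing.scale /= mulrC.
  have dc i : derivable (fun y : V => y 0 i) x (x *m A) by apply: sm_derivable => //; exact: sm_coord.
  rewrite derive_sum; last by move=> i; apply: derivableZ.
  by rewrite mxE; apply: eq_bigr => i _; rewrite deriveZ // derive_coord /GRing.scale /= mulrC.
rewrite {1}/X (@near_eq_derive _ _ _ _ (\sum_(j < 4) (fun y => (y *m B) 0 j) * 'D_(delta_mx 0 j) f)); last first.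
  apply: (@open_near_eq _ _ _ U) => // y Uy.
  rewrite /X derive_coord_sum; last exact: Ck_diff (cU 1%N) Uy.
  by rewrite fct_sumE.
rewrite derive_sum; last by move=> j; apply: derivableM.
rewrite (derive_coord_sum (x *m A *m B) (sm_diff sf Sx)).
have D2 : 'D_(x *m A) ('D_(x *m B) f) x = \sum_j (x *m B) 0 j * 'D_(x *m A) ('D_(delta_mx 0 j) f) x.
  rewrite (Clairaut _ _ oU Ux (cU 2%N)) (derive_coord_sum (x *m B) (sm_diff (sm_dir _ sf) Sx)).
  by apply: eq_bigr => j _; rewrite (Clairaut _ _ oU Ux (cU 2%N)).
rewrite D2 -big_split; apply: eq_bigr => j _.
by rewrite deriveM // DB addrC /GRing.scale /= (mulrC ('D_(delta_mx 0 j) f x)).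
Qed.

(** The second-order terms cancel by [Clairaut]; what remains is the derivative along the linear
    field of the commutator of the matrices. *)
Lemma X_comm A B f x : S3 x -> sm f ->
  X A (X B f) x - X B (X A f) x = 'D_(x *m A *m B - x *m B *m A) f x.
Proof.
move=> Sx sf; have [U [oU SU cU]] := sf; have Ux := SU _ Sx.
rewrite !XX // (Clairaut (x *m B) _ oU Ux (cU 2%N)) opprD addrACA subrr addr0.
have -> : x *m A *m B - x *m B *m A = (-1) *: (x *m B *m A) + x *m A *m B by rewrite scaleN1r addrC.
rewrite derive_linear; last exact: sm_diff.
by rewrite scaleN1r addrC.
Qed.

Let comm_aux A B C f x : (forall y : V, y *m A *m B - y *m B *m A = (-2) *: (y *m C)) -> S3 x -> sm f ->
  X A (X B f) x = X B (X A f) x - 2 * X C f x.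
Proof.
move=> E Sx sf; apply/eqP; rewrite -subr_eq opprK -subr_eq0.
have := X_comm A B Sx sf; rewrite E.
rewrite -[(-2) *: _]addr0 derive_linear; last exact: sm_diff.
rewrite derive0 addr0 => h; rewrite /X in h *.
rewrite addrAC h /GRing.scale /=; apply/eqP; ring.
Qed.

Lemma comm_IJ f x : S3 x -> sm f -> X qI (X qJ f) x = X qJ (X qI f) x - 2 * X qK f x.
Proof.
apply: comm_aux => y; apply: co_eq; rewrite ?(coD, coN, coZ, co_qI, co_qJ, co_qK); ring.
Qed.

Lemma comm_JK f x : S3 x -> sm f -> X qJ (X qK f) x = X qK (X qJ f) x - 2 * X qI f x.
Proof.
apply: comm_aux => y; apply: co_eq; rewrite ?(coD, coN, coZ, co_qI, co_qJ, co_qK); ring.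
Qed.

Lemma comm_KI f x : S3 x -> sm f -> X qK (X qI f) x = X qI (X qK f) x - 2 * X qJ f x.
Proof.
apply: comm_aux => y; apply: co_eq; rewrite ?(coD, coN, coZ, co_qI, co_qJ, co_qK); ring.
Qed.

End Fields.

(** * Integration in Hopf coordinates *)

Section Plane.
Variable R : realType.
Local Notation mu := (@lebesgue_measure R).

(* A named copy, since no sigma-finiteness instance is inferred for a product measure. *)
Definition plane_measure := (mu \x mu)%E.

HB.instance Definition _ := Measure.on plane_measure.

Let plane_sigma_finite : sigma_finite setT plane_measure.
Proof.
have /sigma_finiteP[F [TF ndF Foo]] := sigma_finiteT mu.
exists (fun n => F n `*` F n).
  rewrite -setXTT TF predeqE => -[x y]; split.
    move=> [/= [n _ Fnx] [k _ Gky]]; exists (maxn n k) => //; split.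
    - by move: x Fnx; exact/subsetPset/ndF/leq_maxl.
    - by move: y Gky; exact/subsetPset/ndF/leq_maxr.
  by move=> [n _ []/= ? ?]; split; exists n.
move=> k; have [mF Fk] := Foo k; split; first exact: measurableX.
by rewrite /plane_measure product_measure1E// lte_mul_pinfty// ge0_fin_numE.
Qed.

HB.instance Definition _ := @Measure_isSigmaFinite.Build _ _ _ plane_measure plane_sigma_finite.
End Plane.

Section BoxIntegral.
Variable R : realType.
Local Notation mu := (@lebesgue_measure R).
Local Notation T3 := (R * R * R)%type.
Implicit Types (G : T3 -> R) (a b c : R) (p : T3).

(** Both conditions are set on all of R^3 rather than on the box: the coordinates of [param] satisfy
    them there, and slices at fixed c inherit them. *)
Definition bmeas G := measurable_fun setT G /\ exists M : R, forall p, `|G p| <= M.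

Lemma bmeas_cst (r : R) : bmeas (fun=> r).
Proof. by split; [exact: measurable_cst|exists `|r| => p]. Qed.

Lemma bmeasD G H : bmeas G -> bmeas H -> bmeas (fun p => G p + H p).
Proof.
move=> [mG [M GM]] [mH [N HN]]; split; first exact: measurable_funD.
by exists (M + N) => p; rewrite (le_trans (ler_normD _ _)) // lerD.
Qed.

Lemma bmeasM G H : bmeas G -> bmeas H -> bmeas (fun p => G p * H p).
Proof.
move=> [mG [M GM]] [mH [N HN]]; split; first exact: measurable_funM.
by exists (M * N) => p; rewrite normrM ler_pM.
Qed.

Lemma bmeasN G : bmeas G -> bmeas (fun p => - G p).
Proof.
move=> gG; have := bmeasM (bmeas_cst (-1)) gG.
by congr bmeas; apply/funext => p; rewrite mulN1r.
Qed.

Lemma bmeas_cont1 (f : R -> R) (pr : T3 -> R) (M : R) : continuous f -> (forall s, `|f s| <= M) ->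
  measurable_fun setT pr -> bmeas (fun p => f (pr p)).
Proof.
move=> cf fM mpr; split; last by exists M => p.
by apply: (@measurableT_comp _ _ _ _ _ _ f) => //; exact: continuous_measurable_fun.
Qed.

Lemma measurable_pr1 : measurable_fun setT (fun p : T3 => p.1.1).
Proof. exact: (@measurableT_comp _ _ _ _ _ _ fst). Qed.
Lemma measurable_pr2 : measurable_fun setT (fun p : T3 => p.1.2).
Proof. exact: (@measurableT_comp _ _ _ _ _ _ snd). Qed.
Lemma measurable_pr3 : measurable_fun setT (fun p : T3 => p.2).
Proof. exact: measurable_snd. Qed.

Lemma abs_cos_le1 s : `|cos s : R| <= 1.
Proof. by rewrite ler_norml cos_geN1 cos_le1. Qed.
Lemma abs_sin_le1 s : `|sin s : R| <= 1.
Proof. by rewrite ler_norml sin_geN1 sin_le1. Qed.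

Lemma bmeas_cos pr : measurable_fun setT pr -> bmeas (fun p => cos (pr p)).
Proof. by apply: bmeas_cont1; [exact: continuous_cos|exact: abs_cos_le1]. Qed.
Lemma bmeas_sin pr : measurable_fun setT pr -> bmeas (fun p => sin (pr p)).
Proof. by apply: bmeas_cont1; [exact: continuous_sin|exact: abs_sin_le1]. Qed.

Local Notation box := (@param_dom R).
Local Notation mu2 := (mu \x mu)%E.
Local Notation mu3 := ((mu \x mu) \x mu)%E.

Lemma measurable_box : measurable box.
Proof. by apply: measurableX; [apply: measurableX|]. Qed.

Lemma pi2_gt0 : 0 < pi / 2 :> R. Proof. by rewrite divr_gt0 // pi_gt0. Qed.
Lemma twopi_gt0 : 0 < 2 * pi :> R. Proof. by rewrite mulr_gt0 // pi_gt0. Qed.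

Lemma lebesgue_itv0 (s : R) : 0 < s -> mu `]0%R, s[ = s%:E.
Proof. by move=> s0; rewrite lebesgue_measure_itv /= lte_fin s0 -EFinB subr0. Qed.

Lemma rectangle_area : mu2 (`]0%R, (pi / 2)%R[ `*` `]0%R, (2 * pi)%R[) = (pi / 2 * (2 * pi))%:E.
Proof.
transitivity (mu `]0%R, (pi / 2)%R[ * mu `]0%R, (2 * pi)%R[)%E; first by rewrite product_measure1E.
by rewrite (lebesgue_itv0 twopi_gt0) (lebesgue_itv0 pi2_gt0) EFinM.
Qed.

Lemma box_finite : (mu3 box < +oo)%E.
Proof.
rewrite /param_dom product_measure1E; [|by apply: measurableX|by []].
by rewrite [X in (X * _ < _)%E]rectangle_area [X in (_ * X < _)%E](lebesgue_itv0 twopi_gt0) -EFinM ltry.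
Qed.

Lemma bmeas_integrable G : bmeas G -> mu3.-integrable box (EFin \o G).
Proof.
move=> [mG [M GM]]; apply: measurable_bounded_integrable.
- exact: measurable_box.
- exact: box_finite.
- exact: measurable_funTS.
- exists M; split => [|N MN p _]; first exact: num_real.
  exact: le_trans (GM p) (ltW MN).
Qed.

Definition boxint G : R := \int[mu3]_(p in box) G p.

Lemma boxintD G H : bmeas G -> bmeas H -> boxint (fun p => G p + H p) = boxint G + boxint H.
Proof. by move=> gG gH; rewrite /boxint RintegralD //; [exact: measurable_box|exact: bmeas_integrable|exact: bmeas_integrable]. Qed.

Lemma boxintZ r G : bmeas G -> boxint (fun p => r * G p) = r * boxint G.
Proof. by move=> gG; rewrite /boxint RintegralZl //; [exact: measurable_box|exact: bmeas_integrable]. Qed.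

Lemma le_boxint G H : bmeas G -> bmeas H -> (forall p, box p -> G p <= H p) -> boxint G <= boxint H.
Proof. by move=> gG gH GH; apply: le_Rintegral => //; [exact: measurable_box|exact: bmeas_integrable|exact: bmeas_integrable]. Qed.

Lemma eq_boxint G H : (forall p, box p -> G p = H p) -> boxint G = boxint H.
Proof. by move=> GH; apply: eq_Rintegral => p; rewrite inE => /GH. Qed.

Lemma FTC0 (f F : R -> R) (s : R) : 0 < s -> continuous f ->
  (forall x : R, is_derive x 1 F (f x)) -> F s = F 0 ->
  (\int[mu]_(x in `]0%R, s[) (f x)%:E = 0)%E.
Proof.
move=> s0 cf dF FE; rewrite -(@integral_itv_bndoo _ 0 s (EFin \o f) true false).
- rewrite (@continuous_FTC2 _ f F 0 s s0) ?FE ?subee //.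
  + exact: continuous_subspaceT.
  + have cF : continuous F.
      by move=> x; apply/differentiable_continuous/derivable1_diffP; have [] := dF x.
    split; first by move=> x _; have [] := dF x.
      by apply: cvg_at_right_filter; exact: cF.
    by apply: cvg_at_left_filter; exact: cF.
  + by move=> x _; rewrite derive1E; have [_ ->] := dF x.
- apply/measurable_EFinP; apply: measurable_funTS; exact: continuous_measurable_fun.
Qed.

Let ext G : T3 -> \bar R := (EFin \o G) \_ box.

Lemma integrable_ext G : bmeas G -> mu3.-integrable setT (ext G).
Proof.
move=> gG; apply/(integrable_mkcond _ _).1; last exact: bmeas_integrable.
exact: measurable_box.
Qed.

Lemma boxint_ext G : boxint G = fine (\int[mu3]_p ext G p)%E.
Proof. by rewrite /boxint /Rintegral integral_mkcond. Qed.

Lemma extE G a b c : ext G (a, b, c) =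
  if (a \in `]0, pi / 2[) && (b \in `]0, 2 * pi[) && (c \in `]0, 2 * pi[) then (G (a, b, c))%:E else 0%E.
Proof.
rewrite /ext patchE; congr (if _ then _ else _).
apply/idP/idP => [/set_mem[[/= -> ->] ->] //|/andP[/andP[ha hb] hc]].
by apply/mem_set.
Qed.

Lemma fubini_inner G : bmeas G ->
  (\int[mu3]_p ext G p = \int[@plane_measure R]_z \int[mu]_c ext G (z, c))%E.
Proof.
by move=> gG; rewrite (@integral12_prod_meas1 _ _ _ _ R (@plane_measure R) mu (ext G) (integrable_ext gG)).
Qed.

Lemma fubini_outer G : bmeas G ->
  (\int[mu3]_p ext G p = \int[mu]_c \int[@plane_measure R]_z ext G (z, c))%E.
Proof.
by move=> gG; rewrite (@integral21_prod_meas1 _ _ _ _ R (@plane_measure R) mu (ext G) (integrable_ext gG)).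
Qed.

Lemma boxint0_c G : bmeas G ->
  (forall a b, (\int[mu]_(c in `]0%R, (2 * pi)%R[) (G (a, b, c))%:E = 0)%E) -> boxint G = 0.
Proof.
move=> gG H; rewrite boxint_ext fubini_inner //.
rewrite integral0_eq // => -[a b] _; rewrite /=.
have [ab|ab] := boolP ((a \in `]0, pi / 2[) && (b \in `]0, 2 * pi[)).
  rewrite -[RHS](H a b) [RHS]integral_mkcond; apply: eq_integral => c _.
  by rewrite extE ab /= patchE mem_setE.
by rewrite integral0_eq // => c _; rewrite extE (negbTE ab).
Qed.

(** The product structure singles out c only; to integrate first in a or b, the slice at fixed c is
    treated by a second use of Fubini, in the plane. *)
Let section_c G c (z : R * R) : \bar R := ext G (z, c).

Lemma integrable_section_c G c : bmeas G -> mu2.-integrable setT (section_c G c).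
Proof.
move=> [mG [M GM]].
pose D := `]0%R, (pi / 2)%R[ `*` `]0%R, (2 * pi)%R[ : set (R * R).
pose f z := if c \in `]0, 2 * pi[ then G (z, c) else 0.
have mD : measurable D by apply: measurableX.
have -> : section_c G c = (EFin \o f) \_ D.
  apply/funext => -[a b]; rewrite /section_c extE patchE /f /=.
  have -> : ((a, b) \in D) = (a \in `]0, pi / 2[) && (b \in `]0, 2 * pi[).
    apply/idP/idP => [/set_mem[/= -> ->] //|/andP[ha hb]].
    by apply/mem_set.
  by case: (a \in _); case: (b \in _); case: (c \in _).
apply/(integrable_mkcond _ _).1 => //; apply: measurable_bounded_integrable => //.
- by rewrite [X in (X < _)%E]rectangle_area ltry.
- apply: measurable_funTS; rewrite /f; case: (c \in _); last exact: measurable_cst.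
  exact: (measurable_fun_pair1 c mG).
- exists M; split => [|N MN z _]; first exact: num_real.
  rewrite /f /=; case: (c \in _); first exact: le_trans (GM _) (ltW MN).
  by rewrite normr0 (le_trans (normr_ge0 (G (0, 0, 0)))) // (le_trans (GM _)) // ltW.
Qed.

Lemma boxint0_b G : bmeas G ->
  (forall a c, (\int[mu]_(b in `]0%R, (2 * pi)%R[) (G (a, b, c))%:E = 0)%E) -> boxint G = 0.
Proof.
move=> gG H; rewrite boxint_ext fubini_outer //.
rewrite integral0_eq // => c _; rewrite /=.
rewrite -[LHS]/((\int[mu2]_z (section_c G c z))%E).
rewrite -integral12_prod_meas1; last exact: integrable_section_c.
rewrite integral0_eq // => a _; rewrite /section_c /fubini_F /=.
have [ac|ac] := boolP ((a \in `]0, pi / 2[) && (c \in `]0, 2 * pi[)).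
  rewrite -[RHS](H a c) [RHS]integral_mkcond; apply: eq_integral => b _.
  by rewrite extE andbAC ac /= patchE mem_setE.
by rewrite integral0_eq // => b _; rewrite extE andbAC (negbTE ac).
Qed.

Lemma boxint0_a G : bmeas G ->
  (forall b c, (\int[mu]_(a in `]0%R, (pi / 2)%R[) (G (a, b, c))%:E = 0)%E) -> boxint G = 0.
Proof.
move=> gG H; rewrite boxint_ext fubini_outer //.
rewrite integral0_eq // => c _; rewrite /=.
rewrite -[LHS]/((\int[mu2]_z (section_c G c z))%E).
rewrite -integral21_prod_meas1; last exact: integrable_section_c.
rewrite integral0_eq // => b _; rewrite /section_c /fubini_G /=.
have [bc|bc] := boolP ((b \in `]0, 2 * pi[) && (c \in `]0, 2 * pi[)).
  rewrite -[RHS](H b c) [RHS]integral_mkcond; apply: eq_integral => a _.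
  by rewrite extE -andbA bc andbT /= patchE mem_setE.
by rewrite integral0_eq // => a _; rewrite extE -andbA (negbTE bc) andbF.
Qed.

End BoxIntegral.

(** * Integration by parts for the quaternionic frame *)

Section HopfCoordinates.
Variable R : realType.
Local Notation V := 'rV[R]_4.
Local Notation T3 := (R * R * R)%type.
Local Notation mu := (@lebesgue_measure R).
Implicit Types (a b c : R) (p : T3) (h g : V -> R).

Definition row4 (x0 x1 x2 x3 : R) : V := \row_(j < 4) [:: x0; x1; x2; x3]`_j.

Lemma co_row4 x0 x1 x2 x3 : (co (row4 x0 x1 x2 x3) 0 = x0) * (co (row4 x0 x1 x2 x3) 1 = x1) *
  (co (row4 x0 x1 x2 x3) 2 = x2) * (co (row4 x0 x1 x2 x3) 3 = x3).
Proof. by do !split; rewrite /co mxE inordK. Qed.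

Lemma param_S3 a b c : S3 (param a b c).
Proof.
rewrite /S3 /sphere /= expr1n dotE -/(row4 _ _ _ _) !co_row4.
have := cos2Dsin2 a; have := cos2Dsin2 b; have := cos2Dsin2 c.
move: (cos a) (sin a) (cos b) (sin b) (cos c) (sin c) => x y z w u v E1 E2 E3.
transitivity (x ^+ 2 * (z ^+ 2 + w ^+ 2) + y ^+ 2 * (u ^+ 2 + v ^+ 2)); first by ring.
by rewrite E1 E2 !mulr1.
Qed.

Definition par p : V := param p.1.1 p.1.2 p.2.

Lemma S3_bounded g : (forall x, S3 x -> {for x, continuous g}) ->
  exists M, forall x, S3 x -> `|g x| <= M.
Proof.
move=> gc; have : compact (g @` @S3 R).
  apply: continuous_compact; last exact: S3_compact.
  by apply: continuous_in_subspaceT => x; rewrite inE; exact: gc.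
move=> /compact_bounded[M [_ HM]]; exists (M + 1) => x Sx.
by rewrite (HM (M + 1)) ?ltrDl //=; exists x.
Qed.

Lemma bmeas_co j : bmeas (fun p => par p 0 j).
Proof.
have -> : j = inord j by apply/val_inj; rewrite /= inordK.
have m1 := @measurable_pr1 R; have m2 := @measurable_pr2 R; have m3 := @measurable_pr3 R.
case: j => -[|[|[|[|//]]]] lt /=.
- apply: (@eq_ind _ _ (@bmeas R) (bmeasM (bmeas_cos m1) (bmeas_cos m2))).
  by apply/funext => p; rewrite /par mxE inordK.
- apply: (@eq_ind _ _ (@bmeas R) (bmeasM (bmeas_cos m1) (bmeas_sin m2))).
  by apply/funext => p; rewrite /par mxE inordK.
- apply: (@eq_ind _ _ (@bmeas R) (bmeasM (bmeas_sin m1) (bmeas_cos m3))).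
  by apply/funext => p; rewrite /par mxE inordK.
- apply: (@eq_ind _ _ (@bmeas R) (bmeasM (bmeas_sin m1) (bmeas_sin m3))).
  by apply/funext => p; rewrite /par mxE inordK.
Qed.

Lemma bmeas_polydeg n q : polydeg n q -> measurable_fun setT (fun p => q (par p)).
Proof.
suff H : polydeg n q -> bmeas (fun p => q (par p)) by move=> /H[].
apply: (@span_ind _ _ (fun q => bmeas (fun p => q (par p))) (fun q => bmeas (fun p => q (par p)))).
- exact: bmeas_cst.
- by move=> r q1 q2 b1 b2; apply: bmeasD => //; apply: bmeasM => //; exact: bmeas_cst.
elim: n => [|n IH] /=; first by split => //; exact: bmeas_cst.
apply: each_cat => //; apply: each_flatten_map => j; apply: each_map; apply: each_imp IH => r br.
by apply: bmeasM => //; exact: bmeas_co.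
Qed.

(** g is constrained only at the points of the sphere, so its measurability is not at hand;
    [g \o par] is instead the limit of polynomials in sines and cosines, by [S3_Weierstrass]. *)
Lemma bmeas_par g : (forall x, S3 x -> {for x, continuous g}) -> bmeas (fun p => g (par p)).
Proof.
move=> gc; split; last first.
  by have [M HM] := S3_bounded gc; exists M => p; apply: HM; exact: param_S3.
have W n : exists q, (exists d, polydeg d q) /\ forall x, S3 x -> `|q x - g x| <= n.+1%:R^-1.
  have [||d [q [dq qg]]] := @S3_Weierstrass R g n.+1%:R^-1; first by rewrite invr_gt0 ltr0n.
    by move=> x Sx; apply: cvg_within_filter; exact: gc.
  by exists q; split => //; exists d.
have [q Hq] := choice W.
apply: (@measurable_fun_cvg _ _ _ _ (fun n p => q n (par p))).
  by move=> n; have [[d dq] _] := Hq n; exact: bmeas_polydeg dq.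
move=> p _; apply/cvgrPdist_le => e e0; near=> n.
have [_ /(_ _ (param_S3 p.1.1 p.1.2 p.2)) h] := Hq n.
rewrite distrC (le_trans h) // invf_ple ?posrE ?ltr0n //.
near: n; exists (Num.truncn e^-1) => // n /= tn.
by rewrite ltW // (lt_le_trans (truncnS_gt _)) // ler_nat.
Unshelve. all: by end_near. Qed.

(** The volume density of the round metric in Hopf coordinates; the Berger metric multiplies it by
    t, see [volume_density]. *)
Definition wt p : R := cos p.1.1 * sin p.1.1.

Lemma bmeas_wt : bmeas wt.
Proof. by apply: bmeasM; [apply: bmeas_cos|apply: bmeas_sin]; exact: measurable_pr1. Qed.

Lemma wt_ge0 p : param_dom p -> 0 <= wt p.
Proof.
move=> [[/= + _] _]; rewrite in_itv /= => /andP[a0 a1].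
rewrite /wt mulr_ge0 // ltW //.
  by apply: cos_gt0_pihalf; rewrite a1 (lt_trans _ a0) // oppr_lt0 pi2_gt0.
by apply: sin_gt0_pi; rewrite a0 (lt_trans a1) // ltr_pdivrMr // ltr_pMr ?pi_gt0 // ltr1n.
Qed.

Definition Int h : R := boxint (fun p => h (par p) * wt p).

Lemma bmeas_sm h : sm h -> bmeas (fun p => h (par p)).
Proof. by move=> sh; apply: bmeas_par => x; exact: sm_cont. Qed.

Lemma bmeas_Int h : sm h -> bmeas (fun p => h (par p) * wt p).
Proof. by move=> sh; apply: bmeasM; [exact: bmeas_sm|exact: bmeas_wt]. Qed.

Lemma IntD h g : sm h -> sm g -> Int (fun x => h x + g x) = Int h + Int g.
Proof.
move=> sh sg; rewrite /Int -boxintD; [|exact: bmeas_Int|exact: bmeas_Int].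
by apply: eq_boxint => p _; rewrite mulrDl.
Qed.

Lemma IntZ r h : sm h -> Int (fun x => r * h x) = r * Int h.
Proof.
move=> sh; rewrite /Int -boxintZ; last exact: bmeas_Int.
by apply: eq_boxint => p _; rewrite mulrA.
Qed.

Lemma Int_le h g : sm h -> sm g -> (forall x, S3 x -> h x <= g x) -> Int h <= Int g.
Proof.
move=> sh sg hg; apply: le_boxint; [exact: bmeas_Int|exact: bmeas_Int|move=> p bp].
by rewrite ler_wpM2r ?wt_ge0 //; apply: hg; exact: param_S3.
Qed.

Lemma Int_eq h g : (forall x, S3 x -> h x = g x) -> Int h = Int g.
Proof. by move=> hg; apply: eq_boxint => p _; rewrite hg //; exact: param_S3. Qed.

Lemma is_derive_row (s : R) (w : V) (f : R -> V) :
  (forall j, is_derive s 1 (fun s => f s 0 j) (w 0 j)) -> is_derive s 1 f w.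
Proof.
move=> H; have df : derivable f s 1.
  by apply/derivable_mxP => i j; rewrite ord1; have [] := H j.
apply: DeriveDef => //; apply/rowP => j; rewrite derive_mx // mxE.
by have [_] := H j.
Qed.

Lemma is_derive_row4 (s : R) (f0 f1 f2 f3 : R -> R) (d0 d1 d2 d3 : R) :
  is_derive s 1 f0 d0 -> is_derive s 1 f1 d1 -> is_derive s 1 f2 d2 -> is_derive s 1 f3 d3 ->
  is_derive s 1 (fun s => row4 (f0 s) (f1 s) (f2 s) (f3 s)) (row4 d0 d1 d2 d3).
Proof.
move=> h0 h1 h2 h3; apply: is_derive_row => -[[|[|[|[|//]]]] lt];
 [move: h0|move: h1|move: h2|move: h3]; rewrite mxE /=; congr is_derive;
 by apply/funext => u; rewrite mxE.
Qed.

Definition par_a a b c : V := row4 (- sin a * cos b) (- sin a * sin b) (cos a * cos c) (cos a * sin c).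
Definition par_b a b c : V := row4 (- (cos a * sin b)) (cos a * cos b) 0 0.
Definition par_c a b c : V := row4 0 0 (- (sin a * sin c)) (sin a * cos c).

Lemma is_derive_mulr (f : R -> R) (s df k : R) : is_derive s 1 f df ->
  is_derive s 1 (fun s => f s * k) (df * k).
Proof.
move=> [d1 d2]; have -> : (fun s => f s * k) = k *: f.
  by apply/funext => u; rewrite /GRing.scale /= /GRing.scale /= mulrC.
apply: DeriveDef; first exact: derivableZ.
by rewrite deriveZ // d2 /GRing.scale /= mulrC.
Qed.

Lemma is_derive_mull (f : R -> R) (s df k : R) : is_derive s 1 f df ->
  is_derive s 1 (fun s => k * f s) (k * df).
Proof.
move=> d; rewrite mulrC; have -> : (fun s => k * f s) = (fun s => f s * k) by apply/funext => u; rewrite mulrC.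
exact: is_derive_mulr.
Qed.

Lemma is_derive_mul (f g : R -> R) (s df dg : R) : is_derive s 1 f df -> is_derive s 1 g dg ->
  is_derive s 1 (fun s => f s * g s) (df * g s + f s * dg).
Proof.
move=> [d1 d2] [d3 d4]; apply: DeriveDef; first exact: (derivableM d1 d3).
rewrite -[LHS]/('D_1 (f * g) s) (deriveM d1 d3) d2 d4 addrC /GRing.scale /=.
by rewrite (mulrC (g s)).
Qed.

Lemma is_derive_shiftl (f : R -> R) (s k df : R) : is_derive (s + k) 1 f df ->
  is_derive s 1 (fun s => f (s + k)) df.
Proof.
move=> d; have := @is_derive1_comp _ f (shift k) s df 1 d (is_derive_shift s 1 k).
by rewrite mulr1.
Qed.

Lemma is_derive_par_a a b c : is_derive a 1 (fun a => param a b c) (par_a a b c).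
Proof. by apply: is_derive_row4; apply: is_derive_mulr. Qed.

Lemma is_derive_kcos (k s : R) : is_derive s 1 (fun s => k * cos s) (- (k * sin s)).
Proof. by rewrite -mulrN; exact: is_derive_mull. Qed.

Lemma is_derive_ksin (k s : R) : is_derive s 1 (fun s => k * sin s) (k * cos s).
Proof. exact: is_derive_mull. Qed.

Lemma is_derive_par_b a b c : is_derive b 1 (fun b => param a b c) (par_b a b c).
Proof.
exact: (@is_derive_row4 b _ _ _ _ _ _ _ _ (is_derive_kcos _ _) (is_derive_ksin _ _)
  (is_derive_cst (sin a * cos c) b 1) (is_derive_cst (sin a * sin c) b 1)).
Qed.

Lemma is_derive_par_c a b c : is_derive c 1 (fun c => param a b c) (par_c a b c).
Proof.
exact: (@is_derive_row4 c _ _ _ _ _ _ _ _ (is_derive_cst (cos a * cos b) c 1)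
  (is_derive_cst (cos a * sin b) c 1) (is_derive_kcos _ _) (is_derive_ksin _ _)).
Qed.

Lemma is_derive_continuous (f df : R -> V) : (forall s : R, is_derive s 1 f (df s)) -> continuous f.
Proof. by move=> H s; apply/differentiable_continuous/derivable1_diffP; have [] := H s. Qed.

Lemma param_cont_a b c : continuous (fun a => param a b c).
Proof. by apply: is_derive_continuous => a; exact: is_derive_par_a. Qed.

Lemma param_cont_b a c : continuous (fun b => param a b c).
Proof. by apply: is_derive_continuous => b; exact: is_derive_par_b. Qed.

Lemma param_cont_c a b : continuous (fun c => param a b c).
Proof. by apply: is_derive_continuous => c; exact: is_derive_par_c. Qed.

Lemma sm_comp_cont h (f : R -> V) : sm h -> (forall s, S3 (f s)) -> continuous f ->
  continuous (fun s => h (f s)).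
Proof.
by move=> sh Sf cf s; apply: (@continuous_comp _ _ _ f h); [exact: cf|exact: sm_cont].
Qed.

Lemma derive_coords h x v : sm h -> S3 x ->
  'D_v h x = co v 0 * 'D_(delta_mx 0 (inord 0)) h x + co v 1 * 'D_(delta_mx 0 (inord 1)) h x
    + co v 2 * 'D_(delta_mx 0 (inord 2)) h x + co v 3 * 'D_(delta_mx 0 (inord 3)) h x.
Proof.
move=> sh Sx; rewrite derive_coord_sum; last exact: sm_diff.
by rewrite sum4.
Qed.

Lemma bmeas_dir h (v : T3 -> V) : sm h -> (forall k, (k < 4)%N -> bmeas (fun p => co (v p) k)) ->
  bmeas (fun p => 'D_(v p) h (par p)).
Proof.
move=> sh bv; have B k : (k < 4)%N -> bmeas (fun p => co (v p) k * 'D_(delta_mx 0 (inord k)) h (par p)).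
  by move=> k4; apply: bmeasM; [exact: bv|exact: (bmeas_sm (sm_dir _ sh))].
apply: (@eq_ind _ _ (@bmeas R) (bmeasD (bmeasD (bmeasD (B 0%N isT) (B 1%N isT)) (B 2%N isT)) (B 3%N isT))).
by apply/funext => p; rewrite [RHS]derive_coords //; exact: param_S3.
Qed.

Lemma dir_cont h (f v : R -> V) : sm h -> (forall s, S3 (f s)) -> continuous f ->
  (forall k, (k < 4)%N -> continuous (fun s => co (v s) k)) ->
  continuous (fun s => 'D_(v s) h (f s)).
Proof.
move=> sh Sf cf cv.
have -> : (fun s => 'D_(v s) h (f s)) = (fun s => co (v s) 0 * 'D_(delta_mx 0 (inord 0)) h (f s) + co (v s) 1 * 'D_(delta_mx 0 (inord 1)) h (f s)
    + co (v s) 2 * 'D_(delta_mx 0 (inord 2)) h (f s) + co (v s) 3 * 'D_(delta_mx 0 (inord 3)) h (f s)).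
  by apply/funext => s; rewrite [LHS]derive_coords.
have B k : (k < 4)%N -> continuous (fun s => co (v s) k * 'D_(delta_mx 0 (inord k)) h (f s)).
  move=> k4 s; apply: cvgM; first exact: cv.
  by apply: (sm_comp_cont (sm_dir _ sh) Sf cf).
by move=> s; apply: cvgD; [apply: cvgD; [apply: cvgD|]|]; exact: B.
Qed.

Lemma bmeas_pars k : (k < 4)%N ->
  [/\ bmeas (fun p => co (par_a p.1.1 p.1.2 p.2) k), bmeas (fun p => co (par_b p.1.1 p.1.2 p.2) k)
    & bmeas (fun p => co (par_c p.1.1 p.1.2 p.2) k)].
Proof.
have m1 := @measurable_pr1 R; have m2 := @measurable_pr2 R; have m3 := @measurable_pr3 R.
have [c1 c2 c3] := And3 (bmeas_cos m1) (bmeas_cos m2) (bmeas_cos m3).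
have [s1 s2 s3] := And3 (bmeas_sin m1) (bmeas_sin m2) (bmeas_sin m3).
have b0 := @bmeas_cst R 0.
have E (F : T3 -> V) (g0 g1 g2 g3 : T3 -> R) : (forall p, F p = row4 (g0 p) (g1 p) (g2 p) (g3 p)) ->
    bmeas g0 -> bmeas g1 -> bmeas g2 -> bmeas g3 -> (k < 4)%N -> bmeas (fun p => co (F p) k).
  move=> FE h0 h1 h2 h3; have -> : F = (fun p => row4 (g0 p) (g1 p) (g2 p) (g3 p)) by apply/funext.
  case: k => [|[|[|[|//]]]] _; [move: h0|move: h1|move: h2|move: h3]; congr bmeas;
    by apply/funext => p; rewrite co_row4.
move=> k4; split; apply: E k4 => //.
- exact: (bmeasM (bmeasN s1) c2).
- exact: (bmeasM (bmeasN s1) s2).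
- exact: (bmeasM c1 c3).
- exact: (bmeasM c1 s3).
- exact: (bmeasN (bmeasM c1 s2)).
- exact: (bmeasM c1 c2).
- exact: (bmeasN (bmeasM s1 s3)).
- exact: (bmeasM s1 c3).
Qed.

Lemma eq_cont (f g : R -> R) : f =1 g -> continuous f -> continuous g.
Proof. by move=> /funext ->. Qed.

Lemma row4_cont (f0 f1 f2 f3 : R -> R) k : continuous f0 -> continuous f1 -> continuous f2 -> continuous f3 ->
  (k < 4)%N -> continuous (fun s => co (row4 (f0 s) (f1 s) (f2 s) (f3 s)) k).
Proof.
move=> h0 h1 h2 h3; case: k => [|[|[|[|//]]]] _; [apply: eq_cont h0|apply: eq_cont h1|apply: eq_cont h2|apply: eq_cont h3] => s; by rewrite co_row4.
Qed.

Lemma cont_mulr (f : R -> R) (k : R) : continuous f -> continuous (fun s => f s * k).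
Proof. by move=> cf s; apply: cvgM; [exact: cf|exact: cvg_cst]. Qed.
Lemma cont_mull (f : R -> R) (k : R) : continuous f -> continuous (fun s => k * f s).
Proof. by move=> cf s; apply: cvgM; [exact: cvg_cst|exact: cf]. Qed.
Lemma cont_opp (f : R -> R) : continuous f -> continuous (fun s => - f s).
Proof. by move=> cf s; apply: cvgN; exact: cf. Qed.

Lemma par_a_cont b c k : (k < 4)%N -> continuous (fun a => co (par_a a b c) k).
Proof.
apply: row4_cont; apply: cont_mulr; try apply: cont_opp;
  by [exact: continuous_sin|exact: continuous_cos].
Qed.

Lemma par_b_cont a c k : (k < 4)%N -> continuous (fun b => co (par_b a b c) k).
Proof.
apply: row4_cont; [apply: cont_opp| |exact: cst_continuous|exact: cst_continuous]; apply: cont_mull;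
  by [exact: continuous_sin|exact: continuous_cos].
Qed.

Lemma par_c_cont a b k : (k < 4)%N -> continuous (fun c => co (par_c a b c) k).
Proof.
apply: row4_cont; [exact: cst_continuous|exact: cst_continuous|apply: cont_opp|]; apply: cont_mull;
  by [exact: continuous_sin|exact: continuous_cos].
Qed.

Definition Da h p := 'D_(par_a p.1.1 p.1.2 p.2) h (par p).
Definition Db h p := 'D_(par_b p.1.1 p.1.2 p.2) h (par p).
Definition Dc h p := 'D_(par_c p.1.1 p.1.2 p.2) h (par p).

Lemma bmeas_D h : sm h -> [/\ bmeas (Da h), bmeas (Db h) & bmeas (Dc h)].
Proof.
by move=> sh; split; apply: bmeas_dir => // k k4; have [h1 h2 h3] := bmeas_pars k4.
Qed.

Lemma is_derive_h (h : V -> R) (f : R -> V) (s : R) w : sm h -> S3 (f s) -> is_derive s 1 f w ->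
  is_derive s 1 (fun s => h (f s)) ('D_w h (f s)).
Proof. by move=> sh Sf df; apply: (@is_derive_curve _ _ _ h f) => //; exact: sm_diff. Qed.

Lemma cont_mul (f g : R -> R) : continuous f -> continuous g -> continuous (fun s => f s * g s).
Proof. by move=> cf cg s; apply: cvgM; [exact: cf|exact: cg]. Qed.
Lemma cont_add (f g : R -> R) : continuous f -> continuous g -> continuous (fun s => f s + g s).
Proof. by move=> cf cg s; apply: cvgD; [exact: cf|exact: cg]. Qed.

Definition bcont (f : R -> R) := continuous f /\ exists M, forall s, `|f s| <= M.

Lemma bcont_bmeas (f : R -> R) pr : bcont f -> measurable_fun setT pr -> bmeas (fun p : T3 => f (pr p)).
Proof. by move=> [cf [M fM]]; exact: bmeas_cont1 cf fM. Qed.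

Lemma cont_shift (f : R -> R) (k : R) : continuous f -> continuous (fun s => f (s + k)).
Proof.
move=> cf s; apply: (@continuous_comp _ _ _ (fun s => s + k) f); last exact: cf.
by apply: cvgD; [exact: cvg_id|exact: cvg_cst].
Qed.

Lemma measurable_bc : measurable_fun setT (fun p : T3 => p.1.2 + p.2).
Proof. by apply: measurable_funD; [exact: measurable_pr2|exact: measurable_pr3]. Qed.

Lemma cos_twopi : cos (2 * pi) = 1 :> R.
Proof. by rewrite mulr_natl cos2pi. Qed.
Lemma sin_twopi : sin (2 * pi) = 0 :> R.
Proof. by rewrite mulr_natl sin2pi. Qed.

(** The integrand is the b-derivative of h ta(b + c) be(a), whose values at b = 0 and b = 2 pi
    agree. The angular factor depends on b + c, the phase by which the fields of J and K rotate in
    these coordinates. *)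
Lemma boxint_b h (be ta dta : R -> R) : sm h -> bcont be -> bcont ta -> bcont dta ->
  (forall s : R, is_derive s 1 ta (dta s)) -> (forall s, ta (s + 2 * pi) = ta s) ->
  boxint (fun p => (Db h p * ta (p.1.2 + p.2) + h (par p) * dta (p.1.2 + p.2)) * be p.1.1) = 0.
Proof.
move=> sh bbe bta bdta dt tper; have [_ bD _] := bmeas_D sh.
have bt := bcont_bmeas bta measurable_bc; have bdt := bcont_bmeas bdta measurable_bc.
apply: boxint0_b.
  apply: bmeasM; last exact: bcont_bmeas bbe (@measurable_pr1 R).
  by apply: bmeasD; apply: bmeasM => //; exact: bmeas_sm.
move=> a c /=.
apply: (@FTC0 _ _ (fun b => h (param a b c) * ta (b + c) * be a)); first exact: twopi_gt0.
- apply: cont_mulr; apply: cont_add; apply: cont_mul.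
  + apply: (@dir_cont h (fun b => param a b c) (fun b => par_b a b c) sh) => [b||k k4].
    * exact: param_S3.
    * exact: param_cont_b.
    * exact: par_b_cont.
  + by apply: cont_shift; exact: bta.1.
  + apply: (@sm_comp_cont h (fun b => param a b c) sh) => [b|]; first exact: param_S3.
    exact: param_cont_b.
  + by apply: cont_shift; exact: bdta.1.
- move=> b; apply: is_derive_mulr; apply: is_derive_mul; last exact: is_derive_shiftl.
  by apply: (@is_derive_h h (fun b => param a b c)) => //; [exact: param_S3|exact: is_derive_par_b].
- rewrite (addrC (2 * pi)) tper add0r; congr (h _ * _ * _).
  by rewrite /param cos_twopi sin_twopi cos0 sin0.
Qed.

Lemma boxint_c h (be ta dta : R -> R) : sm h -> bcont be -> bcont ta -> bcont dta ->
  (forall s : R, is_derive s 1 ta (dta s)) -> (forall s, ta (s + 2 * pi) = ta s) ->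
  boxint (fun p => (Dc h p * ta (p.1.2 + p.2) + h (par p) * dta (p.1.2 + p.2)) * be p.1.1) = 0.
Proof.
move=> sh bbe bta bdta dt tper; have [_ _ bD] := bmeas_D sh.
have bt := bcont_bmeas bta measurable_bc; have bdt := bcont_bmeas bdta measurable_bc.
apply: boxint0_c.
  apply: bmeasM; last exact: bcont_bmeas bbe (@measurable_pr1 R).
  by apply: bmeasD; apply: bmeasM => //; exact: bmeas_sm.
move=> a b /=.
have sw (f : R -> R) : (fun c => f (b + c)) = (fun c => f (c + b)).
  by apply/funext => c; rewrite addrC.
apply: (@FTC0 _ _ (fun c => h (param a b c) * ta (b + c) * be a)); first exact: twopi_gt0.
- apply: cont_mulr; apply: cont_add; apply: cont_mul.
  + apply: (@dir_cont h (fun c => param a b c) (fun c => par_c a b c) sh) => [c||k k4].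
    * exact: param_S3.
    * exact: param_cont_c.
    * exact: par_c_cont.
  + by rewrite sw; apply: cont_shift; exact: bta.1.
  + apply: (@sm_comp_cont h (fun c => param a b c) sh) => [c|]; first exact: param_S3.
    exact: param_cont_c.
  + by rewrite sw; apply: cont_shift; exact: bdta.1.
- move=> c; apply: is_derive_mulr; apply: is_derive_mul.
    by apply: (@is_derive_h h (fun c => param a b c)) => //; [exact: param_S3|exact: is_derive_par_c].
  by rewrite sw addrC; exact: is_derive_shiftl.
- rewrite tper addr0; congr (h _ * _ * _).
  by rewrite /param cos_twopi sin_twopi cos0 sin0.
Qed.

(** The boundary terms vanish because al does: a = 0 and a = pi/2 are the circles where the
    coordinates degenerate. *)
Lemma boxint_a h (al dal ta : R -> R) : sm h -> bcont al -> bcont dal -> bcont ta ->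
  (forall s : R, is_derive s 1 al (dal s)) -> al 0 = 0 -> al (pi / 2) = 0 ->
  boxint (fun p => (Da h p * al p.1.1 + h (par p) * dal p.1.1) * ta (p.1.2 + p.2)) = 0.
Proof.
move=> sh bal bdal bta da al0 alp; have [bD _ _] := bmeas_D sh.
have ba := bcont_bmeas bal (@measurable_pr1 R); have bda := bcont_bmeas bdal (@measurable_pr1 R).
apply: boxint0_a.
  apply: bmeasM; last exact: bcont_bmeas bta measurable_bc.
  by apply: bmeasD; apply: bmeasM => //; exact: bmeas_sm.
move=> b c /=.
apply: (@FTC0 _ _ (fun a => h (param a b c) * al a * ta (b + c))); first exact: pi2_gt0.
- apply: cont_mulr; apply: cont_add; apply: cont_mul.
  + apply: (@dir_cont h (fun a => param a b c) (fun a => par_a a b c) sh) => [a||k k4].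
    * exact: param_S3.
    * exact: param_cont_a.
    * exact: par_a_cont.
  + exact: bal.1.
  + apply: (@sm_comp_cont h (fun a => param a b c) sh) => [a|]; first exact: param_S3.
    exact: param_cont_a.
  + exact: bdal.1.
- move=> a; have H := @is_derive_h h (fun a => param a b c) a _ sh (param_S3 _ _ _) (is_derive_par_a a b c).
  exact: (is_derive_mulr _ (is_derive_mul H (da a))).
- by rewrite al0 alp !mulr0.
Qed.

Lemma bcont_cos : bcont (@cos R).
Proof. by split; [exact: continuous_cos|exists 1; exact: abs_cos_le1]. Qed.
Lemma bcont_sin : bcont (@sin R).
Proof. by split; [exact: continuous_sin|exists 1; exact: abs_sin_le1]. Qed.
Lemma bcont_cst (k : R) : bcont (fun=> k).
Proof. by split; [exact: cst_continuous|exists `|k|]. Qed.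
Lemma bcontM (f g : R -> R) : bcont f -> bcont g -> bcont (fun s => f s * g s).
Proof.
move=> [cf [M fM]] [cg [N gN]]; split; first exact: cont_mul.
by exists (M * N) => s; rewrite normrM ler_pM.
Qed.
Lemma bcontB (f g : R -> R) : bcont f -> bcont g -> bcont (fun s => f s - g s).
Proof.
move=> [cf [M fM]] [cg [N gN]]; split; first by move=> s; apply: cvgB; [exact: cf|exact: cg].
by exists (M + N) => s; rewrite (le_trans (ler_normB _ _)) // lerD.
Qed.
Lemma bcontN (f : R -> R) : bcont f -> bcont (fun s => - f s).
Proof.
by move=> [cf [M fM]]; split; [exact: cont_opp|exists M => s; rewrite normrN].
Qed.

Lemma cos_per (s : R) : cos (s + 2 * pi) = cos s.
Proof. by rewrite mulr_natl cosD2pi. Qed.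
Lemma sin_per (s : R) : sin (s + 2 * pi) = sin s.
Proof. by rewrite mulr_natl sinD2pi. Qed.

Lemma derive_lin3 h x u v w (r s t : R) : sm h -> S3 x ->
  'D_(r *: u + s *: v + t *: w) h x = r * 'D_u h x + s * 'D_v h x + t * 'D_w h x.
Proof.
by move=> sh Sx; have d := sm_diff sh Sx; rewrite !deriveE // !linearD !linearZ.
Qed.

Lemma derive_wt h A p : sm h ->
  'D_(wt p *: (par p *m A)) h (par p) = X A h (par p) * wt p.
Proof.
by move=> sh; have d := sm_diff sh (param_S3 p.1.1 p.1.2 p.2); rewrite /X !deriveE // linearZ mulrC.
Qed.

Lemma boxint_sum3 (F G H K : T3 -> R) : bmeas F -> bmeas G -> bmeas H ->
  boxint F = 0 -> boxint G = 0 -> boxint H = 0 -> (forall p, K p = F p + G p + H p) -> boxint K = 0.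
Proof.
move=> bF bG bH F0 G0 H0 KE; rewrite (eq_boxint (H := fun p => F p + G p + H p)) //.
by rewrite boxintD // ?F0; [rewrite boxintD // F0 G0 H0 !addr0|exact: bmeasD].
Qed.

Let w' a : R := cos a * cos a - sin a * sin a.

Let dw a : is_derive a 1 (fun a : R => cos a * sin a) (w' a).
Proof.
have -> : w' a = - sin a * sin a + cos a * cos a by rewrite /w' addrC mulNr.
exact: is_derive_mul.
Qed.

Let bw : bcont (fun a : R => cos a * sin a). Proof. exact: bcontM bcont_cos bcont_sin. Qed.
Let bw' : bcont w'.
Proof. exact: bcontB (bcontM bcont_cos bcont_cos) (bcontM bcont_sin bcont_sin). Qed.

Let w0 : cos 0 * sin 0 = 0 :> R. Proof. by rewrite sin0 mulr0. Qed.
Let wp : cos (pi / 2) * sin (pi / 2) = 0 :> R. Proof. by rewrite cos_pihalf mul0r. Qed.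

Let bmeas_ta h (F : (V -> R) -> T3 -> R) (al dal ta : R -> R) : sm h -> bmeas (F h) -> bcont al -> bcont dal -> bcont ta ->
  bmeas (fun p => (F h p * al p.1.1 + h (par p) * dal p.1.1) * ta (p.1.2 + p.2)).
Proof.
move=> sh bF ba bd bt; apply: bmeasM; last exact: bcont_bmeas bt measurable_bc.
apply: bmeasD; apply: bmeasM => //.
- exact: bcont_bmeas ba (@measurable_pr1 R).
- exact: bmeas_sm.
- exact: bcont_bmeas bd (@measurable_pr1 R).
Qed.

Let bmeas_tb h (F : (V -> R) -> T3 -> R) (be ta dta : R -> R) : sm h -> bmeas (F h) -> bcont be -> bcont ta -> bcont dta ->
  bmeas (fun p => (F h p * ta (p.1.2 + p.2) + h (par p) * dta (p.1.2 + p.2)) * be p.1.1).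
Proof.
move=> sh bF ba bd bt; apply: bmeasM; last exact: bcont_bmeas ba (@measurable_pr1 R).
apply: bmeasD; apply: bmeasM => //.
- exact: bcont_bmeas bd measurable_bc.
- exact: bmeas_sm.
- exact: bcont_bmeas bt measurable_bc.
Qed.

Lemma Int_XI h : sm h -> Int (X (qI R) h) = 0.
Proof.
move=> sh; have [_ bB bC] := bmeas_D sh.
have b1 := bcont_cst 1; have b0 := bcont_cst 0.
have d1 (s : R) : is_derive s 1 (fun=> 1 : R) 0 by exact: is_derive_cst.
have p1 (s : R) : 1 = 1 :> R by [].
(* [wt] times the field of I is [wt] times the sum of the fields of b and c, so the slot of the
   a-derivative is filled with 0. *)
apply: (boxint_sum3 (bmeas_cst 0) (bmeas_tb sh bB bw b1 b0) (bmeas_tb sh bC bw b1 b0) _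
  (boxint_b sh bw b1 b0 d1 p1) (boxint_c sh bw b1 b0 d1 p1)).
  by rewrite (eq_boxint (H := fun p => 0 * 0)) ?boxintZ ?mul0r //; exact: bmeas_cst.
move=> p; rewrite /X /Db /Dc /wt.
have -> : par p *m qI R = 0 *: (0 : V) + 1 *: par_b p.1.1 p.1.2 p.2 + 1 *: par_c p.1.1 p.1.2 p.2.
  by apply: co_eq; rewrite !(coD, coZ, co_qI) /par -!/(row4 _ _ _ _) !co_row4 ; ring.
rewrite derive_lin3 //; last exact: param_S3.
do 3!move: ('D_(_) h (par p)) => ?; move: (h (par p)) => ?; ring.
Qed.

(** In coordinates, [wt] times the field of J has components cos a sin a cos(b+c), sin^2 a sin(b+c)
    and -cos^2 a sin(b+c). Their coordinate divergence is (cos^2 a - sin^2 a + sin^2 a - cos^2 a)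
    cos(b+c) = 0, so the integrand is a sum of three total derivatives. *)
Lemma Int_XJ h : sm h -> Int (X (qJ R) h) = 0.
Proof.
move=> sh; have [bA bB bC] := bmeas_D sh.
have bc := bcont_cos; have bs := bcont_sin.
have bs2 := bcontM bs bs; have bc2 := bcontN (bcontM bc bc).
have ds (s : R) := is_derive_sin s.
apply: (boxint_sum3 (bmeas_ta sh bA bw bw' bc) (bmeas_tb sh bB bs2 bs bc) (bmeas_tb sh bC bc2 bs bc)
  (boxint_a sh bw bw' bc dw w0 wp) (boxint_b sh bs2 bs bc ds sin_per) (boxint_c sh bc2 bs bc ds sin_per)).
move=> p; rewrite -derive_wt // (_ : wt p *: _ = (wt p * cos (p.1.2 + p.2)) *: par_a p.1.1 p.1.2 p.2 +
   (sin p.1.1 * sin p.1.1 * sin (p.1.2 + p.2)) *: par_b p.1.1 p.1.2 p.2 +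
   (- (cos p.1.1 * cos p.1.1) * sin (p.1.2 + p.2)) *: par_c p.1.1 p.1.2 p.2).
  rewrite derive_lin3 //; last exact: param_S3.
  rewrite /Da /Db /Dc /wt /w'; do 3!move: ('D_(_) h (par p)) => ?; move: (h (par p)) => ?; ring.
(* After the addition formulas the two sides differ by a factor cos^2 + sin^2 of b or of c, which is
   inserted on the left. *)
rewrite sinD cosD; have [Eb Ec] := (cos2Dsin2 p.1.2, cos2Dsin2 p.2).
apply: co_eq; rewrite !(coD, coZ, co_qJ) /par -!/(row4 _ _ _ _) !co_row4 /wt.
- by rewrite -[LHS]mulr1 -Eb; ring.
- by rewrite -[LHS]mulr1 -Eb; ring.
- by rewrite -[LHS]mulr1 -Ec; ring.
- by rewrite -[LHS]mulr1 -Ec; ring.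
Qed.

Lemma Int_XK h : sm h -> Int (X (qK R) h) = 0.
Proof.
move=> sh; have [bA bB bC] := bmeas_D sh.
have bc := bcont_cos; have bs := bcont_sin; have bns := bcontN bs.
have bs2 := bcontN (bcontM bs bs); have bc2 := bcontM bc bc.
have dc (s : R) := is_derive_cos s.
apply: (boxint_sum3 (bmeas_ta sh bA bw bw' bs) (bmeas_tb sh bB bs2 bc bns) (bmeas_tb sh bC bc2 bc bns)
  (boxint_a sh bw bw' bs dw w0 wp) (boxint_b sh bs2 bc bns dc cos_per) (boxint_c sh bc2 bc bns dc cos_per)).
move=> p; rewrite -derive_wt // (_ : wt p *: _ = (wt p * sin (p.1.2 + p.2)) *: par_a p.1.1 p.1.2 p.2 +
   (- (sin p.1.1 * sin p.1.1) * cos (p.1.2 + p.2)) *: par_b p.1.1 p.1.2 p.2 +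
   (cos p.1.1 * cos p.1.1 * cos (p.1.2 + p.2)) *: par_c p.1.1 p.1.2 p.2).
  rewrite derive_lin3 //; last exact: param_S3.
  rewrite /Da /Db /Dc /wt /w'; do 3!move: ('D_(_) h (par p)) => ?; move: (h (par p)) => ?; ring.
rewrite sinD cosD; have [Eb Ec] := (cos2Dsin2 p.1.2, cos2Dsin2 p.2).
apply: co_eq; rewrite !(coD, coZ, co_qK) /par -!/(row4 _ _ _ _) !co_row4 /wt.
- by rewrite -[LHS]mulr1 -Eb; ring.
- by rewrite -[LHS]mulr1 -Eb; ring.
- by rewrite -[LHS]mulr1 -Ec; ring.
- by rewrite -[LHS]mulr1 -Ec; ring.
Qed.

End HopfCoordinates.

(** * The spectral gap of the curl *)

#[local] Opaque X qI qJ qK.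

Ltac smooth :=
  lazymatch goal with
  | |- sm (fun x => GRing.add (@?f x) (@?g x)) => apply: (@smD _ f g); smooth
  | |- sm (fun x => GRing.mul (@?f x) (@?g x)) => apply: (@smM _ f g); smooth
  | |- sm (fun x => GRing.opp (@?f x)) => apply: (@smN _ f); smooth
  | |- sm (fun x => GRing.exp (@?f x) ?n) => apply: (@sm_expr _ n f); smooth
  | |- sm (fun x => X ?A ?f x) => apply: (@sm_X _ A f); smooth
  | |- sm (X ?A ?f) => apply: (@sm_X _ A f); smooth
  | |- sm (fun x => co x ?k) => exact: sm_co
  | |- sm (fun _ => ?c) => exact: sm_cst
  | |- sm (fun x => ?f x) => change (sm f); smooth
  | |- sm ?f => match goal with H : sm ?g |- _ => constr_eq f g; exact H end
  end.

Section SpectralGap.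
Variable R : realType.
Local Notation V := 'rV[R]_4.
Local Notation X1 := (X (qI R)).
Local Notation X2 := (X (qJ R)).
Local Notation X3 := (X (qK R)).
Implicit Types (f g p : V -> R) (x : V).

Lemma IntN h : sm h -> Int (fun x : V => - h x) = - Int h.
Proof.
by move=> sh; rewrite -mulN1r -IntZ //; apply: Int_eq => x _; rewrite mulN1r.
Qed.

Lemma IntB h g : sm h -> sm g -> Int (fun x => h x - g x) = Int h - Int g.
Proof. by move=> sh sg; rewrite IntD ?IntN //; exact: smN. Qed.

Lemma Int0 : Int (fun _ : V => 0) = 0 :> R.
Proof.
transitivity (Int (fun x : V => 0 * (fun=> 0 : R) x)); first by apply: Int_eq => x _; rewrite mul0r.
by rewrite (IntZ 0 (@sm_cst R 0)) mul0r.
Qed.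

Lemma Int_ge0 h : sm h -> (forall x : V, S3 x -> 0 <= h x) -> 0 <= Int h.
Proof. by move=> sh h0; rewrite -Int0; apply: Int_le => //; exact: sm_cst. Qed.

Definition divergence (w1 w2 w3 : V -> R) x : R := X1 w1 x + X2 w2 x + X3 w3 x.

Lemma sm_divergence w1 w2 w3 : sm w1 -> sm w2 -> sm w3 -> sm (divergence w1 w2 w3).
Proof. by move=> s1 s2 s3; rewrite /divergence; smooth. Qed.

Lemma Int_divergence w1 w2 w3 : sm w1 -> sm w2 -> sm w3 -> Int (divergence w1 w2 w3) = 0.
Proof.
move=> s1 s2 s3; have t1 := sm_X (qI R) s1; have t2 := sm_X (qJ R) s2; have t3 := sm_X (qK R) s3.
by rewrite /divergence (IntD (smD t1 t2) t3) (IntD t1 t2) (Int_XI s1) (Int_XJ s2) (Int_XK s3) !addr0.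
Qed.

Variables (a1 a2 a3 : V -> R).
Hypotheses (s1 : sm a1) (s2 : sm a2) (s3 : sm a3).

(** With the two definitions below, the Hodge star of da in the coframe dual to X1, X2, X3; the
    zeroth-order term comes from [X2, X3] = -2 X1. *)
Definition curl1 x : R := X2 a3 x - X3 a2 x + 2 * a1 x.
Definition curl2 x : R := X3 a1 x - X1 a3 x + 2 * a2 x.
Definition curl3 x : R := X1 a2 x - X2 a1 x + 2 * a3 x.

Lemma sm_curl : [/\ sm curl1, sm curl2 & sm curl3].
Proof. by split; rewrite /curl1 /curl2 /curl3; smooth. Qed.

(** In components, w = (a . X) a - (div a) a, the terms a_i X_i a_i having cancelled: the usual
    divergence term of a Bochner formula. *)
Let w1 x := (a2 x * X2 a1 x - a1 x * X2 a2 x) + (a3 x * X3 a1 x - a1 x * X3 a3 x).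
Let w2 x := (a1 x * X1 a2 x - a2 x * X1 a1 x) + (a3 x * X3 a2 x - a2 x * X3 a3 x).
Let w3 x := (a1 x * X1 a3 x - a3 x * X1 a1 x) + (a2 x * X2 a3 x - a3 x * X2 a2 x).

Let X_w A b c d e f g h i x : S3 x -> sm b -> sm c -> sm d -> sm e -> sm f -> sm g -> sm h -> sm i ->
  X A (fun x => (b x * c x - d x * e x) + (f x * g x - h x * i x)) x =
  (X A b x * c x + b x * X A c x - (X A d x * e x + d x * X A e x)) +
  (X A f x * g x + f x * X A g x - (X A h x * i x + h x * X A i x)) :> R.
Proof.
by move=> Sx *; rewrite XD // ?XB // ?XM //; smooth.
Qed.

(** The difference of the two sides is twice the squared norm of the symmetric part of the matrix
    (X_i a_j). Equality therefore means that this matrix is skew. *)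
Lemma bochner_pointwise x : S3 x ->
  4 * (a1 x ^+ 2 + a2 x ^+ 2 + a3 x ^+ 2) - 2 * divergence w1 w2 w3 x <=
  curl1 x ^+ 2 + curl2 x ^+ 2 + curl3 x ^+ 2 + 2 * divergence a1 a2 a3 x ^+ 2.
Proof.
move=> Sx; rewrite -subr_ge0.
suff -> : (curl1 x ^+ 2 + curl2 x ^+ 2 + curl3 x ^+ 2 + 2 * divergence a1 a2 a3 x ^+ 2 -
  (4 * (a1 x ^+ 2 + a2 x ^+ 2 + a3 x ^+ 2) - 2 * divergence w1 w2 w3 x)) =
  2 * (X1 a1 x ^+ 2 + X2 a2 x ^+ 2 + X3 a3 x ^+ 2) +
  (X1 a2 x + X2 a1 x) ^+ 2 + (X2 a3 x + X3 a2 x) ^+ 2 + (X3 a1 x + X1 a3 x) ^+ 2.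
  by do !apply: addr_ge0; rewrite ?sqr_ge0 // mulr_ge0 // !addr_ge0 ?sqr_ge0.
rewrite /divergence {1}/w1 {1}/w2 {1}/w3 !X_w //; do ?exact: sm_X.
rewrite -> (comm_IJ Sx s1), (comm_IJ Sx s2), (comm_JK Sx s2), (comm_JK Sx s3), (comm_KI Sx s1), (comm_KI Sx s3).
rewrite /curl1 /curl2 /curl3; do 6!move: (X _ (X _ _) x) => ?; do 9!move: (X _ _ x) => ?; ring.
Qed.

Lemma bochner : 4 * Int (fun x => a1 x ^+ 2 + a2 x ^+ 2 + a3 x ^+ 2) <=
  Int (fun x => curl1 x ^+ 2 + curl2 x ^+ 2 + curl3 x ^+ 2) + 2 * Int (fun x => divergence a1 a2 a3 x ^+ 2).
Proof.
have [c1 c2 c3] := sm_curl; have sd := sm_divergence s1 s2 s3.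
have [t1 t2 t3] : [/\ sm w1, sm w2 & sm w3] by split; rewrite /w1 /w2 /w3; smooth.
have sw := sm_divergence t1 t2 t3.
have sa : sm (fun x => a1 x ^+ 2 + a2 x ^+ 2 + a3 x ^+ 2) by smooth.
have sc : sm (fun x => curl1 x ^+ 2 + curl2 x ^+ 2 + curl3 x ^+ 2) by smooth.
have sd2 : sm (fun x => divergence a1 a2 a3 x ^+ 2) by smooth.
have s4a : sm (fun x => 4 * (a1 x ^+ 2 + a2 x ^+ 2 + a3 x ^+ 2)) by apply: smM => //; exact: sm_cst.
have s2w : sm (fun x => 2 * divergence w1 w2 w3 x) by apply: smM => //; exact: sm_cst.
have s2d : sm (fun x => 2 * divergence a1 a2 a3 x ^+ 2) by apply: smM => //; exact: sm_cst.
have := Int_le (smB s4a s2w) (smD sc s2d) bochner_pointwise.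
by rewrite (IntB s4a s2w) (IntZ 4 sa) (IntZ 2 sw) (Int_divergence t1 t2 t3) mulr0 subr0 (IntD sc s2d) (IntZ 2 sd2).
Qed.

(** This is dda = 0: each commutator of derivations yields some -2 X_i a_i, which the zeroth-order
    term of the curl compensates. *)
Lemma divergence_curl x : S3 x -> divergence curl1 curl2 curl3 x = 0.
Proof.
move=> Sx; rewrite /divergence.
have E A (f g h : V -> R) : sm f -> sm g -> sm h -> X A (fun x => f x - g x + 2 * h x) x = X A f x - X A g x + 2 * X A h x.
  move=> sf sg sh; rewrite (XD A Sx (smB sf sg)); last by smooth.
  by rewrite (XB A Sx sf sg) (XZ A 2 Sx sh).
rewrite {1}/curl1 {1}/curl2 {1}/curl3 !E; try smooth.
rewrite -> (comm_IJ Sx s3), (comm_JK Sx s1), (comm_KI Sx s2).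
by do 3!move: (X _ (X _ _) x) => ?; do 3!move: (X _ _ x) => ?; ring.
Qed.

(** The curl of a gradient vanishes, again because the commutators cancel the zeroth-order terms; so
    a may be changed by a gradient without changing its curl. *)
Lemma curl_gauge f x : S3 x -> sm f ->
  [/\ X2 (fun y => a3 y - X3 f y) x - X3 (fun y => a2 y - X2 f y) x + 2 * (a1 x - X1 f x) = curl1 x,
      X3 (fun y => a1 y - X1 f y) x - X1 (fun y => a3 y - X3 f y) x + 2 * (a2 x - X2 f x) = curl2 x
    & X1 (fun y => a2 y - X2 f y) x - X2 (fun y => a1 y - X1 f y) x + 2 * (a3 x - X3 f x) = curl3 x].
Proof.
move=> Sx sf.
have E A B (g : V -> R) : sm g -> X A (fun y => g y - X B f y) x = X A g x - X A (X B f) x.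
  by move=> sg; rewrite (XB A Sx sg (sm_X B sf)).
rewrite -> (E (qJ R) (qK R) _ s3), (E (qK R) (qJ R) _ s2), (E (qK R) (qI R) _ s1), (E (qI R) (qK R) _ s3), (E (qI R) (qJ R) _ s2), (E (qJ R) (qI R) _ s1).
split; [rewrite -> (comm_JK Sx sf)|rewrite -> (comm_KI Sx sf)|rewrite -> (comm_IJ Sx sf)];
  rewrite /curl1 /curl2 /curl3; do ?move: (X _ (X _ _) x) => ?; do ?move: (X _ _ x) => ?; ring.
Qed.

(* Closed forms are orthogonal to divergence-free fields: the helicity only sees a modulo gradients. *)
Lemma Int_grad_curl f : sm f -> Int (fun x => X1 f x * curl1 x + X2 f x * curl2 x + X3 f x * curl3 x) = 0.
Proof.
move=> sf; have [c1 c2 c3] := sm_curl.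
rewrite -(Int_divergence (smM sf c1) (smM sf c2) (smM sf c3)); apply: Int_eq => x Sx.
have := divergence_curl Sx; rewrite /divergence !XM // => E.
transitivity (X1 f x * curl1 x + X2 f x * curl2 x + X3 f x * curl3 x + f x * (X1 curl1 x + X2 curl2 x + X3 curl3 x)).
  by rewrite E mulr0 addr0.
do 6!move: (X _ _ x) => ?; move: (curl1 x) (curl2 x) (curl3 x) => ? ? ?; ring.
Qed.

End SpectralGap.

(** * Galerkin projection onto polynomial gradients *)

Section Galerkin.
Variable R : realType.
Local Notation V := 'rV[R]_4.
Local Notation X1 := (X (qI R)).
Local Notation X2 := (X (qJ R)).
Local Notation X3 := (X (qK R)).
Implicit Types (f g p : V -> R) (x : V).

Definition gradpair (a1 a2 a3 : V -> R) g x : R := a1 x * X1 g x + a2 x * X2 g x + a3 x * X3 g x.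

Lemma sm_gradpair a1 a2 a3 g : sm a1 -> sm a2 -> sm a3 -> sm g -> sm (gradpair a1 a2 a3 g).
Proof. by move=> *; rewrite /gradpair; smooth. Qed.

Lemma sm_lincomb n (c : 'I_n -> R) (b : 'I_n -> V -> R) : (forall i, sm (b i)) ->
  sm (fun x => \sum_i c i * b i x).
Proof. by move=> sb; apply: (@sm_sum _ _ (fun i x => c i * b i x)) => i; apply: smM => //; exact: sm_cst. Qed.

Lemma X_lincomb n (c : 'I_n -> R) (b : 'I_n -> V -> R) A x : S3 x -> (forall i, sm (b i)) ->
  X A (fun x => \sum_i c i * b i x) x = \sum_i c i * X A (b i) x.
Proof.
move=> Sx; elim: n c b => [|n IH] c b sb.
  rewrite big_ord0 (_ : (fun _ => _) = fun=> 0) ?X_cst //.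
  by apply/funext => y; rewrite big_ord0.
rewrite big_ord_recl -(IH (fun i => c (lift ord0 i)) (fun i => b (lift ord0 i))) //.
rewrite (_ : (fun _ => _) = fun y => c ord0 * b ord0 y + \sum_(i < n) c (lift ord0 i) * b (lift ord0 i) y).
  have t1 : sm (fun y => c ord0 * b ord0 y) by apply: smM => //; exact: sm_cst.
  by rewrite (XD A Sx t1 (sm_lincomb _ (fun i => sb (lift ord0 i)))) (XZ A (c ord0) Sx (sb ord0)).
by apply/funext => y; rewrite big_ord_recl.
Qed.

Lemma Int_lincomb n (c : 'I_n -> R) (b : 'I_n -> V -> R) : (forall i, sm (b i)) ->
  Int (fun x => \sum_i c i * b i x) = \sum_i c i * Int (b i).
Proof.
elim: n c b => [|n IH] c b sb.
  rewrite big_ord0 (_ : (fun _ => _) = fun x : V => 0 * (fun=> 0) x).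
    by rewrite (IntZ 0 (sm_cst 0)) mul0r.
  by apply/funext => y; rewrite big_ord0 mul0r.
rewrite big_ord_recl -(IH (fun i => c (lift ord0 i)) (fun i => b (lift ord0 i))) //.
rewrite (_ : (fun _ => _) = fun y => c ord0 * b ord0 y + \sum_(i < n) c (lift ord0 i) * b (lift ord0 i) y).
  have t1 : sm (fun y => c ord0 * b ord0 y) by apply: smM => //; exact: sm_cst.
  by rewrite (IntD t1 (sm_lincomb _ (fun i => sb (lift ord0 i)))) (IntZ (c ord0) (sb ord0)).
by apply/funext => y; rewrite big_ord_recl.
Qed.

Lemma Int_gradpair_lincomb a1 a2 a3 n (c : 'I_n -> R) (b : 'I_n -> V -> R) :
  sm a1 -> sm a2 -> sm a3 -> (forall i, sm (b i)) ->
  Int (gradpair a1 a2 a3 (fun x => \sum_i c i * b i x)) = \sum_i c i * Int (gradpair a1 a2 a3 (b i)).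
Proof.
move=> s1 s2 s3 sb; rewrite -Int_lincomb; last by move=> i; exact: sm_gradpair.
apply: Int_eq => x Sx; rewrite /gradpair !X_lincomb // !mulr_sumr -!big_split /=.
by apply: eq_bigr => i _; do 3!move: (X _ _ x) => ?; ring.
Qed.

Lemma gradpairC f g x : gradpair (X1 f) (X2 f) (X3 f) g x = gradpair (X1 g) (X2 g) (X3 g) f x.
Proof. by rewrite /gradpair; do !move: (X _ _ x) => ?; ring. Qed.

(** The integral of |a + s grad f|^2 is nonnegative for every s, and affine in s when the gradient
    has zero norm, so its slope vanishes. *)
Lemma Int_gradpair_eq0 a1 a2 a3 f : sm a1 -> sm a2 -> sm a3 -> sm f ->
  Int (gradpair (X1 f) (X2 f) (X3 f) f) = 0 -> Int (gradpair a1 a2 a3 f) = 0.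
Proof.
move=> s1 s2 s3 sf f0.
have [t1 t2 t3] : [/\ sm (X1 f), sm (X2 f) & sm (X3 f)] by split; smooth.
set L := Int _; set A := Int (fun x => a1 x ^+ 2 + a2 x ^+ 2 + a3 x ^+ 2).
have sA : sm (fun x => a1 x ^+ 2 + a2 x ^+ 2 + a3 x ^+ 2) by smooth.
have sL := sm_gradpair s1 s2 s3 sf; have sD := sm_gradpair t1 t2 t3 sf.
have pos (s : R) : 0 <= A + (2 * s) * L.
  have c2 : sm (fun x => (2 * s) * gradpair a1 a2 a3 f x) by apply: smM => //; exact: sm_cst.
  have c3 : sm (fun x => s ^+ 2 * gradpair (X1 f) (X2 f) (X3 f) f x) by apply: smM => //; exact: sm_cst.
  have := Int_ge0 (smD (smD sA c2) c3).
  rewrite (IntD (smD sA c2) c3) (IntD sA c2) (IntZ (2 * s) sL) (IntZ (s ^+ 2) sD) f0 mulr0 addr0.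
  apply => x _; rewrite /gradpair.
  move: (X1 f x) (X2 f x) (X3 f x) => y1 y2 y3.
  rewrite [X in 0 <= X](_ : _ = (a1 x + s * y1) ^+ 2 + (a2 x + s * y2) ^+ 2 + (a3 x + s * y3) ^+ 2); last by ring.
  by rewrite !addr_ge0 ?sqr_ge0.
apply/eqP/negP => /negP L0.
(* At this s the affine function would take the value -1. *)
have := pos (- (A + 1) / (2 * L)).
rewrite (_ : A + _ = -1); last by field.
by rewrite oppr_ge0 ler10.
Qed.

Lemma polydeg_span n p : polydeg n p -> exists c : 'I_(size (polybasis R n)) -> R,
  forall x, p x = \sum_i c i * nth (fun=> 0) (polybasis R n) i x.
Proof. by move=> [c pE]; exists (fun i => c i). Qed.

Lemma sm_polybasis n i : sm (nth (fun=> 0) (polybasis R n) i).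
Proof. exact: (@sm_polydeg _ n _ (each_nth i (span0 _) (span_self (polybasis R n)))). Qed.

(* The best gradient approximation of a among polynomials of degree n exists: the vector of pairings is killed by the kernel of the Gram matrix, hence lies in its row space. *)
Lemma galerkin n a1 a2 a3 : sm a1 -> sm a2 -> sm a3 -> exists2 f, polydeg n f &
  forall p, polydeg n p -> Int (gradpair a1 a2 a3 p) = Int (gradpair (X1 f) (X2 f) (X3 f) p).
Proof.
move=> s1 s2 s3; pose N := size (polybasis R n).
pose b (i : 'I_N) := nth (fun=> 0 : R) (polybasis R n) i.
have sb i : sm (b i) by exact: sm_polybasis.
pose D f g := Int (gradpair (X1 f) (X2 f) (X3 f) g).
have DC f g : D f g = D g f by apply: Int_eq => x _; exact: gradpairC.
have DL f (c : 'I_N -> R) : sm f -> D f (fun x => \sum_i c i * b i x) = \sum_i c i * D f (b i).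
  by move=> sf; rewrite /D Int_gradpair_lincomb //; smooth.
pose G : 'M[R]_N := \matrix_(i, j) D (b i) (b j).
pose l : 'rV[R]_N := \row_j Int (gradpair a1 a2 a3 (b j)).
have /submxP[d lE] : (l <= G)%MS.
  rewrite submxE; apply/eqP/rowP => k; rewrite !mxE.
  pose c (j : 'I_N) : R := cokermx G j k.
  have sf := sm_lincomb c sb.
  have Z : D (fun x => \sum_i c i * b i x) (fun x => \sum_i c i * b i x) = 0.
    rewrite (DL _ c sf) big1 // => i _; rewrite DC (DL (b i) c (sb i)).
    have /matrixP/(_ i k) := mulmx_coker G; rewrite !mxE => E.
    have -> : \sum_j c j * D (b i) (b j) = 0.
      by rewrite -[RHS]E; apply: eq_bigr => j _; rewrite mxE mulrC.
    by rewrite mulr0.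
  have := Int_gradpair_eq0 s1 s2 s3 sf Z.
  rewrite (Int_gradpair_lincomb c s1 s2 s3 sb) => {2}<-.
  by apply: eq_bigr => j _; rewrite mxE mulrC.
exists (fun x => \sum_i d 0 i * b i x).
  by exists (fun i => if insub i is Some j then d 0 j else 0) => x; apply: eq_bigr => i _; rewrite valK.
move=> p /polydeg_span[c /funext ->].
have sf := sm_lincomb (d 0) sb.
rewrite (Int_gradpair_lincomb c s1 s2 s3 sb) -/(D _ _) (DL _ c sf); apply: eq_bigr => j _; congr (_ * _).
rewrite DC (DL _ (d 0) (sb j)); have /rowP/(_ j) := lE; rewrite !mxE => ->.
by apply: eq_bigr => i _; rewrite mxE DC.
Qed.

End Galerkin.

Section HelicityBound.
Variable R : realType.
Local Notation V := 'rV[R]_4.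
Local Notation X1 := (X (qI R)).
Local Notation X2 := (X (qJ R)).
Local Notation X3 := (X (qK R)).
Variables (a1 a2 a3 : V -> R).
Hypotheses (s1 : sm a1) (s2 : sm a2) (s3 : sm a3).
Local Notation b1 f := (fun y => a1 y - X1 f y).
Local Notation b2 f := (fun y => a2 y - X2 f y).
Local Notation b3 f := (fun y => a3 y - X3 f y).
Implicit Types (f g p : V -> R) (x : V).

Lemma Int_by_parts g p : sm g -> sm p -> forall v1 v2 v3, sm v1 -> sm v2 -> sm v3 ->
  (forall x, S3 x -> g x = divergence v1 v2 v3 x) ->
  Int (fun x => g x * p x) = - Int (gradpair v1 v2 v3 p).
Proof.
move=> sg sp v1 v2 v3 t1 t2 t3 gE.
have sgp := smM sg sp; have sG := sm_gradpair t1 t2 t3 sp.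
apply/eqP; rewrite -addr_eq0 -(IntD sgp sG) -(Int_divergence (smM t1 sp) (smM t2 sp) (smM t3 sp)).
apply/eqP; apply: Int_eq => x Sx; rewrite gE // /divergence /gradpair.
rewrite -> (XM (qI R) Sx t1 sp), (XM (qJ R) Sx t2 sp), (XM (qK R) Sx t3 sp).
by do 6!move: (X _ _ x) => ?; ring.
Qed.

Lemma coulomb_gauge (e : R) : 0 < e -> exists2 f, sm f &
  Int (fun x => divergence (b1 f) (b2 f) (b3 f) x ^+ 2)
    <= e ^+ 2 * Int (fun=> 1).
Proof.
move=> e0; have sd := sm_divergence s1 s2 s3.
have [|d [p [dp pd]]] := S3_Weierstrass (f := divergence a1 a2 a3) e0.
  by move=> x Sx; apply: cvg_within_filter; exact: sm_cont.
have [f df Hf] := galerkin d s1 s2 s3; have sf := sm_polydeg df; exists f => //.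
have [t1 t2 t3] : [/\ sm (b1 f), sm (b2 f) & sm (b3 f)].
  by split; smooth.
have sg := sm_divergence t1 t2 t3; set g := divergence _ _ _ in sg *.
have orth q : polydeg d q -> Int (fun x => g x * q x) = 0.
  move=> dq; have sq := sm_polydeg dq.
  rewrite (Int_by_parts sg sq t1 t2 t3) //.
  have [u1 u2 u3] := And3 (sm_X (qI R) sf) (sm_X (qJ R) sf) (sm_X (qK R) sf).
  rewrite (_ : Int _ = Int (gradpair a1 a2 a3 q) - Int (gradpair (X1 f) (X2 f) (X3 f) q)).
    by rewrite Hf // subrr oppr0.
  rewrite -(IntB (sm_gradpair s1 s2 s3 sq) (sm_gradpair u1 u2 u3 sq)); apply: Int_eq => x _.
  by rewrite /gradpair; do 6!move: (X _ _ x) => ?; ring.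
pose lap := divergence (X1 f) (X2 f) (X3 f).
have dlap : polydeg d lap by apply: polydegD; [apply: polydegD|]; do 2!apply: polydegX.
have slap := sm_polydeg dlap; have sp := sm_polydeg dp.
have gE x : S3 x -> g x = divergence a1 a2 a3 x - lap x.
  move=> Sx; rewrite /g /lap /divergence.
  rewrite -> (XB (qI R) Sx s1 (sm_X (qI R) sf)), (XB (qJ R) Sx s2 (sm_X (qJ R) sf)), (XB (qK R) Sx s3 (sm_X (qK R) sf)).
  by do 3!move: (X _ (X _ _) x) => ?; do 3!move: (X _ _ x) => ?; ring.
have sh : sm (fun x => divergence a1 a2 a3 x - p x) by exact: smB.
have sg2 : sm (fun x => g x ^+ 2) by exact: sm_expr.
have E1 : Int (fun x => g x ^+ 2) = Int (fun x => g x * (divergence a1 a2 a3 x - p x)).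
  have dq : polydeg d (fun x => p x + (-1) * lap x) by apply: polydegD => //; exact: polydegZ.
  have h1 := smM sg sh; have h2 := smM sg (sm_polydeg dq).
  rewrite -[RHS]addr0 -(orth _ dq) -(IntD h1 h2); apply: Int_eq => x Sx.
  by rewrite expr2 {2}gE //; ring.
have sh2 : sm (fun x => (divergence a1 a2 a3 x - p x) ^+ 2) by exact: sm_expr.
have E2 : Int (fun x => (divergence a1 a2 a3 x - p x) ^+ 2) <= e ^+ 2 * Int (fun=> 1).
  rewrite -(IntZ (e ^+ 2) (sm_cst 1)); apply: Int_le => //; first by apply: smM; exact: sm_cst.
  move=> x Sx; rewrite mulr1 -real_normK ?num_real // distrC ler_pXn2r ?nnegrE ?(ltW e0) //.
  exact: pd.
have E3 : 2 * Int (fun x => g x * (divergence a1 a2 a3 x - p x)) <=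
    Int (fun x => g x ^+ 2) + Int (fun x => (divergence a1 a2 a3 x - p x) ^+ 2).
  have h1 := smM sg sh.
  rewrite -(IntZ 2 h1) -(IntD sg2 sh2); apply: Int_le => //; [by apply: smM => //; exact: sm_cst|exact: smD|].
  move=> x _; rewrite -subr_ge0.
  rewrite [X in 0 <= X](_ : _ = (g x - (divergence a1 a2 a3 x - p x)) ^+ 2) ?sqr_ge0 //.
  by move: (g x) (divergence a1 a2 a3 x) (p x) => ? ? ?; ring.
apply: le_trans E2; rewrite -E1 in E3; lra.
Qed.

(** Subtracting a gradient from a changes neither integral. In the approximate Coulomb gauge, 4 a .
    b <= |b|^2 + 4 |a|^2 pointwise, and [bochner] bounds the integral of 4 |a|^2 by that of |b|^2 up
    to 2 e. *)
Theorem helicity_bound :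
  2 * Int (fun x => a1 x * curl1 a1 a2 a3 x + a2 x * curl2 a1 a2 a3 x + a3 x * curl3 a1 a2 a3 x) <=
  Int (fun x => curl1 a1 a2 a3 x ^+ 2 + curl2 a1 a2 a3 x ^+ 2 + curl3 a1 a2 a3 x ^+ 2).
Proof.
have [c1 c2 c3] := sm_curl s1 s2 s3.
set B := Int (fun x => _ + curl3 _ _ _ x ^+ 2); set H := Int _.
have I1 : 0 <= Int (fun=> 1 : R) by apply: Int_ge0 => // ; exact: sm_cst.
apply/ler_addgt0Pl => e e0.
(* Makes the bound of [coulomb_gauge], d^2 times the volume, at most e; the added 1 keeps the
   denominator positive. *)
pose d := Num.sqrt (e / (1 + Int (fun=> 1 : R))).
have p1 : 0 < 1 + Int (fun=> 1 : R) by rewrite ltr_pwDl.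
have d0 : 0 < d by rewrite sqrtr_gt0 divr_gt0.
have [f sf Hf] := coulomb_gauge d0.
have {}Hf : Int (fun x => divergence (b1 f) (b2 f) (b3 f) x ^+ 2) <= e.
  apply: (le_trans Hf); rewrite sqr_sqrtr; last by rewrite divr_ge0 // ltW.
  by rewrite mulrAC ler_pdivrMr // ler_wpM2l ?(ltW e0) // lerDr.
have [t1 t2 t3] : [/\ sm (b1 f), sm (b2 f) & sm (b3 f)].
  by split; smooth.
have Bo := bochner t1 t2 t3.
have BE : Int (fun x => curl1 (b1 f) (b2 f) (b3 f) x ^+ 2 +
   curl2 (b1 f) (b2 f) (b3 f) x ^+ 2 +
   curl3 (b1 f) (b2 f) (b3 f) x ^+ 2) = B.
  apply: Int_eq => x Sx; have [E1 E2 E3] := curl_gauge s1 s2 s3 Sx sf.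
  by congr (_ ^+ 2 + _ ^+ 2 + _ ^+ 2).
rewrite BE in Bo; move: Bo; set A := Int (fun x => _ + (a3 x - X3 f x) ^+ 2); move=> Bo.
have HE : H = Int (fun x => (a1 x - X1 f x) * curl1 a1 a2 a3 x + (a2 x - X2 f x) * curl2 a1 a2 a3 x + (a3 x - X3 f x) * curl3 a1 a2 a3 x).
  have u1 : sm (fun x => a1 x * curl1 a1 a2 a3 x + a2 x * curl2 a1 a2 a3 x + a3 x * curl3 a1 a2 a3 x) by smooth.
  have u2 : sm (fun x => X1 f x * curl1 a1 a2 a3 x + X2 f x * curl2 a1 a2 a3 x + X3 f x * curl3 a1 a2 a3 x) by smooth.
  rewrite -[LHS]subr0 -(Int_grad_curl s1 s2 s3 sf) -(IntB u1 u2); apply: Int_eq => x _.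
  by move: (curl1 _ _ _ x) (curl2 _ _ _ x) (curl3 _ _ _ x) => ? ? ?; do 3!move: (X _ _ x) => ?; ring.
have CS : 4 * H <= B + 4 * A.
  have v1 : sm (fun x => (a1 x - X1 f x) * curl1 a1 a2 a3 x + (a2 x - X2 f x) * curl2 a1 a2 a3 x + (a3 x - X3 f x) * curl3 a1 a2 a3 x) by smooth.
  have v2 : sm (fun x => curl1 a1 a2 a3 x ^+ 2 + curl2 a1 a2 a3 x ^+ 2 + curl3 a1 a2 a3 x ^+ 2) by smooth.
  have v3 : sm (fun x => (a1 x - X1 f x) ^+ 2 + (a2 x - X2 f x) ^+ 2 + (a3 x - X3 f x) ^+ 2) by smooth.
  have v1' := smM (@sm_cst R 4) v1; have v3' := smM (@sm_cst R 4) v3.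
  rewrite HE -(IntZ 4 v1) -(IntZ 4 v3) -(IntD v2 v3'); apply: Int_le => // [|x _]; first exact: smD.
  move: (curl1 _ _ _ x) (curl2 _ _ _ x) (curl3 _ _ _ x) => y1 y2 y3; move: (X1 f x) (X2 f x) (X3 f x) => z1 z2 z3.
  rewrite -subr_ge0 [X in 0 <= X](_ : _ = (y1 - 2 * (a1 x - z1)) ^+ 2 + (y2 - 2 * (a2 x - z2)) ^+ 2 + (y3 - 2 * (a3 x - z3)) ^+ 2).
    by rewrite !addr_ge0 ?sqr_ge0.
  by ring.
lra.
Qed.

End HelicityBound.

(** * Invariance of the degree *)

Section Pfaffian.
Variable R : realType.
Implicit Types (u v w a b c d y z : nat -> R).

Definition omega u v : R := u 0%N * v 1%N - u 1%N * v 0%N + (u 2%N * v 3%N - u 3%N * v 2%N).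

(* omega is the symplectic form <iu, v> of C^2, and Pf u v1 v2 v3 the Pfaffian of the matrix of its values, i.e. the determinant of the four vectors. *)
Definition Pf u y1 y2 y3 : R := omega u y1 * omega y2 y3 + omega u y2 * omega y3 y1 + omega u y3 * omega y1 y2.

Definition dotn u v : R := u 0%N * v 0%N + u 1%N * v 1%N + u 2%N * v 2%N + u 3%N * v 3%N.

Lemma Pf_swap01 u y1 y2 y3 : Pf y1 u y2 y3 = - Pf u y1 y2 y3.
Proof. by rewrite /Pf /omega; ring. Qed.
Lemma Pf_swap02 u y1 y2 y3 : Pf y2 y1 u y3 = - Pf u y1 y2 y3.
Proof. by rewrite /Pf /omega; ring. Qed.
Lemma Pf_swap03 u y1 y2 y3 : Pf y3 y1 y2 u = - Pf u y1 y2 y3.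
Proof. by rewrite /Pf /omega; ring. Qed.

(** z and z' stand for X1 X2 w and X2 X1 w, and y3 for X3 w. The commutator contributes a repeated
    column, so the second derivatives of w cancel in the divergence computed below. *)
Lemma Pf_comm12 u d y3 z z' : (forall k, z k = z' k - 2 * y3 k) ->
  Pf u d z y3 + Pf u z' d y3 = 0.
Proof. by move=> E; rewrite /Pf /omega !E; ring. Qed.
Lemma Pf_comm23 u d y1 z z' : (forall k, z k = z' k - 2 * y1 k) ->
  Pf u y1 d z + Pf u y1 z' d = 0.
Proof. by move=> E; rewrite /Pf /omega !E; ring. Qed.
Lemma Pf_comm31 u d y2 z z' : (forall k, z k = z' k - 2 * y2 k) ->
  Pf u z y2 d + Pf u d y2 z' = 0.
Proof. by move=> E; rewrite /Pf /omega !E; ring. Qed.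

(** The expansion of d in the vectors u, y1, y2, y3, paired with u and cleared of denominators. *)
Lemma Cramer u d y1 y2 y3 : dotn u d * Pf u y1 y2 y3 =
  dotn u u * Pf d y1 y2 y3 + dotn u y1 * Pf u d y2 y3 + dotn u y2 * Pf u y1 d y3 + dotn u y3 * Pf u y1 y2 d.
Proof. by rewrite /Pf /omega /dotn; ring. Qed.

Lemma Pf_scale u y1 y2 y3 (r m1 m2 m3 : R) :
  Pf (fun k => r * u k) (fun k => r * y1 k + m1 * u k) (fun k => r * y2 k + m2 * u k) (fun k => r * y3 k + m3 * u k)
  = r ^+ 4 * Pf u y1 y2 y3.
Proof. by rewrite /Pf /omega; ring. Qed.

Lemma variation_algebra (q D PI PJ PK P P1 P2 P3 t1 t2 t3 e r a a' b b' c c' : R) :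
  q * r = 1 -> e * P = r * D + t1 * P1 + t2 * P2 + t3 * P3 -> a + a' = 0 -> b + b' = 0 -> c + c' = 0 ->
  q * q * (D + PI + PJ + PK) - 4 * (q * q * q) * e * P =
  2 * q * (- 2 * (q * q) * t1) * P1 + q * q * (- D + PI + a + c') +
  (2 * q * (- 2 * (q * q) * t2) * P2 + q * q * (- D + a' + PJ + b)) +
  (2 * q * (- 2 * (q * q) * t3) * P3 + q * q * (- D + c + b' + PK)).
Proof.
move=> qr eP /eqP; rewrite addr_eq0 => /eqP -> /eqP; rewrite addr_eq0 => /eqP -> /eqP; rewrite addr_eq0 => /eqP ->.
rewrite -(mulrA _ e P) eP; apply/eqP; rewrite -subr_eq0; apply/eqP.
transitivity (4 * (q * q) * D * (1 - q * r)); first by ring.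
by rewrite qr subrr mulr0.
Qed.

Lemma cauchy_schwarz4 u v : dotn u v ^+ 2 <= dotn u u * dotn v v.
Proof.
rewrite -subr_ge0 /dotn.
rewrite [X in 0 <= X](_ : _ = (u 0%N * v 1%N - u 1%N * v 0%N) ^+ 2 + (u 0%N * v 2%N - u 2%N * v 0%N) ^+ 2 +
  (u 0%N * v 3%N - u 3%N * v 0%N) ^+ 2 + (u 1%N * v 2%N - u 2%N * v 1%N) ^+ 2 +
  (u 1%N * v 3%N - u 3%N * v 1%N) ^+ 2 + (u 2%N * v 3%N - u 3%N * v 2%N) ^+ 2); last by ring.
by rewrite !addr_ge0 ?sqr_ge0.
Qed.

End Pfaffian.

Section FieldCalculus.
Variable R : realType.
Local Notation V := 'rV[R]_4.
Local Notation qI := (qI R).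
Local Notation qJ := (qJ R).
Local Notation qK := (qK R).
Implicit Types (u v w d : nat -> V -> R) (x : V) (A : 'M[R]_4).

Definition smf u := forall k, sm (u k).
Definition XF A u : nat -> V -> R := fun k => X A (u k).

Lemma smf_XF A u : smf u -> smf (XF A u).
Proof. by move=> su k; exact: sm_X. Qed.

Lemma sm_omega u v : smf u -> smf v -> sm (fun x => omega (u^~ x) (v^~ x)).
Proof.
move=> su sv; rewrite /omega.
have := (su 0%N, su 1%N, su 2%N, su 3%N); have := (sv 0%N, sv 1%N, sv 2%N, sv 3%N).
by move=> [[[? ?] ?] ?] [[[? ?] ?] ?]; smooth.
Qed.

Lemma sm_dotn u v : smf u -> smf v -> sm (fun x => dotn (u^~ x) (v^~ x)).
Proof.
move=> su sv; rewrite /dotn.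
have := (su 0%N, su 1%N, su 2%N, su 3%N); have := (sv 0%N, sv 1%N, sv 2%N, sv 3%N).
by move=> [[[? ?] ?] ?] [[[? ?] ?] ?]; smooth.
Qed.

Lemma X_dotn A u v x : S3 x -> smf u -> smf v ->
  X A (fun x => dotn (u^~ x) (v^~ x)) x = dotn (XF A u ^~ x) (v^~ x) + dotn (u^~ x) (XF A v ^~ x).
Proof.
move=> Sx su sv; rewrite /dotn /XF.
have m k : sm (fun x => u k x * v k x) by exact: smM.
rewrite (XD A Sx (smD (smD (m 0%N) (m 1%N)) (m 2%N)) (m 3%N)) (XD A Sx (smD (m 0%N) (m 1%N)) (m 2%N)).
rewrite (XD A Sx (m 0%N) (m 1%N)) !(fun k => XM A Sx (su k) (sv k)).
by do 8!move: (X _ _ x) => ?; ring.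
Qed.

Lemma X_omega A u v x : S3 x -> smf u -> smf v ->
  X A (fun x => omega (u^~ x) (v^~ x)) x = omega (XF A u ^~ x) (v^~ x) + omega (u^~ x) (XF A v ^~ x).
Proof.
move=> Sx su sv; rewrite /omega /XF.
have m k l : sm (fun x => u k x * v l x) by exact: smM.
rewrite (XD A Sx (smB (m 0%N 1%N) (m 1%N 0%N)) (smB (m 2%N 3%N) (m 3%N 2%N))).
rewrite (XB A Sx (m 0%N 1%N) (m 1%N 0%N)) (XB A Sx (m 2%N 3%N) (m 3%N 2%N)).
rewrite !(fun k l => XM A Sx (su k) (sv l)).
by do 8!move: (X _ _ x) => ?; ring.
Qed.

Definition PfF u a b c x : R := Pf (u^~ x) (a^~ x) (b^~ x) (c^~ x).

Lemma sm_PfF u a b c : smf u -> smf a -> smf b -> smf c -> sm (PfF u a b c).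
Proof.
move=> su sa sb sc; rewrite /PfF /Pf.
by apply: smD; [apply: smD|]; apply: smM; exact: sm_omega.
Qed.

Lemma X_PfF A u a b c x : S3 x -> smf u -> smf a -> smf b -> smf c ->
  X A (PfF u a b c) x = PfF (XF A u) a b c x + PfF u (XF A a) b c x + PfF u a (XF A b) c x + PfF u a b (XF A c) x.
Proof.
move=> Sx su sa sb sc; rewrite /PfF /Pf.
have m p q r s : smf p -> smf q -> smf r -> smf s ->
  sm (fun x => omega (p^~ x) (q^~ x) * omega (r^~ x) (s^~ x)).
  by move=> *; apply: smM; exact: sm_omega.
have M p q r s : smf p -> smf q -> smf r -> smf s ->
  X A (fun x => omega (p^~ x) (q^~ x) * omega (r^~ x) (s^~ x)) x =
  (omega (XF A p ^~ x) (q^~ x) + omega (p^~ x) (XF A q ^~ x)) * omega (r^~ x) (s^~ x) +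
  omega (p^~ x) (q^~ x) * (omega (XF A r ^~ x) (s^~ x) + omega (r^~ x) (XF A s ^~ x)).
  by move=> sp sq sr ss; rewrite (XM A Sx (sm_omega sp sq) (sm_omega sr ss)) !X_omega.
rewrite (XD A Sx (smD (m _ _ _ _ su sa sb sc) (m _ _ _ _ su sb sc sa)) (m _ _ _ _ su sc sa sb)).
rewrite (XD A Sx (m _ _ _ _ su sa sb sc) (m _ _ _ _ su sb sc sa)) !M //.
by do !move: (omega _ _) => ?; ring.
Qed.

Definition Jac u x : R := PfF u (XF qI u) (XF qJ u) (XF qK u) x.

Lemma sm_Jac u : smf u -> sm (Jac u).
Proof. by move=> su; apply: sm_PfF => //; exact: smf_XF. Qed.

Section Variation.
Variables (w d : nat -> V -> R) (q : V -> R).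
Hypotheses (sw : smf w) (sd : smf d) (sq : sm q).
Hypothesis qE : forall x, S3 x -> q x * dotn (w^~ x) (w^~ x) = 1.

(* The derivative of Jac (w + s d) / |w + s d|^4 at s = 0. *)
Definition variation x : R :=
  q x * q x * (PfF d (XF qI w) (XF qJ w) (XF qK w) x + PfF w (XF qI d) (XF qJ w) (XF qK w) x +
     PfF w (XF qI w) (XF qJ d) (XF qK w) x + PfF w (XF qI w) (XF qJ w) (XF qK d) x)
  - 4 * (q x * q x * q x) * dotn (w^~ x) (d^~ x) * Jac w x.

Let V1 x := q x * q x * PfF w d (XF qJ w) (XF qK w) x.
Let V2 x := q x * q x * PfF w (XF qI w) d (XF qK w) x.
Let V3 x := q x * q x * PfF w (XF qI w) (XF qJ w) d x.

(** Obtained by differentiating q |w|^2 = 1, an equality on the sphere only, whence the tangency of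
    A. *)
Let Xq A x : S3 x -> tangent_field A -> X A q x = - 2 * (q x * q x) * dotn (w^~ x) (XF A w ^~ x).
Proof.
move=> Sx tA; have sr := sm_dotn sw sw.
have : X A (fun x => q x * dotn (w^~ x) (w^~ x)) x = 0.
  by rewrite (X_ext tA Sx (smM sq sr) (sm_cst 1) qE) X_cst.
rewrite (XM A Sx sq sr) (X_dotn A Sx sw sw).
have -> : dotn (XF A w ^~ x) (w^~ x) = dotn (w^~ x) (XF A w ^~ x) by rewrite /dotn; do 4!move: (XF _ _ _ x) => ?; ring.
have := qE Sx; move: (X A q x) (q x) (dotn (w^~ x) (w^~ x)) (dotn (w^~ x) (XF A w ^~ x)) => xq q0 r t E1 E2.
transitivity (xq * (q0 * r)); first by rewrite E1 mulr1.
transitivity (q0 * (xq * r + q0 * (t + t)) - q0 * q0 * (t + t)); first by ring.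
by rewrite E2; ring.
Qed.

Let XqqP A x (P : V -> R) : S3 x -> sm P ->
  X A (fun x => q x * q x * P x) x = 2 * q x * X A q x * P x + q x * q x * X A P x.
Proof.
move=> Sx sP; rewrite (XM A Sx (smM sq sq) sP) (XM A Sx sq sq).
by do 2!move: (X _ _ x) => ?; ring.
Qed.

(** The form det(w, ., ., .) / |w|^4 is closed away from 0, so the derivative of its pullback along
    w + s d is exact, with primitive the contraction by d; [V1], [V2] and [V3] are the components of
    that primitive. *)
Lemma variation_divergence x : S3 x -> variation x = divergence V1 V2 V3 x.
Proof.
move=> Sx; rewrite /divergence /V1 /V2 /V3.
have [swI swJ swK] := And3 (smf_XF qI sw) (smf_XF qJ sw) (smf_XF qK sw).
rewrite (XqqP qI Sx (sm_PfF sw sd swJ swK)) (XqqP qJ Sx (sm_PfF sw swI sd swK)) (XqqP qK Sx (sm_PfF sw swI swJ sd)).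
rewrite (Xq Sx (@tangent_qI R)) (Xq Sx (@tangent_qJ R)) (Xq Sx (@tangent_qK R)).
rewrite (X_PfF qI Sx sw sd swJ swK) (X_PfF qJ Sx sw swI sd swK) (X_PfF qK Sx sw swI swJ sd).
have C12 := @Pf_comm12 R (w^~ x) (d^~ x) (XF qK w ^~ x) (XF qI (XF qJ w) ^~ x) (XF qJ (XF qI w) ^~ x) (fun k => comm_IJ Sx (sw k)).
have C23 := @Pf_comm23 R (w^~ x) (d^~ x) (XF qI w ^~ x) (XF qJ (XF qK w) ^~ x) (XF qK (XF qJ w) ^~ x) (fun k => comm_JK Sx (sw k)).
have C31 := @Pf_comm31 R (w^~ x) (d^~ x) (XF qJ w ^~ x) (XF qK (XF qI w) ^~ x) (XF qI (XF qK w) ^~ x) (fun k => comm_KI Sx (sw k)).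
have Cr := Cramer (w^~ x) (d^~ x) (XF qI w ^~ x) (XF qJ w ^~ x) (XF qK w ^~ x).
have qr := qE Sx.
rewrite /variation /Jac /PfF.
rewrite -> (Pf_swap01 (d^~ x) (XF qI w ^~ x)), (Pf_swap02 (d^~ x) (XF qI w ^~ x) (XF qJ w ^~ x)), (Pf_swap03 (d^~ x) (XF qI w ^~ x) (XF qJ w ^~ x) (XF qK w ^~ x)).
exact: (variation_algebra _ _ _ qr Cr C12 C23 C31).
Qed.

Lemma Int_variation : Int variation = 0.
Proof.
have [swI swJ swK] := And3 (smf_XF qI sw) (smf_XF qJ sw) (smf_XF qK sw).
have m P : sm P -> sm (fun x => q x * q x * P x) by move=> sP; apply: smM => //; exact: smM.
rewrite (Int_eq variation_divergence) Int_divergence //; apply: m; exact: sm_PfF.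
Qed.

End Variation.

End FieldCalculus.

(** * Constancy of the degree along a segment *)

Section Path.
Variable R : realType.
Local Notation V := 'rV[R]_4.
Local Notation qI := (qI R).
Local Notation qJ := (qJ R).
Local Notation qK := (qK R).

Definition aff (u d : nat -> R) (s : R) : nat -> R := fun k => u k + s * d k.

Lemma is_derive_add (f g : R -> R) (s df dg : R) : is_derive s 1 f df -> is_derive s 1 g dg ->
  is_derive s 1 (fun s => f s + g s) (df + dg).
Proof. by move=> df' dg'; exact: (is_deriveD df' dg'). Qed.

Lemma is_derive_opp (f : R -> R) (s df : R) : is_derive s 1 f df -> is_derive s 1 (fun s => - f s) (- df).
Proof. by move=> df'; exact: (is_deriveN df'). Qed.

Lemma is_derive_val (f : R -> R) (s df df' : R) : is_derive s 1 f df -> df = df' -> is_derive s 1 f df'.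
Proof. by move=> + <-. Qed.

Lemma is_derive_aff u d (s : R) k : is_derive s 1 (fun s => aff u d s k) (d k).
Proof.
have h : is_derive s 1 (fun s : R => u k + s * d k) (0 + 1 * d k).
  exact: (is_derive_add (is_derive_cst (u k) s 1) (is_derive_mulr (d k) (is_derive_id s 1))).
by apply: (is_derive_val h); rewrite add0r mul1r.
Qed.

Lemma is_derive_inv (f : R -> R) (s df : R) : f s != 0 -> is_derive s 1 f df ->
  is_derive s 1 (fun s => (f s)^-1) (- ((f s)^-1 * (f s)^-1 * df)).
Proof.
move=> f0 [d1 d2]; apply: DeriveDef; first exact: derivableV.
by rewrite deriveV // d2 /GRing.scale /= expr2 invfM mulNr.
Qed.

Lemma is_derive_omega u d a a' (s : R) :
  is_derive s 1 (fun s => omega (aff u d s) (aff a a' s)) (omega d (aff a a' s) + omega (aff u d s) a').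
Proof.
have m k l := is_derive_mul (is_derive_aff u d s k) (is_derive_aff a a' s l).
apply: (is_derive_val (is_derive_add (is_derive_add (m 0%N 1%N) (is_derive_opp (m 1%N 0%N)))
  (is_derive_add (m 2%N 3%N) (is_derive_opp (m 3%N 2%N))))).
by rewrite /omega; ring.
Qed.

Lemma is_derive_dotn u d (s : R) :
  is_derive s 1 (fun s => dotn (aff u d s) (aff u d s)) (2 * dotn (aff u d s) d).
Proof.
have m k := is_derive_mul (is_derive_aff u d s k) (is_derive_aff u d s k).
apply: (is_derive_val (is_derive_add (is_derive_add (is_derive_add (m 0%N) (m 1%N)) (m 2%N)) (m 3%N))).
by rewrite /dotn; ring.
Qed.

Lemma is_derive_Pf u d a a' b b' c c' (s : R) :
  is_derive s 1 (fun s => Pf (aff u d s) (aff a a' s) (aff b b' s) (aff c c' s))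
   (Pf d (aff a a' s) (aff b b' s) (aff c c' s) + Pf (aff u d s) a' (aff b b' s) (aff c c' s) +
    Pf (aff u d s) (aff a a' s) b' (aff c c' s) + Pf (aff u d s) (aff a a' s) (aff b b' s) c').
Proof.
have m p p' q q' r r' t t' := is_derive_mul (is_derive_omega p p' q q' s) (is_derive_omega r r' t t' s).
apply: (is_derive_val (is_derive_add (is_derive_add (m u d a a' b b' c c') (m u d b b' c c' a a')) (m u d c c' a a' b b'))).
by rewrite /Pf; do !move: (omega _ _) => ?; ring.
Qed.

Variables (u d : nat -> V -> R).
Hypotheses (su : smf u) (sd : smf d).

Definition seg (s : R) : nat -> V -> R := fun k x => u k x + s * d k x.

Lemma smf_seg s : smf (seg s).
Proof. by move=> k; apply: smD; [exact: su|apply: smM; [exact: sm_cst|exact: sd]]. Qed.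

Lemma XF_seg A s x : S3 x -> XF A (seg s) ^~ x = aff (XF A u ^~ x) (XF A d ^~ x) s.
Proof.
move=> Sx; apply/funext => k; rewrite /XF /seg /aff.
by rewrite (XD A Sx (su k) (smM (sm_cst s) (sd k))) (XZ A s Sx (sd k)).
Qed.

Let q s x : R := (dotn (seg s ^~ x) (seg s ^~ x))^-1.

(** The Jacobian of the normalized map w / |w|, see [Jac_normf]. *)
Definition Jac0 (w : nat -> V -> R) x : R :=
  (dotn (w^~ x) (w^~ x))^-1 * (dotn (w^~ x) (w^~ x))^-1 * Jac w x.

Lemma is_derive_Jac0 s x : S3 x -> dotn (seg s ^~ x) (seg s ^~ x) != 0 ->
  is_derive s 1 (fun s => Jac0 (seg s) x) (variation (seg s) d (q s) x).
Proof.
move=> Sx n0; rewrite /Jac0 /Jac /PfF.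
have -> : (fun s => (dotn (seg s ^~ x) (seg s ^~ x))^-1 * (dotn (seg s ^~ x) (seg s ^~ x))^-1 *
    Pf (seg s ^~ x) (XF qI (seg s) ^~ x) (XF qJ (seg s) ^~ x) (XF qK (seg s) ^~ x)) =
  (fun s => (dotn (aff (u^~ x) (d^~ x) s) (aff (u^~ x) (d^~ x) s))^-1 * (dotn (aff (u^~ x) (d^~ x) s) (aff (u^~ x) (d^~ x) s))^-1 *
    Pf (aff (u^~ x) (d^~ x) s) (aff (XF qI u ^~ x) (XF qI d ^~ x) s) (aff (XF qJ u ^~ x) (XF qJ d ^~ x) s) (aff (XF qK u ^~ x) (XF qK d ^~ x) s)).
  by apply/funext => t; rewrite -> (XF_seg qI t Sx), (XF_seg qJ t Sx), (XF_seg qK t Sx).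
have iv := @is_derive_inv (fun s => dotn (aff (u^~ x) (d^~ x) s) (aff (u^~ x) (d^~ x) s)) s _ n0 (is_derive_dotn (u^~ x) (d^~ x) s).
apply: (is_derive_val (is_derive_mul (is_derive_mul iv iv) (is_derive_Pf _ _ _ _ _ _ _ _ s))).
rewrite /variation /q /Jac /PfF; rewrite -> (XF_seg qI s Sx), (XF_seg qJ s Sx), (XF_seg qK s Sx).
rewrite -[seg s ^~ x]/(aff (u^~ x) (d^~ x) s).
do !move: (Pf _ _ _ _) => ?; do !move: (dotn _ _) => ?; do ?move: (_^-1) => ?.
ring.
Qed.

Section UniformBounds.
Local Notation mu3 := ((@lebesgue_measure R \x @lebesgue_measure R) \x @lebesgue_measure R)%E.
Variables (de c : R).
Hypotheses (de0 : 0 < de) (de1 : de <= 1) (c0 : 0 < c).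
(** An open interval around [0, 1], so that two-sided derivatives exist at both endpoints; [ub] and
    [ubf] are bounds uniform over it, for dominated differentiation. *)
Let I (s : R) := - de < s < 1 + de.
Hypothesis lb : forall s, I s -> forall x, S3 x -> c <= dotn (seg s ^~ x) (seg s ^~ x).

Let ub (H : R -> V -> R) := exists M, forall s x, I s -> S3 x -> `|H s x| <= M.
Let ubf (W : R -> nat -> V -> R) := forall k, ub (fun s x => W s k x).

Let ub_sm g : sm g -> ub (fun=> g).
Proof.
move=> sg; have [|M HM] := S3_bounded (g := g); first by move=> x; exact: sm_cont.
by exists M => s x _; exact: HM.
Qed.

Let ub_s : ub (fun s _ => s).
Proof.
exists 2 => s x /andP[h1 h2] _; rewrite ler_norml; apply/andP; split; move: de1 => h; lra.
Qed.

Let ubD H K : ub H -> ub K -> ub (fun s x => H s x + K s x).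
Proof.
move=> [M HM] [N HN]; exists (M + N) => s x Is Sx.
by rewrite (le_trans (ler_normD _ _)) // lerD // ?HM ?HN.
Qed.

Let ubM H K : ub H -> ub K -> ub (fun s x => H s x * K s x).
Proof.
move=> [M HM] [N HN]; exists (M * N) => s x Is Sx.
by rewrite normrM ler_pM // ?HM ?HN.
Qed.

Let ubN H : ub H -> ub (fun s x => - H s x).
Proof. by move=> [M HM]; exists M => s x Is Sx; rewrite normrN HM. Qed.

Let ub_omega W Z : ubf W -> ubf Z -> ub (fun s x => omega (W s ^~ x) (Z s ^~ x)).
Proof.
move=> bW bZ; rewrite /omega.
apply: (ubD (ubD (ubM (bW 0%N) (bZ 1%N)) (ubN (ubM (bW 1%N) (bZ 0%N))))
  (ubD (ubM (bW 2%N) (bZ 3%N)) (ubN (ubM (bW 3%N) (bZ 2%N))))).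
Qed.

Let ub_dotn W Z : ubf W -> ubf Z -> ub (fun s x => dotn (W s ^~ x) (Z s ^~ x)).
Proof.
move=> bW bZ; rewrite /dotn.
apply: (ubD (ubD (ubD (ubM (bW 0%N) (bZ 0%N)) (ubM (bW 1%N) (bZ 1%N))) (ubM (bW 2%N) (bZ 2%N))) (ubM (bW 3%N) (bZ 3%N))).
Qed.

Let ub_PfF W A B C : ubf W -> ubf A -> ubf B -> ubf C -> ub (fun s x => PfF (W s) (A s) (B s) (C s) x).
Proof.
move=> bW bA bB bC; rewrite /PfF /Pf.
apply: (ubD (ubD (ubM (ub_omega bW bA) (ub_omega bB bC)) (ubM (ub_omega bW bB) (ub_omega bC bA))) (ubM (ub_omega bW bC) (ub_omega bA bB))).
Qed.

Let ubf_smf w : smf w -> ubf (fun=> w).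
Proof. by move=> sw k; exact: ub_sm. Qed.

Let ubf_seg : ubf seg.
Proof. by move=> k; apply: (ubD (ub_sm (su k)) (ubM ub_s (ub_sm (sd k)))). Qed.

Let ubf_XF_seg A : ubf (fun s => XF A (seg s)).
Proof.
move=> k; have [M HM] := ubD (ub_sm (smf_XF A su k)) (ubM ub_s (ub_sm (smf_XF A sd k))).
exists M => s x Is Sx; have := HM s x Is Sx.
by rewrite -[XF A (seg s) k x]/((XF A (seg s) ^~ x) k) (XF_seg A s Sx).
Qed.

Let ub_q : ub q.
Proof.
exists c^-1 => s x Is Sx; have h := lb Is Sx; have p := lt_le_trans c0 h.
by rewrite /q normfV gtr0_norm // lef_pV2 // posrE.
Qed.

Let ub_variation : ub (fun s x => variation (seg s) d (q s) x).
Proof.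
have [bI bJ bK] := And3 (ubf_XF_seg qI) (ubf_XF_seg qJ) (ubf_XF_seg qK).
have [dI dJ dK] := And3 (ubf_smf (smf_XF qI sd)) (ubf_smf (smf_XF qJ sd)) (ubf_smf (smf_XF qK sd)).
have bd := ubf_smf sd; have b4 := ub_sm (sm_cst 4).
rewrite /variation /Jac.
exact: (ubD (ubM (ubM ub_q ub_q) (ubD (ubD (ubD (ub_PfF bd bI bJ bK) (ub_PfF ubf_seg dI bJ bK)) (ub_PfF ubf_seg bI dJ bK)) (ub_PfF ubf_seg bI bJ dK)))
  (ubN (ubM (ubM (ubM b4 (ubM (ubM ub_q ub_q) ub_q)) (ub_dotn ubf_seg bd)) (ub_PfF ubf_seg bI bJ bK)))).
Qed.

Let seg_pos s x : I s -> S3 x -> 0 < dotn (seg s ^~ x) (seg s ^~ x).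
Proof. by move=> Is Sx; exact: lt_le_trans (lb Is Sx). Qed.

Let sm_q s : I s -> sm (q s).
Proof.
by move=> Is; apply: smV; [exact: sm_dotn (smf_seg s) (smf_seg s)|move=> x; exact: seg_pos].
Qed.

Let sm_Jac0 s : I s -> sm (Jac0 (seg s)).
Proof.
move=> Is; have sq := sm_q Is; have sJ := sm_Jac (smf_seg s).
exact: smM (smM sq sq) sJ.
Qed.

Let phi (s : R) (p : R * R * R) : R := Jac0 (seg s) (par p) * wt p.

Let dphi s p : I s -> is_derive s 1 (phi ^~ p) (variation (seg s) d (q s) (par p) * wt p).
Proof.
move=> Is; apply: is_derive_mulr; apply: is_derive_Jac0; first exact: param_S3.
by apply: lt0r_neq0; apply: seg_pos => //; exact: param_S3.
Qed.

(** Differentiation under the integral sign, dominated by a constant on the box; the derivative is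
    the integral of a divergence, by [Int_variation]. *)
Lemma is_derive_Int_Jac0 s : I s -> is_derive s 1 (fun s => Int (Jac0 (seg s))) 0.
Proof.
move=> Is; have [M HM] := ub_variation.
have M0 : 0 <= M by apply: le_trans (normr_ge0 _) (HM s (par (0, 0, 0)) Is (param_S3 _ _ _)).
have Iitv x : `]- de, (1 + de)[%classic x -> I x by rewrite /= in_itv.
have Is' : `]- de, (1 + de)[%classic s by rewrite /= in_itv.
have intf x : `]- de, (1 + de)[%classic x ->
   mu3.-integrable (@param_dom R) (EFin \o phi x).
  by move=> /Iitv Ix; apply: bmeas_integrable; apply: bmeas_Int; exact: sm_Jac0.
have dif x y : `]- de, (1 + de)[%classic x -> @param_dom R y -> derivable (phi ^~ y) x 1.
  by move=> /Iitv Ix _; have [] := dphi y Ix.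
have intG := bmeas_integrable (bmeas_cst M).
have Gub x y : `]- de, (1 + de)[%classic x -> @param_dom R y -> `|partial1of2 phi x y| <= M.
  move=> /Iitv Ix _; rewrite partial1of2E; have [_ ->] := dphi y Ix.
  rewrite normrM -[leRHS]mulr1 ler_pM // ?HM //; first exact: param_S3.
  by rewrite /wt normrM -[leRHS]mulr1 ler_pM // ?abs_cos_le1 ?abs_sin_le1.
have mb := @measurable_box R.
have D1 := @derivable_under_integral R _ _ mu3 phi (@param_dom R) mb s (- de) (1 + de) Is' intf dif (fun=> M) (fun=> M0) intG Gub.
have D2 := @differentiation_under_integral R _ _ mu3 phi (@param_dom R) mb s (- de) (1 + de) Is' intf dif (fun=> M) (fun=> M0) intG Gub.
apply: DeriveDef; first exact: D1.
rewrite -derive1E [LHS]D2.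
have qE x : S3 x -> q s x * dotn (seg s ^~ x) (seg s ^~ x) = 1.
  by move=> Sx; rewrite /q mulVf // lt0r_neq0 // seg_pos.
rewrite -(Int_variation (smf_seg s) sd (sm_q Is) qE); apply: eq_boxint => p _.
by rewrite partial1of2E; have [_ ->] := dphi p Is.
Qed.

Lemma Int_Jac0_const : Int (Jac0 (seg 1)) = Int (Jac0 (seg 0)).
Proof.
have [|a _] := @MVT_from0 R (fun s => Int (Jac0 (seg s))) (fun=> 0) 1 ltr01.
  by move=> a /andP[a0 a1]; apply: is_derive_Int_Jac0; apply/andP; split; move: de0 => h; lra.
by rewrite mul0r => /eqP; rewrite subr_eq0 => /eqP.
Qed.

End UniformBounds.

End Path.

Section DegreeStep.
Variable R : realType.
Local Notation V := 'rV[R]_4.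

Definition normf (v : nat -> V -> R) : nat -> V -> R :=
  fun k x => (Num.sqrt (dotn (v^~ x) (v^~ x)))^-1 * v k x.

Lemma smf_normf v : smf v -> (forall x, S3 x -> 0 < dotn (v^~ x) (v^~ x)) -> smf (normf v).
Proof.
move=> sv vp k; apply: smM => //; apply: smV.
  by apply: sm_sqrt => //; exact: sm_dotn.
by move=> x Sx; rewrite sqrtr_gt0 vp.
Qed.

(** Differentiating the scalar 1/|v| only adds multiples of v to the other three columns of the
    determinant, which leaves it unchanged; the factor 1/|v| then comes out of all four columns. *)
Lemma Jac_normf v x : smf v -> (forall x, S3 x -> 0 < dotn (v^~ x) (v^~ x)) -> S3 x ->
  Jac (normf v) x = Jac0 v x.
Proof.
move=> sv vp Sx; have sr : sm (fun x => (Num.sqrt (dotn (v^~ x) (v^~ x)))^-1).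
  apply: smV; first by apply: sm_sqrt => //; exact: sm_dotn.
  by move=> y Sy; rewrite sqrtr_gt0 vp.
have XE A : XF A (normf v) ^~ x = (fun k => (Num.sqrt (dotn (v^~ x) (v^~ x)))^-1 * XF A v k x +
   X A (fun x => (Num.sqrt (dotn (v^~ x) (v^~ x)))^-1) x * v k x).
  by apply/funext => k; rewrite /XF /normf (XM A Sx sr (sv k)) addrC.
rewrite /Jac0 /Jac /PfF; rewrite -> (XE (qI R)), (XE (qJ R)), (XE (qK R)).
rewrite -[normf v ^~ x]/(fun k => (Num.sqrt (dotn (v^~ x) (v^~ x)))^-1 * v k x) Pf_scale.
congr (_ * _); rewrite exprVn -[4%N]/(2 * 2)%N exprM sqr_sqrtr ?ltW ?vp //.
by rewrite expr2 invfM.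
Qed.

(** Since <u, u + s (v - u)> = 1 + s (<u, v> - 1), pairing with u keeps the segment from u to v away
    from 0, and the normalized segment deforms u into v / |v|. *)
Lemma degree_step u v : smf u -> smf v -> (forall x, S3 x -> dotn (u^~ x) (u^~ x) = 1) ->
  (forall x, S3 x -> 2^-1 <= dotn (u^~ x) (v^~ x)) -> Int (Jac (normf v)) = Int (Jac u).
Proof.
move=> su sv u1 uv.
have vp x : S3 x -> 0 < dotn (v^~ x) (v^~ x).
  move=> Sx; have := cauchy_schwarz4 (u^~ x) (v^~ x); rewrite u1 // mul1r.
  by apply: lt_le_trans; rewrite exprn_gt0 // (lt_le_trans _ (uv x Sx)).
pose d : nat -> V -> R := fun k x => v k x - u k x.
have sd : smf d by move=> k; apply: smB.
have e1 : seg u d 1 = v by apply/funext => k; apply/funext => x; rewrite /seg /d mul1r addrC subrK.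
have e0 : seg u d 0 = u by apply/funext => k; apply/funext => x; rewrite /seg mul0r addr0.
have [|M HM] := @S3_bounded R (fun x => dotn (u^~ x) (v^~ x)).
  by move=> x Sx; apply: sm_cont => //; exact: sm_dotn.
(* Small enough that the pairing stays above 1/4 for -de < s < 1 + de, whence the lower bound 1/16.
   The bound M on <u, v> serves for negative s. *)
pose de := (4 * (`|M| + 1))^-1.
have M1 : 0 < `|M| + 1 by rewrite ltr_wpDl.
have de0 : 0 < de by rewrite invr_gt0 mulr_gt0.
have deM : de * (4 * (`|M| + 1)) = 1 by rewrite mulVf // lt0r_neq0 // mulr_gt0.
have deM0 : 0 <= de * `|M| by rewrite mulr_ge0 // ltW.
have de1 : de <= 1 by lra.
have c0 : 0 < (16^-1 : R) by rewrite invr_gt0.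
have -> : Int (Jac u) = Int (Jac0 (seg u d 0)).
  by rewrite e0; apply: Int_eq => x Sx; rewrite /Jac0 u1 // invr1 !mul1r.
have -> : Int (Jac (normf v)) = Int (Jac0 (seg u d 1)).
  by rewrite e1; apply: Int_eq => x Sx; rewrite Jac_normf.
apply: (Int_Jac0_const su sd de0 de1 c0) => s /andP[s1 s2] x Sx.
have := cauchy_schwarz4 (u^~ x) (seg u d s ^~ x); rewrite u1 // mul1r; apply: le_trans.
have -> : dotn (u^~ x) (seg u d s ^~ x) = 1 + s * (dotn (u^~ x) (v^~ x) - 1).
  transitivity (dotn (u^~ x) (u^~ x) + s * (dotn (u^~ x) (v^~ x) - dotn (u^~ x) (u^~ x))).
    by rewrite /dotn /seg /d; ring.
  by rewrite u1.
have t1 := uv x Sx; have := HM x Sx; rewrite ler_norml => /andP[_].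
move: (dotn _ _) t1 => t t1 tM.
have {}tM : t <= `|M| by rewrite (le_trans tM) // ler_norm.
have h : 4^-1 <= 1 + s * (t - 1).
  have [t2|t2] := lerP 1 t.
    have : - (de * `|M|) <= s * (t - 1).
      have h1 : - de * (t - 1) <= s * (t - 1) by rewrite ler_wpM2r ?subr_ge0 // ltW.
      have h2 : de * (t - 1) <= de * `|M| by rewrite ler_wpM2l ?(ltW de0) //; lra.
      lra.
    lra.
  have : (1 + de) * (t - 1) <= s * (t - 1) by rewrite ler_wnM2r ?(ltW s2) //; lra.
  have : (1 + de) * (t - 1) >= (1 + de) * (- 2^-1) by rewrite ler_wpM2l //; lra.
  lra.
have -> : 16^-1 = 4^-1 ^+ 2 :> R by rewrite exprVn; congr (_^-1); ring.
by rewrite ler_pXn2r ?nnegrE ?invr_ge0 // (le_trans _ h) // invr_ge0.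
Qed.

End DegreeStep.

(** * Lifting through the Hopf map *)

Section HopfAlgebra.
Variable R : realType.
Implicit Types (u p : nat -> R).

Definition hopfn u (j : nat) : R :=
  nth 0 [:: u 0%N * u 2%N + u 1%N * u 3%N; u 1%N * u 2%N - u 0%N * u 3%N;
            2^-1 * ((u 0%N ^+ 2 + u 1%N ^+ 2) - (u 2%N ^+ 2 + u 3%N ^+ 2))] j.

(* 1/2 + p . sigma on C^2, with the Pauli matrices sigma: for |p| = 1/2 this is the orthogonal projection onto the line which the Hopf map sends to p. *)
Definition lineproj p u (k : nat) : R :=
  nth 0 [:: (2^-1 + p 2%N) * u 0%N + p 0%N * u 2%N - p 1%N * u 3%N;
            (2^-1 + p 2%N) * u 1%N + p 0%N * u 3%N + p 1%N * u 2%N;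
            p 0%N * u 0%N + p 1%N * u 1%N + (2^-1 - p 2%N) * u 2%N;
            p 0%N * u 1%N - p 1%N * u 0%N + (2^-1 - p 2%N) * u 3%N] k.

Definition dot3 p q : R := p 0%N * q 0%N + p 1%N * q 1%N + p 2%N * q 2%N.

(** If p makes no obtuse angle with the Hopf image of a unit vector u, then u has inner product at
    least 1/2 with its projection, which is the threshold of [degree_step]. *)
Lemma dot_lineproj p u : dotn u (lineproj p u) = 2^-1 * dotn u u + 2 * dot3 p (hopfn u).
Proof. by rewrite /dotn /dot3 /lineproj /hopfn /=; field. Qed.

(** For |p| = 1/2 the Hopf image of the projected vector is p times its squared norm. A polynomial
    approximation p need not lie on the sphere, and the error then carries the factor 1/4 -
    |p|^2. *)
Lemma hopfn_lineproj p u j : (j < 3)%N ->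
  hopfn (lineproj p u) j = p j * (dotn (lineproj p u) (lineproj p u) + (4^-1 - dot3 p p) * dotn u u)
    + (4^-1 - dot3 p p) * hopfn u j.
Proof.
by case: j => [|[|[|//]]] _; rewrite /dotn /dot3 /lineproj /hopfn /=; field.
Qed.

Lemma hopfn_norm u : 4 * dot3 (hopfn u) (hopfn u) = dotn u u ^+ 2.
Proof. by rewrite /dotn /dot3 /hopfn /=; field. Qed.

Lemma hopfn_scale r u j : hopfn (fun k => r * u k) j = r ^+ 2 * hopfn u j.
Proof. by case: j => [|[|[|j]]]; rewrite /hopfn /= ?nth_nil ?mulr0 //; ring. Qed.

End HopfAlgebra.

Section LiftStep.
Variable R : realType.
Local Notation V := 'rV[R]_4.
Variables (psi : nat -> V -> R) (p : nat -> V -> R).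
Hypotheses (spsi : smf psi) (sp : smf p).
Hypothesis psi1 : forall x, S3 x -> dotn (psi^~ x) (psi^~ x) = 1.
Hypothesis pos : forall x, S3 x -> 0 <= dot3 (p^~ x) (hopfn (psi^~ x)).

Definition lineprojf : nat -> V -> R := fun k x => lineproj (p^~ x) (psi^~ x) k.

Lemma smf_lineprojf : smf lineprojf.
Proof.
have [p0 [p1 p2]] := (sp 0%N, (sp 1%N, sp 2%N)).
have [s0 [s1 [s2 s3]]] := (spsi 0%N, (spsi 1%N, (spsi 2%N, spsi 3%N))).
case=> [|[|[|[|k]]]]; rewrite /lineprojf /lineproj /=; smooth.
Qed.

Lemma dot_lineprojf x : S3 x -> 2^-1 <= dotn (psi^~ x) (lineprojf ^~ x).
Proof.
move=> Sx; rewrite -[lineprojf ^~ x]/(lineproj (p^~ x) (psi^~ x)) dot_lineproj psi1 // mulr1 lerDl.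
by rewrite mulr_ge0 // pos.
Qed.

Lemma lineprojf_ge x : S3 x -> 4^-1 <= dotn (lineprojf ^~ x) (lineprojf ^~ x).
Proof.
move=> Sx; have := cauchy_schwarz4 (psi^~ x) (lineprojf ^~ x); rewrite psi1 // mul1r; apply: le_trans.
have h := dot_lineprojf Sx.
have -> : 4^-1 = 2^-1 ^+ 2 :> R by rewrite exprVn; congr (_^-1); ring.
by rewrite ler_pXn2r ?nnegrE ?invr_ge0 // (le_trans _ h) // invr_ge0.
Qed.

Lemma lineprojf_gt0 x : S3 x -> 0 < dotn (lineprojf ^~ x) (lineprojf ^~ x).
Proof. by move=> Sx; apply: lt_le_trans (lineprojf_ge Sx); rewrite invr_gt0. Qed.

Definition lift : nat -> V -> R := normf lineprojf.

Lemma smf_lift : smf lift.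
Proof. by apply: smf_normf; [exact: smf_lineprojf|exact: lineprojf_gt0]. Qed.

Lemma dotn_scale (r : R) u v : dotn (fun k => r * u k) (fun k => r * v k) = r ^+ 2 * dotn u v.
Proof. by rewrite /dotn; ring. Qed.

Lemma lift_norm x : S3 x -> dotn (lift^~ x) (lift^~ x) = 1.
Proof.
move=> Sx; have vp := lineprojf_gt0 Sx.
rewrite /lift /normf dotn_scale exprVn sqr_sqrtr ?ltW // mulVf //.
exact: lt0r_neq0.
Qed.

Lemma Int_Jac_lift : Int (Jac lift) = Int (Jac psi).
Proof. exact: degree_step spsi smf_lineprojf psi1 dot_lineprojf. Qed.

Lemma hopfn_lift x j : S3 x -> (j < 3)%N -> hopfn (lift^~ x) j - p j x =
  (4^-1 - dot3 (p^~ x) (p^~ x)) * (p j x + hopfn (psi^~ x) j) / dotn (lineprojf ^~ x) (lineprojf ^~ x).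
Proof.
move=> Sx j3; have vp := lineprojf_gt0 Sx.
rewrite /lift /normf hopfn_scale exprVn sqr_sqrtr ?ltW //.
rewrite -[X in hopfn X]/(lineproj (p^~ x) (psi^~ x)) hopfn_lineproj // psi1 //.
rewrite -[X in dotn X]/(lineprojf ^~ x) -[X in dotn _ X]/(lineprojf ^~ x).
move: (dotn _ _) vp (dot3 _ _) (hopfn _ _) => r r0 N h; field.
by rewrite lt0r_neq0.
Qed.

End LiftStep.

Section Chain.
Variable R : realType.
Local Notation V := 'rV[R]_4.
Local Notation W := 'rV[R]_3.

Lemma dot3E (y z : W) : dot y z = dot3 (fun j => y 0 (inord j)) (fun j => z 0 (inord j)).
Proof.
rewrite /dot /dot3 !big_ord_recl big_ord0 addr0 addrA.
by congr (_ * _ + _ * _ + _ * _); congr (_ 0 _); apply/val_inj; rewrite /= inordK.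
Qed.

Lemma dot3_half (h : nat -> R) : dot3 h h = 4^-1 -> forall j, (j < 3)%N -> `|h j| <= 2^-1.
Proof.
rewrite /dot3 => E; have q0 k : 0 <= h k * h k by rewrite -expr2 sqr_ge0.
have [a [b c]] := (q0 0%N, (q0 1%N, q0 2%N)).
have H (s : R) : s * s <= 4^-1 -> `|s| <= 2^-1.
  move=> h1; rewrite -(@ler_pXn2r _ 2) ?nnegrE ?invr_ge0 // real_normK ?num_real //.
  by rewrite expr2 (le_trans h1) //; lra.
by case=> [|[|[|//]]] _; apply: H; lra.
Qed.

(* With f = g + O(1/20) on the sphere |g| = 1/2, the fibre lines of f and of a polynomial approximation p of g are never orthogonal, so an approximate lift of f can be projected onto the lines of p. *)
Lemma lift_error (p h g : nat -> R) (e : R) : dot3 g g = 4^-1 -> dot3 h h = 4^-1 -> e <= 20^-1 ->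
  (forall j, (j < 3)%N -> `|p j - g j| <= e) -> forall r j, (j < 3)%N -> 4^-1 <= r ->
  `|(4^-1 - dot3 p p) * (p j + h j) / r| <= 36 * e.
Proof.
move=> g1 h1 e20 pg r j j3 r4; have gb := dot3_half g1; have hb := dot3_half h1.
have e0 : 0 <= e by apply: le_trans (normr_ge0 _) (pg 0%N isT).
have [r0 rV] : 0 < r /\ r^-1 <= 4.
  have r0 : 0 < r by apply: lt_le_trans r4; rewrite invr_gt0.
  by split => //; rewrite -[leRHS]invrK lef_pV2 ?posrE // invr_gt0.
have pb k : (k < 3)%N -> `|p k + g k| <= 2.
  move=> k3; have := pg k k3; have := gb k k3; rewrite !ler_norml => /andP[? ?] /andP[? ?].
  by apply/andP; split; lra.
have m k : (k < 3)%N -> `|(p k - g k) * (p k + g k)| <= e * 2.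
  by move=> k3; rewrite normrM ler_pM // ?pg ?pb.
have N : `|4^-1 - dot3 p p| <= 6 * e.
  have [a [b c]] := (m 0%N isT, (m 1%N isT, m 2%N isT)).
  rewrite -g1 distrC; move: a b c; rewrite /dot3 !ler_norml => /andP[? ?] /andP[? ?] /andP[? ?].
  by apply/andP; split; lra.
have q : `|p j + h j| <= 3 / 2.
  have := pg j j3; have := gb j j3; have := hb j j3.
  rewrite !ler_norml => /andP[? ?] /andP[? ?] /andP[? ?]; by apply/andP; split; lra.
rewrite !normrM (gtr0_norm (_ : 0 < r^-1)) ?invr_gt0 //.
have -> : 36 * e = 6 * e * (3 / 2) * 4 by field.
by rewrite !ler_pM ?mulr_ge0 ?invr_ge0 ?normr_ge0 ?(ltW r0).
Qed.

(** The coordinates of p - h are at most 3/20, so |p - h|^2 <= 27/400 < 1/4 = |h|^2, and 2 <p, h> =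
    |p|^2 + |h|^2 - |p - h|^2. *)
Lemma lift_positive (p h g f : nat -> R) : dot3 h h = 4^-1 ->
  (forall j, (j < 3)%N -> `|p j - g j| <= 20^-1) -> (forall j, (j < 3)%N -> `|f j - g j| <= 20^-1) ->
  (forall j, (j < 3)%N -> `|h j - f j| <= 20^-1) -> 0 <= dot3 p h.
Proof.
move=> h1 pg fg hf.
have q j : (j < 3)%N -> (p j - h j) * (p j - h j) <= (3 / 20) ^+ 2.
  move=> j3; rewrite -expr2 -real_normK ?num_real // ler_pXn2r ?nnegrE //.
  have := pg j j3; have := fg j j3; have := hf j j3.
  by rewrite !ler_norml => /andP[? ?] /andP[? ?] /andP[? ?]; apply/andP; split; lra.
have [a [b c]] := (q 0%N isT, (q 1%N isT, q 2%N isT)).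
have pp : 0 <= dot3 p p by rewrite /dot3 -!expr2 !addr_ge0 ?sqr_ge0.
by move: h1 pp a b c; rewrite /dot3 => *; lra.
Qed.

(** The lifts are only approximate because psi is smooth while the maps at intermediate times are
    merely continuous; degree one is expressed by the integral of the Jacobian. *)
Definition liftable (f : V -> W) := forall e, 0 < e -> exists psi : nat -> V -> R,
  [/\ smf psi, forall x, S3 x -> dotn (psi^~ x) (psi^~ x) = 1, Int (Jac psi) = Int (fun=> 1) &
      forall x j, S3 x -> (j < 3)%N -> `|hopfn (psi^~ x) j - f x 0 (inord j)| <= e].

Lemma liftable_eq f g : (forall x, S3 x -> f x = g x) -> liftable f -> liftable g.
Proof.
move=> fg lf e /lf[psi [s1 s2 s3 s4]]; exists psi; split => // x j Sx j3.
by rewrite -fg // s4.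
Qed.

Lemma S2E (y : W) : S2 y -> dot3 (fun j => y 0 (inord j)) (fun j => y 0 (inord j)) = 4^-1.
Proof. by rewrite /S2 /sphere /= -dot3E => ->; rewrite exprVn; congr (_^-1); ring. Qed.

Lemma hopfn_unit (u : nat -> R) : dotn u u = 1 -> dot3 (hopfn u) (hopfn u) = 4^-1.
Proof. by have := hopfn_norm u => + u1; rewrite u1; lra. Qed.

(** One lift of f with error 1/20 is enough to produce lifts of g with any error, so errors do not
    build up from one time to the next. *)
Lemma lift_step (f g : V -> W) : (forall x, S3 x -> S2 (g x)) ->
  (forall x, S3 x -> g @ within (@S3 R) (nbhs x) --> g x) ->
  (forall x j, S3 x -> (j < 3)%N -> `|f x 0 (inord j) - g x 0 (inord j)| <= 20^-1) ->
  liftable f -> liftable g.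
Proof.
move=> gS gc fg lf e e0.
have c20 : 0 < 20^-1 :> R by rewrite invr_gt0.
(* 36 e1 bounds the error of the projection, by [lift_error], and one more e1 separates p from g. *)
pose e1 := Num.min 20^-1 (e / 37).
have e10 : 0 < e1 by rewrite lt_min c20 divr_gt0.
have e120 : e1 <= 20^-1 by rewrite ge_min lexx.
have e1e : 37 * e1 <= e by rewrite mulrC -ler_pdivlMr // ge_min lexx orbT.
have [psi [spsi psi1 Jpsi hpsi]] := lf _ c20.
have /choice[p Hp] : forall j : nat, exists p : V -> R, sm p /\ forall x, S3 x -> `|p x - g x 0 (inord j)| <= e1.
  move=> j; have [x Sx|d [p [dp Hp]]] := @S3_Weierstrass R (fun x => g x 0 (inord j)) e1 e10.
    exact: (cvg_comp _ (fun y : W => y 0 (inord j)) (gc x Sx) (@coord_continuous R _ _ 0 (inord j) (g x))).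
  by exists p; split => //; exact: sm_polydeg dp.
have sp : smf p by move=> j; have [] := Hp j.
have pg x j : S3 x -> `|p j x - g x 0 (inord j)| <= e1 by move=> Sx; have [_ /(_ x Sx)] := Hp j.
have pos x : S3 x -> 0 <= dot3 (p^~ x) (hopfn (psi^~ x)).
  move=> Sx; apply: (@lift_positive _ _ (fun j => g x 0 (inord j)) (fun j => f x 0 (inord j))).
  - by apply: hopfn_unit; exact: psi1.
  - by move=> j _; rewrite (le_trans (pg x j Sx)).
  - by move=> j; exact: fg.
  - by move=> j; exact: hpsi.
exists (lift psi p); split.
- exact: (smf_lift spsi sp psi1 pos).
- exact: (lift_norm psi1 pos).
- by rewrite (Int_Jac_lift spsi sp psi1 pos).
- move=> x j Sx j3; rewrite -(subrKA (p j x)) (le_trans (ler_normD _ _)) // (le_trans _ e1e) //.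
  have -> : 37 * e1 = 36 * e1 + e1 by ring.
  rewrite lerD ?pg // (hopfn_lift psi1 pos Sx j3).
  apply: (lift_error (S2E (gS x Sx)) (hopfn_unit (psi1 x Sx)) e120) => //.
    by move=> k _; exact: pg.
  exact: (lineprojf_ge psi1 pos).
Qed.

(** The identity is an exact lift, and its Jacobian is |x|^4. *)
Lemma liftable_hopf : liftable (@hopf R).
Proof.
move=> e e0; exists (fun k x => co x k); split.
- by move=> k; exact: sm_co.
- by move=> x Sx; rewrite -(S3E Sx) dotE.
- apply: Int_eq => x Sx; have := S3E Sx; rewrite dotE.
  have XE A : XF A (fun k x => co x k) ^~ x = co (x *m A) by apply/funext => k; exact: X_co.
  rewrite /Jac /PfF; rewrite -> (XE (qI R)), (XE (qJ R)), (XE (qK R)).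
  rewrite /Pf /omega !co_qI !co_qJ !co_qK.
  move: (co x 0) (co x 1) (co x 2) (co x 3) => a b c d E.
  have -> : 1 = (a * a + b * b + c * c + d * d) * (a * a + b * b + c * c + d * d) by rewrite E mulr1.
  ring.
- move=> x j Sx j3; rewrite /hopf mxE inordK // /hopfn /co subrr normr0; exact: ltW.
Qed.

End Chain.

(** * From the homotopy to an exact lift *)

Section Homotopy.
Variable R : realType.
Local Notation V := 'rV[R]_4.
Local Notation W := 'rV[R]_3.

Lemma coord_le_norm n (y : 'rV[R]_n) j : `|y 0 j| <= `|y|.
Proof. by rewrite [leRHS]/Num.Def.normr /= mx_normrE (le_bigmax _ (fun i => `|y i.1 i.2|) (0, j)). Qed.

(** Uniform continuity in time, from the compactness of [0, 1] x S^3; H is continuous only relative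
    to that set, so nearby points are compared only inside it. *)
Lemma homotopy_uniform (H : R * V -> W) (e : R) : 0 < e -> {within `[0, 1]%classic `*` @S3 R, continuous H} ->
  exists2 d : R, 0 < d & forall (s s' : R) (x : V), 0 <= s <= 1 -> 0 <= s' <= 1 -> `|s - s'| < d -> S3 x ->
    `|H (s, x) - H (s', x)| <= e.
Proof.
pose K : set (R * V) := `[0, 1]%classic `*` @S3 R.
move=> e0 /subspace_continuousP; rewrite -[X in from_subspace X]/K -/K => Hc.
have Kc : compact K by apply: compact_setX; [exact: segment_compact|exact: S3_compact].
pose P (d : R) (q : R * V) := forall s' : R, 0 <= s' <= 1 -> `|q.1 - s'| < d -> K q -> `|H q - H (s', q.2)| <= e.
suff : \forall d \near 0^'+, K `<=` P d.
  move=> h; have /filter_ex[d [d0 Hd]] : \forall d \near (0 : R)^'+, 0 < d /\ K `<=` P d.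
    by near=> d; split; [near: d; exact: nbhs_right_gt|near: d].
  exists d => // s s' x s01 s'01 ss Sx.
  have Kq : K (s, x) by split => //=; rewrite in_itv.
  exact: (Hd (s, x) Kq s' s'01 ss Kq).
have nc := (compact_near_coveringP _).1 Kc.
apply: (nc _ ((0 : R)^'+) P) => -[s x] Kq.
have e20 : 0 < e / 2 by rewrite divr_gt0.
have := Hc (s, x) Kq; move=> /cvgrPdist_lt/(_ _ e20) /= h.
have [r r0 Hr] : exists2 r, 0 < r & forall q, `|s - q.1| < r -> `|x - q.2| < r -> K q ->
    `|H (s, x) - H q| < e / 2.
  move: h => [[A B] /= [/nbhs_ballP[r1 /= r10 h1] /nbhs_ballP[r2 /= r20 h2]] h].
  exists (Num.min r1 r2); first by rewrite lt_min r10.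
  move=> [s' x'] /= hs hx K'; apply: (h (s', x')) => //; split => /=.
    by apply: h1; rewrite -ball_normE /=; move: hs; rewrite lt_min => /andP[].
  by apply: h2; rewrite -ball_normE /=; move: hx; rewrite lt_min => /andP[].
have r20 : 0 < r / 2 by rewrite divr_gt0.
near=> q d => s' s'01 /= sd [q1 q2].
have qs : `|s - q.1| < r / 2.
  by near: q; exists (ball s (r / 2), setT) => /=; [split; [exact: nbhsx_ballx|exact: filterT]|move=> [a b] /= [+ _]; rewrite -ball_normE].
have qx : `|x - q.2| < r.
  by near: q; exists (setT, ball x r) => /=; [split; [exact: filterT|exact: nbhsx_ballx]|move=> [a b] /= [_ +]; rewrite -ball_normE].
have dr : d < r / 2 by near: d; exact: nbhs_right_lt.
have h1 : `|H (s, x) - H q| < e / 2 by apply: Hr => //; lra.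
have h2 : `|H (s, x) - H (s', q.2)| < e / 2.
  apply: (Hr (s', q.2) _ qx); last by split => //=; rewrite in_itv.
  rewrite /= -(subrKA q.1) (le_lt_trans (ler_normD _ _)) //; lra.
rewrite -(subrKA (H (s, x))) (le_trans (ler_normD _ _)) // distrC; lra.
Unshelve. all: by end_near. Qed.

Lemma homotopy_liftable (H : R * V -> W) : {within `[0, 1]%classic `*` @S3 R, continuous H} ->
  (forall (s : R) x, s \in `[0, 1] -> S3 x -> S2 (H (s, x))) ->
  liftable (fun x => H (1, x)) -> liftable (fun x => H (0, x)).
Proof.
move=> Hc HS l1; have c20 : 0 < 20^-1 :> R by rewrite invr_gt0.
have [d d0 Hd] := homotopy_uniform c20 Hc.
have [n nd] : exists n : nat, n.+1%:R^-1 < d.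
  by have [n _ /(_ n (leqnn n))] := near_infty_natSinv_lt (PosNum d0); exists n.
have n0 : 0 < n.+1%:R :> R by [].
(* Times run downwards from 1, where lifts are known, in steps short enough that H moves by at most
   1/20. *)
suff L k : (k <= n.+1)%N -> liftable (fun x => H ((n.+1 - k)%:R / n.+1%:R, x)).
  by have := L n.+1 (leqnn _); rewrite subnn mul0r.
elim: k => [_|k IH kn]; first by rewrite subn0 divff ?gt_eqF.
have t01 m : (m <= n.+1)%N -> 0 <= (m%:R / n.+1%:R : R) <= 1.
  by move=> mn; rewrite divr_ge0 //= ler_pdivrMr // mul1r ler_nat.
have a := t01 _ (leq_subr k n.+1); have b := t01 _ (leq_subr k.+1 n.+1).
apply: lift_step (IH (ltnW kn)).
- by move=> x Sx; apply: HS => //; rewrite in_itv.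
- move=> x Sx; have /subspace_continuousP h := Hc.
  have Kx y : S3 y -> (`[(0 : R), 1]%classic `*` @S3 R) ((n.+1 - k.+1)%:R / n.+1%:R, y).
    by move=> Sy; split => //=; rewrite in_itv.
  move=> A HA; have [[A1 A2] /= [n1 n2] sub] := h _ (Kx x Sx) A HA.
  apply: filterS n2 => y A2y Sy; apply: (sub (_, y)) (Kx y Sy); split => //.
  exact: nbhs_singleton n1.
- move=> x j Sx j3.
  have := coord_le_norm (H ((n.+1 - k)%:R / n.+1%:R, x) - H ((n.+1 - k.+1)%:R / n.+1%:R, x)) (inord j).
  rewrite !mxE => /le_trans; apply; apply: Hd => //.
  have -> : (n.+1 - k)%:R = 1 + (n.+1 - k.+1)%:R :> R by rewrite addrC natr1 subnSK.
  by rewrite -mulrBl addrK mul1r gtr0_norm ?invr_gt0.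
Qed.

Lemma Ck_local k (U : set V) (f : V -> R) :
  (forall x, U x -> exists U', [/\ open U', U' x & Ck k U' f]) -> Ck k U f.
Proof.
elim: k f => [|k IH] f H /=.
  by move=> x /H[U' [_ Ux cf]]; exact: cf.
split=> [x /H[U' [oU' Ux cf]]|v]; first exact: Ck_diff cf Ux.
by apply: IH => x /H[U' [oU' Ux [_ cf]]]; exists U'; split => //; exact: cf.
Qed.

(** The local extensions F of f need not agree off the sphere; composed with [normalize], they are
    all local expressions of the same radial extension. *)
Lemma smooth_on_sm (f : V -> W) j : smooth_on (@S3 R) f -> sm (fun x => f (normalize x) 0 j).
Proof.
move=> sf; exists [set x | x != 0]; split; [exact: open_neq0|by move=> x /S3_neq0|move=> k].
apply: Ck_local => x x0; have [U [F [oU Ux cF FE]]] := sf _ (normalize_S3 x0).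
have oU' : open ([set x : V | x != 0] `&` @normalize R @^-1` U).
  rewrite openE => y [y0 Uy]; apply: filterI; first exact: (open_nbhs_nbhs (conj (@open_neq0 R) y0)).
  by apply: (normalize_continuous y0); exact: (open_nbhs_nbhs (conj oU Uy)).
exists ([set x : V | x != 0] `&` @normalize R @^-1` U); split => //.
apply: (@Ck_ext _ _ _ _ (fun y => F (normalize y) 0 j)) => //.
  by move=> y [y0 Uy]; rewrite FE //; exact: normalize_S3.
apply: (@Ck_comp _ _ _ _ _ U (@normalize R) (fun z => F z 0 j)) => //.
- by move=> y [].
- move=> i; exact: (@Ck_sub R 3 k [set x : V | x != 0] ([set x : V | x != 0] `&` @normalize R @^-1` U) (fun y => normalize y 0 i) (@subIsetl _ _ _) (@Ck_normalize R k i)).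
- exact: class_C_Ck.
Qed.

(* A lift up to 1/20 can be corrected to an exact one, since the defect 1/4 - |p|^2 vanishes when p is the map itself. *)
Lemma exact_lift (f : V -> W) : smooth_S3_S2 f -> liftable f ->
  exists psi : nat -> V -> R, [/\ smf psi, forall x, S3 x -> dotn (psi^~ x) (psi^~ x) = 1,
    Int (Jac psi) = Int (fun=> 1) & forall x j, S3 x -> (j < 3)%N -> f x 0 (inord j) = hopfn (psi^~ x) j].
Proof.
move=> [fS sf] lf; have c20 : 0 < 20^-1 :> R by rewrite invr_gt0.
have [psi [spsi psi1 Jpsi hpsi]] := lf _ c20.
pose p : nat -> V -> R := fun j x => f (normalize x) 0 (inord j).
have sp : smf p by move=> j; exact: smooth_on_sm.
have pE x : S3 x -> p^~ x = (fun j => f x 0 (inord j)) by move=> Sx; rewrite /p normalize_id.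
have pos x : S3 x -> 0 <= dot3 (p^~ x) (hopfn (psi^~ x)).
  move=> Sx; rewrite pE //; apply: (@lift_positive _ _ _ (fun j => f x 0 (inord j)) (fun j => f x 0 (inord j))).
  - by apply: hopfn_unit; exact: psi1.
  - by move=> j _; rewrite subrr normr0 ltW.
  - by move=> j _; rewrite subrr normr0 ltW.
  - by move=> j; exact: hpsi.
exists (lift psi p); split.
- exact: (smf_lift spsi sp psi1 pos).
- exact: (lift_norm psi1 pos).
- by rewrite (Int_Jac_lift spsi sp psi1 pos).
- move=> x j Sx j3; have := hopfn_lift psi1 pos Sx j3.
  rewrite pE // (S2E (fS x Sx)) subrr !mul0r => /eqP; rewrite subr_eq0 => /eqP ->.
  by rewrite /p normalize_id.
Qed.

Lemma homotopic_liftable (f : V -> W) : homotopic_S3_S2 f (@hopf R) -> liftable f.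
Proof.
move=> [H [Hc HS H0 H1]]; apply: (liftable_eq H0); apply: homotopy_liftable => //.
by apply: liftable_eq (@liftable_hopf R) => x Sx; rewrite H1.
Qed.

End Homotopy.

(** * The pulled back area form *)

Section LiftEnergy.
Variable R : realType.
Local Notation V := 'rV[R]_4.
Local Notation W := 'rV[R]_3.
Local Notation qI := (qI R).
Local Notation qJ := (qJ R).
Local Notation qK := (qK R).
Variable psi : nat -> V -> R.
Hypothesis spsi : smf psi.

Lemma omega_curl (u a b c d e : nat -> R) : (forall k, d k = e k - 2 * c k) ->
  omega a b + omega u d - (omega b a + omega u e) + 2 * omega u c = 2 * omega a b.
Proof. by move=> E; rewrite /omega !E; ring. Qed.

Let area A B x := omega (XF A psi ^~ x) (XF B psi ^~ x).

Lemma sm_area A B : sm (fun x => omega (XF A psi ^~ x) (XF B psi ^~ x)).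
Proof. exact: sm_omega (smf_XF A spsi) (smf_XF B spsi). Qed.

Let al A x := omega (psi ^~ x) (XF A psi ^~ x).

Let sm_al A : sm (al A).
Proof. exact: sm_omega spsi (smf_XF A spsi). Qed.

(* The exterior derivative of the pulled back contact form is twice the pulled back symplectic form. *)
Let curl_al A B C x : S3 x -> (forall f, sm f -> X A (X B f) x = X B (X A f) x - 2 * X C f x) ->
  X A (al B) x - X B (al A) x + 2 * al C x = 2 * area A B x.
Proof.
move=> Sx H; rewrite /al /area.
rewrite -> (X_omega A Sx spsi (smf_XF B spsi)), (X_omega B Sx spsi (smf_XF A spsi)).
exact: (@omega_curl (psi ^~ x) (XF A psi ^~ x) (XF B psi ^~ x) (XF C psi ^~ x)
  (XF A (XF B psi) ^~ x) (XF B (XF A psi) ^~ x) (fun k => H (psi k) (spsi k))).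
Qed.

Lemma Pf_omega (u a b c : nat -> R) :
  omega u a * (2 * omega b c) + omega u b * (2 * omega c a) + omega u c * (2 * omega a b) = 2 * Pf u a b c.
Proof. rewrite /Pf; do !move: (omega _ _) => ?; ring. Qed.

Lemma sumsq_double (a b c : R) : (2 * a) ^+ 2 + (2 * b) ^+ 2 + (2 * c) ^+ 2 = 4 * (a ^+ 2 + b ^+ 2 + c ^+ 2).
Proof. ring. Qed.

Lemma sm_sumsq (f g h : V -> R) : sm f -> sm g -> sm h -> sm (fun x => f x ^+ 2 + g x ^+ 2 + h x ^+ 2).
Proof. by move=> *; smooth. Qed.

(** The contact components have curl twice [area] and helicity twice the integral of the Jacobian,
    so [helicity_bound] says that 4 vol(S^3) is at most 4 times the right-hand side. *)
Lemma area_bound : Int (Jac psi) = Int (fun=> 1) ->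
  Int (fun=> 1) <= Int (fun x => area qJ qK x ^+ 2 + area qK qI x ^+ 2 + area qI qJ x ^+ 2).
Proof.
move=> J1.
have [s1 s2 s3] := And3 (sm_area qJ qK) (sm_area qK qI) (sm_area qI qJ).
have sa : sm (fun x => area qJ qK x ^+ 2 + area qK qI x ^+ 2 + area qI qJ x ^+ 2).
  exact: (sm_sumsq s1 s2 s3).
have := helicity_bound (sm_al qI) (sm_al qJ) (sm_al qK).
set L := Int _; set M := Int (fun x => _ + curl3 _ _ _ x ^+ 2).
have c1 x : S3 x -> curl1 (al qI) (al qJ) (al qK) x = 2 * area qJ qK x.
  by move=> Sx; apply: curl_al => // f; exact: comm_JK.
have c2 x : S3 x -> curl2 (al qI) (al qJ) (al qK) x = 2 * area qK qI x.
  by move=> Sx; apply: curl_al => // f; exact: comm_KI.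
have c3 x : S3 x -> curl3 (al qI) (al qJ) (al qK) x = 2 * area qI qJ x.
  by move=> Sx; apply: curl_al => // f; exact: comm_IJ.
have -> : L = 2 * Int (fun=> 1).
  rewrite -J1 -(IntZ 2 (sm_Jac spsi)); apply: Int_eq => x Sx.
  rewrite -> (c1 x Sx), (c2 x Sx), (c3 x Sx); exact: (Pf_omega (psi ^~ x) (XF qI psi ^~ x) (XF qJ psi ^~ x) (XF qK psi ^~ x)).
have -> : M = 4 * Int (fun x => area qJ qK x ^+ 2 + area qK qI x ^+ 2 + area qI qJ x ^+ 2).
  rewrite -(IntZ 4 sa); apply: Int_eq => x Sx.
  rewrite -> (c1 x Sx), (c2 x Sx), (c3 x Sx); exact: (sumsq_double (area qJ qK x) (area qK qI x) (area qI qJ x)).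
by rewrite mulrA -natrM ler_pM2l.
Qed.

End LiftEnergy.

(** * The area form of S^2 pulled back by a lifted map *)

Section PullbackArea.
Variable R : realType.
Local Notation V := 'rV[R]_4.
Local Notation W := 'rV[R]_3.
Local Notation qI := (qI R).
Local Notation qJ := (qJ R).
Local Notation qK := (qK R).

Lemma sum3 (U : nmodType) (F : 'I_3 -> U) : \sum_i F i = F (inord 0) + F (inord 1) + F (inord 2).
Proof.
rewrite !big_ord_recl big_ord0 addr0 addrA.
by congr (F _ + F _ + F _); apply/val_inj; rewrite /= inordK.
Qed.

Lemma det2 (m : nat -> nat -> R) :
  \det (\matrix_(i < 2, j < 2) m i j) = m 0%N 0%N * m 1%N 1%N - m 0%N 1%N * m 1%N 0%N.
Proof.
rewrite (expand_det_row _ ord0) !big_ord_recl big_ord0 /cofactor !det_mx11 !mxE /= /bump /=.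
by rewrite addr0 addn0 addn1 expr0 expr1 mul1r mulN1r mulrN.
Qed.

Lemma det3 (m : nat -> nat -> R) :
  \det (\matrix_(i < 3, j < 3) m i j) =
    m 0%N 0%N * (m 1%N 1%N * m 2%N 2%N - m 1%N 2%N * m 2%N 1%N)
  - m 0%N 1%N * (m 1%N 0%N * m 2%N 2%N - m 1%N 2%N * m 2%N 0%N)
  + m 0%N 2%N * (m 1%N 0%N * m 2%N 1%N - m 1%N 1%N * m 2%N 0%N).
Proof.
have minor (k : 'I_3) : \det (row' ord0 (col' k (\matrix_(i < 3, j < 3) m i j))) =
    m 1%N (bump k 0) * m 2%N (bump k 1) - m 1%N (bump k 1) * m 2%N (bump k 0).
  rewrite -(det2 (fun i j => m (bump 0 i) (bump k j))); congr (\det _).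
  by apply/matrixP => i j; rewrite !mxE.
rewrite (expand_det_row _ ord0) !big_ord_recl big_ord0 /cofactor !minor !mxE /= /bump /=.
by rewrite !addr0 !add0n ?addn0 ?addn1 -signr_odd /= expr1 !expr0; ring.
Qed.

Lemma col3E n (a b c : 'rV[R]_n) (i : 'I_3) k :
  (col_mx a (col_mx b c) : 'M[R]_(3, n)) i k = [:: a 0 k; b 0 k; c 0 k]`_i.
Proof.
rewrite mxE; case: splitP => i' ->; first by rewrite ord1.
by rewrite mxE; case: splitP => i'' ->; rewrite ord1.
Qed.

Lemma area_formE (y u v : W) : let c (z : W) j := z 0 (inord j) in
  area_form y u v = 2 * (c y 0%N * (c u 1%N * c v 2%N - c u 2%N * c v 1%N)
    - c y 1%N * (c u 0%N * c v 2%N - c u 2%N * c v 0%N)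
    + c y 2%N * (c u 0%N * c v 1%N - c u 1%N * c v 0%N)).
Proof.
move=> c; rewrite /area_form.
have -> : col_mx (2 *: y) (col_mx u v) =
    \matrix_(i < 3, j < 3) (fun i j : nat => [:: 2 * c y j; c u j; c v j]`_i) i j :> 'M[R]_3.
  by apply/matrixP => i j; rewrite (col3E _ _ _ i j) !mxE /c inord_val.
by rewrite (det3 (fun i j => [:: 2 * c y j; c u j; c v j]`_i)) /=; ring.
Qed.

Lemma area_form_linear (y : W) a p q r : area_form y (a *: p + q) r = a * area_form y p r + area_form y q r.
Proof. by rewrite !area_formE /= !mxE; ring. Qed.

Lemma area_form_alt (y p q : W) : area_form y p q = - area_form y q p.
Proof. by rewrite !area_formE /=; ring. Qed.

Definition dhopfn (u a : nat -> R) (j : nat) : R :=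
  nth 0 [:: a 0%N * u 2%N + u 0%N * a 2%N + (a 1%N * u 3%N + u 1%N * a 3%N);
            a 1%N * u 2%N + u 1%N * a 2%N - (a 0%N * u 3%N + u 0%N * a 3%N);
            u 0%N * a 0%N + u 1%N * a 1%N - (u 2%N * a 2%N + u 3%N * a 3%N)] j.

(* Up to sign, the area form of the sphere pulls back to omega on the unit sphere of C^2. *)
Lemma area_hopfn (u a b : nat -> R) (y p q : W) :
  (forall j, (j < 3)%N -> y 0 (inord j) = hopfn u j) ->
  (forall j, (j < 3)%N -> p 0 (inord j) = dhopfn u a j) ->
  (forall j, (j < 3)%N -> q 0 (inord j) = dhopfn u b j) ->
  dotn u u = 1 -> dotn u a = 0 -> dotn u b = 0 -> area_form y p q = - omega a b.
Proof.
move=> yE pE qE u1 ua ub; rewrite area_formE /= !yE // !pE // !qE //.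
(* The identity before the constraints are imposed, homogeneous of degree four in u; tangency
   removes the terms with <u, a> and <u, b>. *)
transitivity (- (dotn u u ^+ 2 * omega a b - dotn u u * (dotn u a * omega u b + dotn u b * omega a u))).
  by rewrite /hopfn /dhopfn /dotn /omega /=; field.
by rewrite u1 ua ub; ring.
Qed.

Section Lift.
Variables (f : V -> W) (psi : nat -> V -> R).
Hypothesis spsi : smf psi.
Hypothesis psi1 : forall x, S3 x -> dotn (psi^~ x) (psi^~ x) = 1.
Hypothesis fpsi : forall x j, S3 x -> (j < 3)%N -> f x 0 (inord j) = hopfn (psi^~ x) j.

(** f is meaningful only on the sphere; G is smooth near it, and both have the same composite with
    [normalize] away from 0. *)
Let G : V -> W := fun x => \row_(j < 3) hopfn (psi^~ x) j.

Lemma sm_hopfn j : sm (fun x => hopfn (psi^~ x) j).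
Proof.
have [s0 s1 s2] := And3 (spsi 0%N) (spsi 1%N) (spsi 2%N); have s3 := spsi 3%N.
by case: j => [|[|[|j]]]; rewrite /hopfn /= ?nth_nil; smooth.
Qed.

Let dG x : S3 x -> differentiable G x.
Proof.
move=> Sx; apply: differentiable_coords => j.
have -> : (fun y => G y 0 j) = (fun y => hopfn (psi^~ y) j) by apply/funext => y; rewrite mxE.
exact: sm_diff (sm_hopfn j) Sx.
Qed.

Let fG x : S3 x -> \near x, (G \o @normalize R) x = (f \o @normalize R) x.
Proof.
move=> Sx; apply: (@open_near_eq _ _ _ [set y : V | y != 0]); [exact: open_neq0| |exact: S3_neq0].
move=> y y0 /=; apply/rowP => j; have Sy := normalize_S3 y0.
by rewrite mxE -fpsi // inord_val.
Qed.

Lemma lift_differentiable x : S3 x -> differentiable (f \o @normalize R) x.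
Proof.
move=> Sx; apply: near_eq_differentiable (fG Sx) _.
have x0 : dot x 0 = 0 by rewrite /dot big1 // => i _; rewrite mxE mulr0.
exact: (derive_comp_normalize Sx x0 (dG Sx)).1.
Qed.

Lemma dS3_lift x A j : S3 x -> tangent_field A -> (j < 3)%N ->
  dS3 f x (x *m A) 0 (inord j) = dhopfn (psi^~ x) (XF A psi ^~ x) j.
Proof.
move=> Sx tA j3; have dGx := dG Sx.
rewrite /dS3 -(near_eq_derive _ (fG Sx)) (derive_comp_normalize Sx (tA x) dGx).2.
rewrite coord_derive; last exact: diff_derivable.
have -> : (fun y => G y 0 (inord j)) = (fun y => hopfn (psi^~ y) j).
  by apply/funext => y; rewrite mxE inordK.
rewrite -[LHS]/(X A (fun y => hopfn (psi^~ y) j) x).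
have [s0 s1 s2] := And3 (spsi 0%N) (spsi 1%N) (spsi 2%N); have s3 := spsi 3%N.
have m k l := XM A Sx (spsi k) (spsi l).
case: j j3 => [|[|[|//]]] _.
- exact: etrans (XD A Sx (smM s0 s2) (smM s1 s3)) (congr2 +%R (m 0%N 2%N) (m 1%N 3%N)).
- exact: etrans (XB A Sx (smM s1 s2) (smM s0 s3)) (congr2 (fun r s => r - s) (m 1%N 2%N) (m 0%N 3%N)).
- have -> : (fun y => hopfn (psi^~ y) 2) = (fun y => 2^-1 * ((psi 0%N y * psi 0%N y + psi 1%N y * psi 1%N y) -
      (psi 2%N y * psi 2%N y + psi 3%N y * psi 3%N y))).
    by apply/funext => y; rewrite /hopfn /= !expr2.
  have s01 := smD (smM s0 s0) (smM s1 s1); have s23 := smD (smM s2 s2) (smM s3 s3).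
  apply: (etrans (XZ A 2^-1 Sx (smB s01 s23))); apply: (etrans (congr1 ( *%R 2^-1) (XB A Sx s01 s23))).
  have e01 := etrans (XD A Sx (smM s0 s0) (smM s1 s1)) (congr2 +%R (m 0%N 0%N) (m 1%N 1%N)).
  have e23 := etrans (XD A Sx (smM s2 s2) (smM s3 s3)) (congr2 +%R (m 2%N 2%N) (m 3%N 3%N)).
  apply: (etrans (congr2 (fun r s => 2^-1 * (r - s)) e01 e23)).
  rewrite /dhopfn /= /XF.
  move: (X A (psi 0%N) x) (X A (psi 1%N) x) (X A (psi 2%N) x) (X A (psi 3%N) x) => a b c d.
  by move: (psi 0%N x) (psi 1%N x) (psi 2%N x) (psi 3%N x) => u0 u1 u2 u3; field.
Qed.

Let dotn_XF A x : S3 x -> tangent_field A -> dotn (psi^~ x) (XF A psi ^~ x) = 0.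
Proof.
move=> Sx tA; have := X_dotn A Sx spsi spsi.
have := X_ext tA Sx (sm_dotn spsi spsi) (sm_cst 1) psi1.
rewrite -> (X_cst A 1 x) => ->; rewrite /dotn.
move: (XF A psi 0%N x) (XF A psi 1%N x) (XF A psi 2%N x) (XF A psi 3%N x) => a b c d.
by move: (psi 0%N x) (psi 1%N x) (psi 2%N x) (psi 3%N x) => u0 u1 u2 u3; lra.
Qed.

Lemma pullback_lift x A B : S3 x -> tangent_field A -> tangent_field B ->
  pullback_area f x (x *m A) (x *m B) = - omega (XF A psi ^~ x) (XF B psi ^~ x).
Proof.
move=> Sx tA tB; apply: (area_hopfn (u := psi^~ x)).
- by move=> j; exact: fpsi.
- by move=> j; exact: dS3_lift.
- by move=> j; exact: dS3_lift.
- exact: psi1.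
- exact: dotn_XF.
- exact: dotn_XF.
Qed.

Lemma pullback_linear x a u v w : S3 x ->
  pullback_area f x (a *: u + v) w = a * pullback_area f x u w + pullback_area f x v w.
Proof.
move=> Sx; rewrite /pullback_area /dS3 (derive_linear (lift_differentiable Sx)).
exact: area_form_linear.
Qed.

End Lift.

Lemma pullback_alt (f : V -> W) x u v : pullback_area f x u v = - pullback_area f x v u.
Proof. exact: area_form_alt. Qed.

End PullbackArea.

(** * The Berger metric *)

Section BergerMetric.
Variable R : realType.
Local Notation V := 'rV[R]_4.
Local Notation W := 'rV[R]_3.
Local Notation qI := (qI R).
Local Notation qJ := (qJ R).
Local Notation qK := (qK R).

Lemma dotDl n (u v w : 'rV[R]_n) : dot (u + v) w = dot u w + dot v w.
Proof. by rewrite /dot -big_split; apply: eq_bigr => i _; rewrite mxE mulrDl. Qed.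

Lemma dotC n (u v : 'rV[R]_n) : dot u v = dot v u.
Proof. by apply: eq_bigr => i _; rewrite mulrC. Qed.

Lemma dotZl n a (u w : 'rV[R]_n) : dot (a *: u) w = a * dot u w.
Proof. by rewrite /dot mulr_sumr; apply: eq_bigr => i _; rewrite mxE mulrA. Qed.

Lemma dotBl n (u v w : 'rV[R]_n) : dot (u - v) w = dot u w - dot v w.
Proof. by rewrite dotDl -scaleN1r dotZl mulN1r. Qed.

Lemma sum_lt3 (F : 'I_3 -> 'I_3 -> R) : \sum_(i < 3) \sum_(j < 3 | (i < j)%N) F i j =
  F (inord 0) (inord 1) + F (inord 0) (inord 2) + F (inord 1) (inord 2).
Proof.
under eq_bigr => i _ do rewrite big_mkcond sum3.
by rewrite sum3 !inordK //= !add0r !addr0.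
Qed.

(* For orthogonal M both traces tr (A A^T) and tr (B B^T), with B = M A M^T, agree. *)
Lemma sqnorm_orthogonal (M A : 'M[R]_3) : M *m M^T = 1%:M -> A^T = - A ->
  let S (B : 'M[R]_3) := B (inord 0) (inord 1) ^+ 2 + B (inord 0) (inord 2) ^+ 2 + B (inord 1) (inord 2) ^+ 2 in
  S (M *m A *m M^T) = S A.
Proof.
move=> MM AT S.
have trS (B : 'M[R]_3) : B^T = - B -> \tr (B *m B^T) = 2 * S B.
  move=> BT; have b i j : B j i = - B i j by have /matrixP/(_ i j) := BT; rewrite !mxE.
  have b0 i : B i i = 0 by have := b i i; lra.
  rewrite /mxtrace sum3 !mxE !sum3 !mxE /S !b0 (b (inord 0) (inord 1)) (b (inord 0) (inord 2)) (b (inord 1) (inord 2)); ring.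
have BT : (M *m A *m M^T)^T = - (M *m A *m M^T) by rewrite !trmx_mul trmxK AT mulNmx mulmxN mulmxA.
have two : (2 : R) != 0 by rewrite pnatr_eq0.
apply: (mulfI two); rewrite -(trS _ BT) -(trS _ AT) !trmx_mul trmxK.
rewrite mxtrace_mulC !mulmxA -(mulmxA (M *m _)) (mulmx1C MM) mulmx1.
rewrite -!mulmxA mxtrace_mulC -!mulmxA (mulmx1C MM) mulmx1.
by rewrite mxtrace_mulC.
Qed.

Section AlternatingForm.
Variable B : V -> V -> R.
Hypothesis BD : forall a u v w, B (a *: u + v) w = a * B u w + B v w.
Hypothesis BC : forall u v, B u v = - B v u.

Lemma alt_self u : B u u = 0.
Proof. by have := BC u u; lra. Qed.

Lemma alt_scale a u w : B (a *: u) w = a * B u w.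
Proof.
have p0 : B 0 w = 0 by have := BD 1 0 0 w; rewrite scale1r addr0 mul1r; lra.
by rewrite -[a *: u]addr0 BD p0 addr0.
Qed.

Lemma alt_lin3 (a b c : R) u v w z : B (a *: u + b *: v + c *: w) z = a * B u z + b * B v z + c * B w z.
Proof. by rewrite -addrA BD BD alt_scale addrA. Qed.

(** The only nonzero pairing among u, v, w is that of v with w, so pairing the combination with w
    isolates b and pairing it with v isolates c. *)
Lemma alt_kernel (a b c : R) u v w : B v w = - 1 -> B w u = 0 -> B u v = 0 ->
  (forall z, B (a *: u + b *: v + c *: w) z = 0) -> b = 0 /\ c = 0.
Proof.
move=> vw wu uv H; have := H v; have := H w.
by rewrite !alt_lin3 !alt_self vw uv (BC u w) (BC w v) wu vw; split; lra.
Qed.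

End AlternatingForm.

Section AtPoint.
Variable x : V.
Hypothesis Sx : S3 x.

Let E : co x 0 * co x 0 + co x 1 * co x 1 + co x 2 * co x 2 + co x 3 * co x 3 = 1.
Proof. by rewrite -(S3E Sx) dotE. Qed.

Lemma dot_frame : [/\ dot (x *m qI) (x *m qI) = 1, dot (x *m qJ) (x *m qJ) = 1 & dot (x *m qK) (x *m qK) = 1] /\
  [/\ dot (x *m qI) (x *m qJ) = 0, dot (x *m qI) (x *m qK) = 0 & dot (x *m qJ) (x *m qK) = 0].
Proof.
by do 2 split; rewrite dotE ?co_qI ?co_qJ ?co_qK -?E; move: (co x 0) (co x 1) (co x 2) (co x 3) => a b c d; ring.
Qed.

Lemma frame_decomp v : dot x v = 0 ->
  v = dot (x *m qI) v *: (x *m qI) + dot (x *m qJ) v *: (x *m qJ) + dot (x *m qK) v *: (x *m qK).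
Proof.
move=> xv.
(* Homogenizes each coordinate: a factor |x|^2 = 1 and a multiple of <x, v> = 0 are inserted, after
   which the claim is a polynomial identity. *)
have H k (r : R) : r - co v k * (co x 0 * co x 0 + co x 1 * co x 1 + co x 2 * co x 2 + co x 3 * co x 3)
    + co x k * dot x v = 0 -> co v k = r.
  by rewrite E xv mulr0 addr0 mulr1 => /eqP; rewrite subr_eq0 => /eqP ->.
apply: co_eq; rewrite !coD !coZ; apply: H; rewrite !dotE ?co_qI ?co_qJ ?co_qK;
  move: (co x 0) (co x 1) (co x 2) (co x 3) (co v 0) (co v 1) (co v 2) (co v 3) => a b c d v0 v1 v2 v3; ring.
Qed.

Let xI := x *m qI.
Let xJ := x *m qJ.
Let xK := x *m qK.

Let psi : nat -> V -> R := fun k y => co y k.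
Let spsi : smf psi. Proof. by move=> k; exact: sm_co. Qed.
Let psi1 y : S3 y -> dotn (psi^~ y) (psi^~ y) = 1.
Proof. by move=> Sy; rewrite -(S3E Sy) dotE. Qed.
Let hpsi y j : S3 y -> (j < 3)%N -> hopf y 0 (inord j) = hopfn (psi^~ y) j.
Proof. by move=> _ j3; rewrite mxE inordK. Qed.
Let Xpsi A : XF A psi ^~ x = co (x *m A).
Proof. by apply/funext => k; exact: X_co. Qed.

Let pb u v : R := pullback_area (@hopf R) x u v.

Lemma pullback_hopf_frame : [/\ pb xJ xK = - 1, pb xK xI = 0 & pb xI xJ = 0].
Proof.
have [tI tJ tK] := And3 (@tangent_qI R) (@tangent_qJ R) (@tangent_qK R).
have F A B (tA : tangent_field A) (tB : tangent_field B) := pullback_lift spsi psi1 hpsi Sx tA tB.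
rewrite /pb /xI /xJ /xK; rewrite -> (F _ _ tJ tK), (F _ _ tK tI), (F _ _ tI tJ), (Xpsi qI), (Xpsi qJ), (Xpsi qK).
split; rewrite /omega ?co_qI ?co_qJ ?co_qK -?E; move: (co x 0) (co x 1) (co x 2) (co x 3) => a b c d; ring.
Qed.

Let pbD a u v w : pb (a *: u + v) w = a * pb u w + pb v w.
Proof. exact: (pullback_linear spsi hpsi). Qed.
Let pbC u v : pb u v = - pb v u.
Proof. exact: pullback_alt. Qed.
Lemma dS3_hopf_fibre : dS3 (@hopf R) x xI = 0.
Proof.
apply/rowP => j; rewrite -[j]inord_val (dS3_lift spsi hpsi Sx (@tangent_qI R) (ltn_ord j)) mxE Xpsi.
case: j => -[|[|[|//]]] /= _; rewrite /dhopfn /= !co_qI; rewrite /psi;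
  move: (co x 0) (co x 1) (co x 2) (co x 3) => a b c d; ring.
Qed.

Lemma verticalP v : vertical x v <-> exists a, v = a *: xI.
Proof.
have df := lift_differentiable spsi hpsi Sx.
split => [[tv v0]|[a ->]]; last first.
  split; first by rewrite /tangentS3 /= dotC dotZl dotC tangent_qI mulr0.
  rewrite -[a *: xI]addr0 /dS3 (derive_linear df) -/(dS3 _ _ _) dS3_hopf_fibre scaler0 add0r.
  by rewrite deriveE // linear0.
have [JK KI IJ] := pullback_hopf_frame.
(* A vector killed by the differential of the Hopf map is killed by the pulled back area form, which
   is nondegenerate on the span of xJ and xK. *)
have p0 w : pb v w = 0.
  by rewrite /pb /pullback_area v0 area_formE /= !mxE; ring.
have D : v = dot xI v *: xI + dot xJ v *: xJ + dot xK v *: xK := frame_decomp tv.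
have [hJ hK] : dot xJ v = 0 /\ dot xK v = 0.
  by apply: (alt_kernel (a := dot xI v) pbD pbC JK KI IJ) => z; rewrite -D; exact: p0.
by exists (dot xI v); rewrite {1}D hJ hK !scale0r !addr0.
Qed.

Lemma horizontalP v : dot xI v = 0 -> dot x v = 0 -> horizontal x v.
Proof. by move=> hI xv; split => // w /verticalP[a ->]; rewrite dotC dotZl hI mulr0. Qed.

Lemma vpartE v : dot x v = 0 -> vpart x v = dot xI v *: xI.
Proof.
have [[dII _ _] _] := dot_frame.
have vI a : vertical x (a *: xI) by apply/verticalP; exists a.
move=> xv; apply: xget_unique => [|u [/verticalP[a ->] [_ h]]].
  split => //; apply: horizontalP.
    by rewrite dotC dotBl dotZl dII mulr1 dotC subrr.
  by rewrite dotC dotBl dotZl dotC xv [dot xI x]dotC tangent_qI mulr0 subrr.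
have := h _ (vI 1); rewrite scale1r dotBl dotZl dII mulr1 dotC => /eqP.
by rewrite subr_eq0 => /eqP ->.
Qed.

Lemma bergerE t u v : dot x u = 0 -> dot x v = 0 ->
  berger t x u v = t ^+ 2 * (dot xI u * dot xI v) + (dot u v - dot xI u * dot xI v).
Proof.
have [[dII _ _] _] := dot_frame.
move=> xu xv; rewrite /berger /hpart !vpartE // dotZ dII mulr1; congr (_ + _).
rewrite dotBl dotZl [dot u _]dotC [dot xI (v - _)]dotC !dotBl !dotZl dII [dot v xI]dotC [dot v u]dotC; ring.
Qed.

(** For t nonzero, an orthonormal frame of the Berger metric, in which the unit fibre vector is
    rescaled; [fr t] gives the coordinates in it. *)
Let bf (t : R) k : V := nth 0 [:: t^-1 *: xI; xJ; xK] k.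
Let fr (t : R) u k : R := nth 0 [:: t * dot xI u; dot xJ u; dot xK u] k.

Let dot_fr u v : dot x u = 0 -> dot x v = 0 ->
  dot u v = dot xI u * dot xI v + dot xJ u * dot xJ v + dot xK u * dot xK v.
Proof. by move=> xu _; rewrite {1}(frame_decomp xu) !dotDl !dotZl. Qed.

Let berger_fr t u v : dot x u = 0 -> dot x v = 0 ->
  berger t x u v = fr t u 0 * fr t v 0 + fr t u 1 * fr t v 1 + fr t u 2 * fr t v 2.
Proof. by move=> xu xv; rewrite bergerE // (dot_fr xu xv) /fr /=; move: (dot _ u) (dot _ u) (dot _ u) => *; ring. Qed.

Let fr_decomp t u : t != 0 -> dot x u = 0 ->
  u = fr t u 0 *: bf t 0 + fr t u 1 *: bf t 1 + fr t u 2 *: bf t 2.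
Proof.
move=> t0 xu; rewrite {1}(frame_decomp xu) /fr /bf /=.
by rewrite scalerA mulrAC mulfV // mul1r.
Qed.

Let bf_tangent t k : dot x (bf t k) = 0.
Proof.
case: k => [|[|[|k]]]; rewrite /bf /=.
- by rewrite dotC dotZl dotC tangent_qI mulr0.
- exact: tangent_qJ.
- exact: tangent_qK.
- by rewrite nth_nil /dot big1 // => i _; rewrite mxE mulr0.
Qed.

Lemma orthonormal_frame_berger t : t != 0 -> exists e, orthonormal_frame (berger t) x e.
Proof.
move=> t0; have [[dII dJJ dKK] [dIJ dIK dJK]] := dot_frame.
exists (\matrix_(i < 3) bf t i); split => [i|]; first by rewrite rowK; exact: bf_tangent.
apply/matrixP => i j; rewrite !mxE !rowK berger_fr ?bf_tangent //.
case: i => -[|[|[|//]]] i3; case: j => -[|[|[|//]]] j3; rewrite /fr /bf /= -?val_eqE /=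
  ?[dot _ (t^-1 *: _)]dotC ?dotZl ?[dot xJ xI]dotC ?[dot xK xI]dotC ?[dot xK xJ]dotC ?dII ?dJJ ?dKK ?dIJ ?dIK ?dJK ?mulr1 ?mulfV //;
  rewrite ?mulr0 ?mul0r ?mulr1 ?addr0 ?add0r //.
Qed.

(** The frame in [sqnorm_form2] is an unspecified choice, so its transition matrix M to the frame
    [bf] is shown to be orthogonal and [sqnorm_orthogonal] moves the computation to [bf], where
    exactly the two pairs with the vertical vector carry a factor 1/t. *)
Lemma sqnorm_berger t (B : V -> V -> R) : t != 0 ->
  (forall a u v w, B (a *: u + v) w = a * B u w + B v w) -> (forall u v, B u v = - B v u) ->
  sqnorm_form2 (berger t) x B = B xJ xK ^+ 2 + (B xK xI ^+ 2 + B xI xJ ^+ 2) / t ^+ 2.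
Proof.
move=> t0 BD BC; rewrite /sqnorm_form2.
have [te ge] := xgetPex 0 (orthonormal_frame_berger t0).
move: (xget _ _) te ge => e te ge; rewrite sum_lt3.
pose M : 'M[R]_3 := \matrix_(i, k) fr t (row i e) k.
pose A : 'M[R]_3 := \matrix_(k, l) B (bf t k) (bf t l).
have MM : M *m M^T = 1%:M.
  by rewrite -ge; apply/matrixP => i j; rewrite !mxE sum3 !mxE !inordK // berger_fr; [|exact: te|exact: te].
have AT : A^T = - A by apply/matrixP => i j; rewrite !mxE BC.
have BE i j : B (row i e) (row j e) = (M *m A *m M^T) i j.
  rewrite (fr_decomp t0 (te i)) (alt_lin3 BD) !(BC _ (row j e)) (fr_decomp t0 (te j)) !(alt_lin3 BD).
  rewrite !mxE sum3 !mxE !sum3 !mxE !inordK //.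
  rewrite (BC (bf t 1) (bf t 0)) (BC (bf t 2) (bf t 0)) (BC (bf t 2) (bf t 1)) !(alt_self BC); ring.
rewrite !BE (sqnorm_orthogonal MM AT) !mxE !inordK // /bf /=.
rewrite !(alt_scale BD) (BC xK xI).
by move: (B xI xJ) (B xI xK) (B xJ xK) => a b c; field.
Qed.

End AtPoint.
End BergerMetric.

(** * Volume and energy for the Berger metric *)

Section Volume.
Variable R : realType.
Local Notation V := 'rV[R]_4.
Local Notation qI := (qI R).
Local Notation qJ := (qJ R).
Local Notation qK := (qK R).

Implicit Types (a b c t : R).

Let cs (a : R) : cos a * cos a = 1 - sin a * sin a.
Proof. by rewrite -(cos2Dsin2 a) !expr2 addrK. Qed.

Lemma par_frame_tangent a b c : let x := param a b c in
  [/\ dot x (par_a a b c) = 0, dot x (par_b a b c) = 0 & dot x (par_c a b c) = 0].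
Proof.
rewrite /= -[param a b c]/(row4 (cos a * cos b) (cos a * sin b) (sin a * cos c) (sin a * sin c)).
rewrite /par_a /par_b /par_c; split; rewrite dotE !co_row4; last 2 first; try ring.
have hb := cs b; have hc := cs c.
move: (cos a) (sin a) (cos b) (sin b) (cos c) (sin c) hb hc => ca sa cb sb cc sc hb hc.
transitivity (- (ca * sa) * (cb * cb + sb * sb) + ca * sa * (cc * cc + sc * sc)); first by ring.
by rewrite hb hc; ring.
Qed.

Lemma par_frame_vertical a b c : let x := param a b c in
  [/\ dot (x *m qI) (par_a a b c) = 0, dot (x *m qI) (par_b a b c) = cos a ^+ 2
    & dot (x *m qI) (par_c a b c) = sin a ^+ 2].
Proof.
rewrite /= -[param a b c]/(row4 (cos a * cos b) (cos a * sin b) (sin a * cos c) (sin a * sin c)).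
have hb := cs b; have hc := cs c.
rewrite /par_a /par_b /par_c; split; rewrite dotE !co_qI !co_row4;
  move: (cos a) (sin a) (cos b) (sin b) (cos c) (sin c) hb hc => ca sa cb sb cc sc hb hc.
- by ring.
- transitivity (ca ^+ 2 * (cb * cb + sb * sb)); first by ring.
  by rewrite hb; ring.
- transitivity (sa ^+ 2 * (cc * cc + sc * sc)); first by ring.
  by rewrite hc; ring.
Qed.

Lemma par_frame_dot a b c :
  [/\ dot (par_a a b c) (par_a a b c) = 1, dot (par_b a b c) (par_b a b c) = cos a ^+ 2
    & dot (par_c a b c) (par_c a b c) = sin a ^+ 2] /\
  [/\ dot (par_a a b c) (par_b a b c) = 0, dot (par_a a b c) (par_c a b c) = 0
    & dot (par_b a b c) (par_c a b c) = 0].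
Proof.
have hb := cs b; have hc := cs c; have ha := cs a.
rewrite /par_a /par_b /par_c; do 2 split; rewrite dotE !co_row4;
  move: (cos a) (sin a) (cos b) (sin b) (cos c) (sin c) ha hb hc => ca sa cb sb cc sc ha hb hc.
- transitivity (sa * sa * (cb * cb + sb * sb) + ca * ca * (cc * cc + sc * sc)); first by ring.
  by rewrite ha hb hc; ring.
- transitivity (ca ^+ 2 * (cb * cb + sb * sb)); first by ring.
  by rewrite hb; ring.
- transitivity (sa ^+ 2 * (cc * cc + sc * sc)); first by ring.
  by rewrite hc; ring.
- by ring.
- by ring.
- by ring.
Qed.

Lemma param_frameE a b c :
  param_frame a b c = col_mx (par_a a b c) (col_mx (par_b a b c) (par_c a b c)).
Proof.
have [_ ha] := is_derive_par_a a b c; have [_ hb] := is_derive_par_b a b c.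
have [_ hc] := is_derive_par_c a b c.
by rewrite /param_frame !derive1E ha hb hc.
Qed.

(** The Gram matrix is diag(1, cos^2 a, sin^2 a) plus t^2 - 1 times the square of the covector (0,
    cos^2 a, sin^2 a) of vertical components. This rank one update multiplies the determinant by 1 +
    (t^2 - 1)(cos^2 a + sin^2 a) = t^2. *)
Lemma det_gram a b c t :
  \det (gram (berger t) (param a b c) (param_frame a b c)) = (t * (cos a * sin a)) ^+ 2.
Proof.
pose w k := nth 0 [:: par_a a b c; par_b a b c; par_c a b c] k.
have Sx := param_S3 a b c.
have -> : gram (berger t) (param a b c) (param_frame a b c) =
    \matrix_(i < 3, j < 3) (fun i j : nat => berger t (param a b c) (w i) (w j)) i j.
  have rE i : row i (param_frame a b c) = w i.
    apply/rowP => k; rewrite mxE param_frameE (col3E _ _ _ i k).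
    by case: i => -[|[|[|//]]].
  by apply/matrixP => i j; rewrite !mxE !rE.
have [ta tb tc] := par_frame_tangent a b c.
have [va vb vc] := par_frame_vertical a b c.
have [[aa bb cc] [ab ac bc]] := par_frame_dot a b c.
rewrite (det3 (fun i j => berger t (param a b c) (w i) (w j))) /w /= !bergerE //.
rewrite ?[dot (par_b _ _ _) (par_a _ _ _)]dotC ?[dot (par_c _ _ _) (par_a _ _ _)]dotC ?[dot (par_c _ _ _) (par_b _ _ _)]dotC.
rewrite va vb vc aa bb cc ab ac bc.
have := cs a; move: (cos a) (sin a) => ca sa h.
transitivity ((ca * sa) ^+ 2 * ((1 + (t ^+ 2 - 1) * (ca * ca)) * (1 + (t ^+ 2 - 1) * (sa * sa)) - (t ^+ 2 - 1) ^+ 2 * (ca * ca * (sa * sa)))).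
  by ring.
by rewrite h; ring.
Qed.

Lemma volume_density t (p : R * R * R) : 0 < t -> param_dom p ->
  Num.sqrt (\det (gram (berger t) (param p.1.1 p.1.2 p.2) (param_frame p.1.1 p.1.2 p.2))) = t * wt p.
Proof.
move=> t0 bp; rewrite det_gram sqrtr_sqr ger0_norm //.
by rewrite mulr_ge0 ?(ltW t0) ?wt_ge0.
Qed.

Lemma integral_S3_berger t (h e : V -> R) : 0 < t -> sm e -> (forall x, S3 x -> h x = e x) ->
  integral_S3 (berger t) h = (t * Int e)%:E.
Proof.
move=> t0 se he; rewrite /integral_S3.
have be := bmeas_Int se; have bte := bmeasM (bmeas_cst t) be.
rewrite /Int -(boxintZ t be) /boxint /Rintegral fineK.
  apply: eq_integral => p; rewrite inE => bp.
  rewrite (volume_density t0 bp) he; last exact: param_S3.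
  by congr (_%:E); rewrite /par; ring.
apply: integrable_fin_num; [exact: measurable_box|exact: (bmeas_integrable bte)].
Qed.

Lemma sumsq_neg t (p q r a b c : R) : p = - a -> q = - b -> r = - c ->
  p ^+ 2 + (q ^+ 2 + r ^+ 2) / t ^+ 2 = a ^+ 2 + (b ^+ 2 + c ^+ 2) / t ^+ 2.
Proof. by move=> -> -> ->; rewrite !sqrrN. Qed.

Lemma sumsq_unit t (p q r : R) : p = - 1 -> q = 0 -> r = 0 -> p ^+ 2 + (q ^+ 2 + r ^+ 2) / t ^+ 2 = 1.
Proof. by move=> -> -> ->; rewrite sqrrN expr1n !expr0n /= addr0 mul0r addr0. Qed.

Section LiftedEnergy.
Variables (f : V -> 'rV[R]_3) (psi : nat -> V -> R).
Hypothesis spsi : smf psi.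
Hypothesis psi1 : forall x, S3 x -> dotn (psi^~ x) (psi^~ x) = 1.
Hypothesis fpsi : forall x j, S3 x -> (j < 3)%N -> f x 0 (inord j) = hopfn (psi^~ x) j.

Let area A B x := omega (XF A psi ^~ x) (XF B psi ^~ x).

Lemma sqnorm_lift t x : 0 < t -> S3 x -> sqnorm_form2 (berger t) x (pullback_area f x) =
  area qJ qK x ^+ 2 + (area qK qI x ^+ 2 + area qI qJ x ^+ 2) * t ^- 2.
Proof.
move=> t0 Sx; have tn0 : t != 0 by rewrite lt0r_neq0.
have [tI tJ tK] := And3 (@tangent_qI R) (@tangent_qJ R) (@tangent_qK R).
have F A B (tA : tangent_field A) (tB : tangent_field B) := pullback_lift spsi psi1 fpsi Sx tA tB.
have BD a u v w := pullback_linear spsi fpsi a u v w Sx.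
apply: (etrans (sqnorm_berger Sx tn0 BD (@pullback_alt R f x))).
exact: (sumsq_neg t (F _ _ tJ tK) (F _ _ tK tI) (F _ _ tI tJ)).
Qed.

Lemma energy_lift t : 0 < t ->
  energy (berger t) f = (2^-1 * (t * Int (fun x => area qJ qK x ^+ 2 + (area qK qI x ^+ 2 + area qI qJ x ^+ 2) * t ^- 2)))%:E.
Proof.
move=> t0.
have [s1 s2 s3] := And3 (sm_area spsi qJ qK) (sm_area spsi qK qI) (sm_area spsi qI qJ).
rewrite /energy (integral_S3_berger t0 (e := fun x => area qJ qK x ^+ 2 + (area qK qI x ^+ 2 + area qI qJ x ^+ 2) * t ^- 2)) //.
  exact: smD (sm_expr 2 s1) (smM (smD (sm_expr 2 s2) (sm_expr 2 s3)) (sm_cst (t ^- 2))).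
by move=> x; exact: sqnorm_lift.
Qed.

End LiftedEnergy.

Lemma energy_hopf t : 0 < t -> energy (berger t) (@hopf R) = (2^-1 * (t * Int (fun=> 1)))%:E.
Proof.
move=> t0; rewrite /energy (integral_S3_berger t0 (e := fun=> 1)) //; first exact: sm_cst.
move=> x Sx; have tn0 : t != 0 by rewrite lt0r_neq0.
have [JK KI IJ] := pullback_hopf_frame Sx.
have spsi : smf (fun k (x : V) => co x k) by move=> k; exact: sm_co.
have fpsi y j : S3 y -> (j < 3)%N -> hopf y 0 (inord j) = hopfn (co y) j :> R.
  by move=> _ j3; rewrite mxE inordK.
have BD a u v w := pullback_linear spsi fpsi a u v w Sx.
apply: (etrans (sqnorm_berger Sx tn0 BD (@pullback_alt R (@hopf R) x))).
exact: (sumsq_unit t JK KI IJ).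
Qed.

End Volume.

Theorem mainTheorem2 (R : realType) (t : R) (ht0 : 0 < t) (ht1 : t <= 1)
    (phi : 'rV[R]_4 -> 'rV[R]_3) (hphi : smooth_S3_S2 phi)
    (hhom : homotopic_S3_S2 phi (@hopf R)) :
  (energy (berger t) (@hopf R) <= energy (berger t) phi)%E.
Proof.
have [psi [spsi psi1 J1 fpsi]] := exact_lift hphi (homotopic_liftable hhom).
rewrite (energy_hopf ht0) (energy_lift spsi psi1 fpsi ht0) lee_fin.
(* Both energies carry the factor t/2, so only integrals for the round volume are left to
   compare. *)
rewrite ler_wpM2l ?invr_ge0 // ler_wpM2l ?(ltW ht0) //.
apply: (le_trans (area_bound spsi J1)).
have [s1 s2 s3] := And3 (sm_area spsi (qJ R) (qK R)) (sm_area spsi (qK R) (qI R)) (sm_area spsi (qI R) (qJ R)).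
apply: Int_le.
- exact: (sm_sumsq s1 s2 s3).
- exact: (smD (sm_expr 2 s1) (smM (smD (sm_expr 2 s2) (sm_expr 2 s3)) (sm_cst (t ^- 2)))).
move=> x _; rewrite -addrA lerD2l ler_peMr ?addr_ge0 ?sqr_ge0 //.
by rewrite invf_ge1 ?exprn_gt0 // exprn_ile1 // ltW.
Qed.
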